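(* Let $K$ be a field, $X=(X_{ij})$ an $m\times n$ matrix of indeterminates, and let $I\subset K[X]$ be an ideal defined by shape. If $I$ is G-KRS, then $I$ is a sum of ideals each of which is of type $J(k,d)\cap I_1^u$ or, in the case $m=n$, of type $\bigl(J(k,d)\cap I_1^u\bigr)I_n^v$ (with integers $k\ge1$ and $d,u,v\ge0$ depending on the summand).
   Context: A minor is $[a_1,\dots,a_t\mid b_1,\dots,b_t]=\det(X_{a_ib_j})_{1\le i,j\le t}$ with $1\le a_1<\dots<a_t\le m$, $1\le b_1<\dots<b_t\le n$; its size is $t$, and the empty minor (size $0$) is $1$. $I_t$ is the ideal of $K[X]$ generated by the minors of size $t$, and $I_0=K[X]$. With $p=\min(m,n)$, for integers $k\ge1$, $d\ge0$, $$J(k,d)=\sum I_0^{e_0}I_1^{e_1}\cdots I_p^{e_p},$$ the sum over all non-negative integers $e_0,\dots,e_p$ with $e_0+\dots+e_p=k$ and $e_1+2e_2+\dots+pe_p=d$. A bitableau is a product $\Delta=\delta_1\cdots\delta_w$ of minors ordered so that $|\delta_1|\ge\dots\ge|\delta_w|$, where $|\delta|$ is the size of $\delta$; its shape is $|\Delta|=(|\delta_1|,\dots,|\delta_w|)$ (up to trailing zeros). It is written $(a_{ij}\mid b_{ij})$, where $a_{i1}<a_{i2}<\cdots$ and $b_{i1}<b_{i2}<\cdots$ are the row and column indices of $\delta_i$ (row $i$ of the left and right tableau). Partial order on minors: $[a_1,\dots,a_t\mid b_1,\dots,b_t]\preceq[c_1,\dots,c_u\mid d_1,\dots,d_u]$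 iff $t\ge u$ and $a_i\le c_i$, $b_i\le d_i$ for $i=1,\dots,u$. The bitableau is standard if $\delta_1\preceq\dots\preceq\delta_w$. The standard bitableaux form a $K$-basis of $K[X]$. An ideal has a standard basis if it is the $K$-span of the standard bitableaux contained in it. An ideal $I$ is defined by shape if it is generated as an ideal by a set of bitableaux and, moreover, it depends only on $|\Delta|$ whether a bitableau $\Delta$ belongs to $I$. KRS: for a non-empty standard bitableau $\Sigma=(a_{ij}\mid b_{ij})$ let $\ell$ be the largest entry of the left tableau, and let $(p,q)$ be the position with $a_{pq}=\ell$ having largest row index $p$. Remove the boxes at position $(p,q)$ from both tableaux and put $s=b_{pq}$. While $p>1$: in row $p-1$ of the right tableau, replace the rightmost entry that is $\le s$ by $s$, let $s$ be the replaced entry, and replace $p$ by $p-1$. When $p=1$ put $r=s$. The result is a standard bitableau $\Sigma'$ and a pair $(\ell,r)$. Define recursively $\operatorname{KRS}(1)=1$ and $\operatorname{KRS}(\Sigma)=\operatorname{KRS}(\Sigma')X_{\ell r}$. This is a bijection from standard bitableaux to monomials of $K[X]$, and it is extended $K$-linearly to a vector space automorphism $\operatorname{KRS}$ of $K[X]$. Initial ideals are taken with respect to a fixed diagonal term order on $K[X]$, i.e. a term order for which $\operatorname{in}([a_1,\dots,a_t\mid b_1,\dots,b_t])=X_{a_1b_1}\cdots X_{a_tb_t}$ for every minor. An ideal $I$ with a standard basis is in-KRS if $\operatorname{in}(I)=\operatorname{KRS}(I)$, and it is G-KRS if, in addition, the bitableaux $\Delta\in I$ form a Gröbner basis of $I$.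 *)

(* Defs.v *)
From HB Require Import structures.
From mathcomp Require Import all_boot all_order all_algebra.
From mathcomp Require Import mpoly.

Set Implicit Arguments.
Unset Strict Implicit.
Unset Printing Implicit Defensive.

Import GRing.Theory.

Local Open Scope ring_scope.

(* Subsets (in particular ideals) of a ring or vector space are Prop-valued
   predicates: mathcomp's [idealr] is boolean and only covers proper ideals. *)
Definition same_set (T : Type) (A B : T -> Prop) : Prop := forall x, A x <-> B x.

Definition set_inter (T : Type) (A B : T -> Prop) : T -> Prop :=
  fun x => A x /\ B x.

Section Ideals.
Variable R : comNzRingType.
Implicit Types (A B S : R -> Prop).

Definition is_ideal A : Prop :=
  [/\ A 0, forall x y, A x -> A y -> A (x + y) & forall a x, A x -> A (a * x)].

Definition ideal_gen S : R -> Prop := fun x =>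
  exists2 s : seq (R * R),
    (forall y, y \in s -> S y.2) & x = \sum_(y <- s) y.1 * y.2.

Definition ideal_full : R -> Prop := fun _ => True.

Definition ideal_mul A B : R -> Prop :=
  ideal_gen (fun z => exists x y, [/\ A x, B y & z = x * y]).

Definition ideal_exp A (k : nat) : R -> Prop := iter k (ideal_mul A) ideal_full.

(* The sum of the ideals [F i] over the indices [i] satisfying [P]. *)
Definition ideal_sum (T : Type) (P : T -> Prop) (F : T -> R -> Prop) : R -> Prop :=
  ideal_gen (fun x => exists2 i, P i & F i x).

End Ideals.

Definition lin_span (K : fieldType) (V : lmodType K) (S : V -> Prop) : V -> Prop :=
  fun x => exists2 s : seq (K * V),
    (forall y, y \in s -> S y.2) & x = \sum_(y <- s) y.1 *: y.2.

(* Row and column indices are numbered from 0. The indeterminate X_ij of the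
   m x n matrix is the variable of {mpoly K[m * n]} of index [mxvec_index i j]. *)
Notation mxpoly_ring K m n := {mpoly K[(m * n)%N]}.
Notation mxmonom m n := 'X_{1..(m * n)%N}.

(* The minor [a_1, ..., a_t | b_1, ..., b_t] is encoded by the sequence of
   pairs (a_1, b_1), ..., (a_t, b_t), and the bitableau d_1 ... d_w by the
   sequence of its minors; taking first (resp. second) components gives the
   left (resp. right) tableau. Empty minors are allowed. *)
Notation cell m n := ('I_m * 'I_n)%type.

Section Bitableaux.
Variables m n : nat.
Implicit Types (d e : seq (cell m n)) (D : seq (seq (cell m n))).

Definition is_minor d : bool :=
  sorted (fun x y : cell m n => (x.1 < y.1)%N && (x.2 < y.2)%N) d.

Definition bitableau D : bool := all is_minor D && sorted geq (map size D).

Definition shape D : seq nat := [seq t <- map size D | (0 < t)%N].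

Definition minor_le d e : bool :=
  (size e <= size d)%N &&
  all (fun xy : cell m n * cell m n =>
         (xy.1.1 <= xy.2.1)%N && (xy.1.2 <= xy.2.2)%N) (zip d e).

Definition standard D : bool := bitableau D && sorted minor_le D.

Definition cell_mnm (x : cell m n) : mxmonom m n := U_(mxvec_index x.1 x.2)%MM.

Definition diag_mnm d : mxmonom m n := (\sum_(x <- d) cell_mnm x)%MM.

(* [krs_pluck l d] removes the cell of [d] with left entry [l], and also
   returns it. *)
Fixpoint krs_pluck (l : nat) d : option (seq (cell m n) * cell m n) :=
  if d is x :: d1 then
    if x.1 == l :> nat then Some (d1, x)
    else if krs_pluck l d1 is Some (d1', y) then Some (x :: d1', y) else None
  else None.

(* [krs_bump s d] replaces by [s] the rightmost right entry of [d] that is at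
   most [s], and also returns the replaced entry. *)
Fixpoint krs_bump (s : 'I_n) d : option (seq (cell m n) * 'I_n) :=
  if d is x :: d1 then
    if krs_bump s d1 is Some (d1', s') then Some (x :: d1', s')
    else if (x.2 <= s)%N then Some ((x.1, s) :: d1, x.2)
    else None
  else None.

(* Plucks [l] from the lowest row that contains it, then bumps upwards through
   all the rows above. In a standard bitableau the bumping never fails. *)
Fixpoint krs_delete (l : nat) D : option (seq (seq (cell m n)) * cell m n) :=
  if D is d :: D1 then
    if krs_delete l D1 is Some (D1', x) then
      if krs_bump x.2 d is Some (d', s) then Some (d' :: D1', (x.1, s))
      else None
    else if krs_pluck l d is Some (d', x) then Some (d' :: D1, x)
    else None
  else None.

Definition krs_step D : option (seq (seq (cell m n)) * cell m n) :=
  krs_delete (\max_(x <- flatten D) x.1)%N D.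

Fixpoint krs_iter (k : nat) D : mxmonom m n :=
  if k is k1.+1 then
    if krs_step D is Some (D', x) then (krs_iter k1 D' + cell_mnm x)%MM else 0%MM
  else 0%MM.

(* The exponent of the monomial KRS(D); each step removes one cell. *)
Definition krs_mnm D : mxmonom m n := krs_iter (size (flatten D)) D.

End Bitableaux.

Section Polynomials.
Variables (K : fieldType) (m n : nat).
Implicit Types (I S : mxpoly_ring K m n -> Prop) (f g : mxpoly_ring K m n).
Implicit Types (d : seq (cell m n)) (D : seq (seq (cell m n))).

Definition minor_poly d : mxpoly_ring K m n :=
  \det (\matrix_(i < size d, j < size d)
    'X_(mxvec_index (tnth (in_tuple d) i).1 (tnth (in_tuple d) j).2)).

Definition bitab_poly D : mxpoly_ring K m n := \prod_(d <- D) minor_poly d.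

Definition det_ideal (t : nat) : mxpoly_ring K m n -> Prop :=
  ideal_gen (fun f => exists2 d, is_minor d && (size d == t) & f = minor_poly d).

Definition J_ideal (k d : nat) : mxpoly_ring K m n -> Prop :=
  ideal_sum
    (fun e : 'I_(minn m n).+1 -> nat =>
       (\sum_(i < (minn m n).+1) e i = k)%N /\
       (\sum_(i < (minn m n).+1) i * e i = d)%N)
    (fun e => \big[@ideal_mul _/@ideal_full _]_(i < (minn m n).+1)
                ideal_exp (det_ideal i) (e i)).

Definition has_standard_basis I : Prop :=
  same_set I (lin_span (fun f =>
    exists2 D, standard D /\ I (bitab_poly D) & f = bitab_poly D)).

Definition defined_by_shape I : Prop :=
  (exists2 G : seq (seq (cell m n)) -> Prop,
     forall D, G D -> bitableau D
     & same_set I (ideal_gen (fun f => exists2 D, G D & f = bitab_poly D)))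
  /\ (forall D D' : seq (seq (cell m n)),
        bitableau D -> bitableau D' -> shape D = shape D' ->
        I (bitab_poly D) <-> I (bitab_poly D')).

(* The graph of the K-linear extension of KRS from the basis of standard
   bitableaux to the whole polynomial ring. *)
Definition KRS_graph f g : Prop :=
  exists s : seq (K * seq (seq (cell m n))),
    [/\ all (fun y => standard y.2) s,
        f = \sum_(y <- s) y.1 *: bitab_poly y.2
      & g = \sum_(y <- s) y.1 *: 'X_[krs_mnm y.2]].

Definition KRS_image S : mxpoly_ring K m n -> Prop :=
  fun g => exists2 f, S f & KRS_graph f g.

Variable le : rel (mxmonom m n).

Definition term_order : Prop :=
  [/\ total le, antisymmetric le, transitive le,
      forall u, le 0%MM u
    & forall u v w : mxmonom m n, le u v -> le (u + w)%MM (v + w)%MM].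

(* [u] is the exponent of the initial monomial of [f], which is nonzero. *)
Definition initial_mnm f (u : mxmonom m n) : Prop :=
  u \in msupp f /\ forall v, v \in msupp f -> le v u.

Definition diagonal_term_order : Prop :=
  term_order /\ forall d, is_minor d -> initial_mnm (minor_poly d) (diag_mnm d).

Definition initial_ideal S : mxpoly_ring K m n -> Prop :=
  ideal_gen (fun g => exists f u, [/\ S f, initial_mnm f u & g = 'X_[u]]).

Definition groebner_basis I S : Prop :=
  (forall f, S f -> I f) /\ same_set (initial_ideal I) (initial_ideal S).

Definition in_KRS I : Prop :=
  has_standard_basis I /\ same_set (initial_ideal I) (KRS_image I).

Definition G_KRS I : Prop :=
  in_KRS I /\
  groebner_basis I (fun f =>
    exists2 D, bitableau D /\ I (bitab_poly D) & f = bitab_poly D).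

End Polynomials.

(* Main.v *)
Require Import Defs.
From HB Require Import structures.
From mathcomp Require Import all_boot all_order all_algebra.
From mathcomp Require Import mpoly.
From mathcomp Require Import zify.
From Stdlib Require Import Classical.

Set Implicit Arguments.
Unset Strict Implicit.
Unset Printing Implicit Defensive.

Import GRing.Theory.

(** Whether a bitableau belongs to I depends on its shape only, so that I is
    governed by the set S of the shapes of its bitableaux. S is closed under adding
    parts, and the G-KRS hypothesis provides two more properties of S.

    - As in(I) is contained in KRS(I) and KRS is injective on standard bitableaux, a
      standard bitableau lies in I as soon as its KRS monomial is the initial
      monomial of a bitableau in I ([krs_pullback]). For a product of minors on the
      rows and columns 0, 1, 2, and so on, the KRS monomial is the product of the
      diagonals, which can be cut into chains of other lengths. It follows that S is
      stable under moving a box from a part to a part that is at least as large and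
      smaller than min(m,n) ([move_box]).

    - As KRS(I) is contained in in(I), which is generated by the diagonals of the
      bitableaux in I, the KRS monomial of a standard bitableau in I is divisible by
      the initial monomial of a bitableau in I ([krs_divisible]). For a shape s with
      two parts a >= 2 and x >= a + 2, x < max(m,n), there is a standard bitableau of
      shape s whose KRS monomial is computed explicitly ([wide_run], [tall_run]).
      A covering by antichains, as in Greene's theorem, shows that the shapes of the
      initial monomials dividing it are dominated by s ([dominated]), and a finer
      count that s itself is not among them ([no_decomposition]). So if s is in S,
      then S contains a shape strictly below s in the dominance order
      ([unbalanced]).

    By descent, every shape in S dominates a shape in S whose parts are v times n
    (with v = 0 unless m = n), k parts of sum d any two of which differ by at most
    one, and l times 1 ([reduce], [nearly_split]). Consider the ideal
    A = (J(k,d) intersected with I_1^(d+l)) I_n^v for this shape. It is generated by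
    bitableaux, whose shapes arise from the given one by box moves and additional
    parts, so A is contained in I ([summand_sub]). Conversely Laplace expansion
    shows that A contains all bitableaux whose shape dominates the given one
    ([summand_mem]). Hence I is the sum of such ideals, and Dickson's lemma for the
    multiplicities of the parts reduces the sum to a finite one. *)

(** * KRS and its inverse on pairs of natural numbers *)

(** Cells are pairs of natural numbers here, so that explicit tableaux can be
    written without ordinals. *)
Notation pt := (nat * nat)%type.
Notation o := (0, 0).

Section KRScomb.
Implicit Types (d e : seq pt) (D : seq (seq pt)) (x y z : pt) (l r s t : nat).

Definition slt x y := (x.1 < y.1) && (x.2 < y.2).
Definition chain d := sorted slt d.
Definition row_le d e :=
  (size e <= size d) && all (fun xy : pt * pt => (xy.1.1 <= xy.2.1) && (xy.1.2 <= xy.2.2)) (zip d e).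
Arguments row_le : simpl never.
Arguments chain : simpl never.
Definition std D := all chain D && sorted row_le D.

Fixpoint pluck l d : option (seq pt * pt) :=
  if d is x :: d1 then
    if x.1 == l then Some (d1, x)
    else if pluck l d1 is Some (d1', y) then Some (x :: d1', y) else None
  else None.

Fixpoint bump_row s d : option (seq pt * nat) :=
  if d is x :: d1 then
    if bump_row s d1 is Some (d1', s') then Some (x :: d1', s')
    else if x.2 <= s then Some ((x.1, s) :: d1, x.2)
    else None
  else None.

Fixpoint delete l D : option (seq (seq pt) * pt) :=
  if D is d :: D1 then
    if delete l D1 is Some (D1', x) then
      if bump_row x.2 d is Some (d', s) then Some (d' :: D1', (x.1, s))
      else None
    else if pluck l d is Some (d', x) then Some (d' :: D1, x)
    else None
  else None.

(** Inverse of [bump_row]: [r] takes the place of the leftmost right entry that is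
    at least [r]. When there is none, [insert] stops, since this is the row from
    which [delete] plucked a cell. *)
Fixpoint insert_row r d : option (seq pt * nat) :=
  if d is x :: d1 then
    if r <= x.2 then Some ((x.1, r) :: d1, x.2)
    else if insert_row r d1 is Some (d1', s) then Some (x :: d1', s) else None
  else None.

Fixpoint insert x D : seq (seq pt) :=
  if D is d :: D1 then
    if insert_row x.2 d is Some (d', s) then d' :: insert (x.1, s) D1
    else rcons d x :: D1
  else [::].

Lemma insert_cons x d D : insert x (d :: D) =
  if insert_row x.2 d is Some (d', s) then d' :: insert (x.1, s) D else rcons d x :: D.
Proof. by []. Qed.

Lemma slt_trans : transitive slt.
Proof. by move=> y x z /andP[a b] /andP[c e]; rewrite /slt; lia. Qed.

Lemma chain_cat d1 x d2 : chain (d1 ++ x :: d2) ->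
  [/\ chain d1, chain d2, {in d1, forall y, slt y x}, {in d2, forall y, slt x y}
    & {in d1 & d2, forall y z, slt y z}].
Proof.
rewrite /chain !(sorted_pairwise slt_trans) pairwise_cat /= => /and3P[].
rewrite allrel_consr => /andP[/allP h1 /allrelP h2] p1 /andP[/allP h3 p2].
by split=> // y z; exact: h2.
Qed.

Lemma chain_catI d1 x d2 : chain d1 -> chain d2 -> {in d1, forall y, slt y x} ->
  {in d2, forall y, slt x y} -> chain (d1 ++ x :: d2).
Proof.
move=> c1 c2 h1 h2; rewrite /chain in c1 c2 *; rewrite !(sorted_pairwise slt_trans) pairwise_cat /=.
rewrite allrel_consr -!(sorted_pairwise slt_trans) c1 c2 !andbT -andbA.
apply/and3P; split; first by apply/allP.
  by apply/allrelP => y z hy hz; apply: (slt_trans (h1 _ hy) (h2 _ hz)).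
by apply/allP.
Qed.

Lemma row_leP d e : reflect (size e <= size d /\
    forall c, c < size e -> (nth o d c).1 <= (nth o e c).1 /\ (nth o d c).2 <= (nth o e c).2)
  (row_le d e).
Proof.
apply: (iffP andP) => [[sz /allP h]|[sz h]]; split=> //.
  move=> c hc; have hz : c < size (zip d e) by rewrite size_zip (minn_idPr sz).
  by have := h _ (mem_nth (o, o) hz); rewrite nth_zip_cond hz /= => /andP.
apply/(all_nthP (o, o)) => c hz; rewrite nth_zip_cond hz /=.
rewrite size_zip (minn_idPr sz) in hz; move: hz => hc.
by have [-> ->] := h _ hc.
Qed.

Lemma bump_rowP s d :
  match bump_row s d with
  | None => {in d, forall x, s < x.2}
  | Some (d', t) => exists d1 x d2, [/\ d = d1 ++ x :: d2, d' = d1 ++ (x.1, s) :: d2,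
        t = x.2, x.2 <= s & {in d2, forall y, s < y.2}]
  end.
Proof.
elim: d => [|x d IH] //=.
case: (bump_row s d) IH => [[d' t] [d1 [y [d2 [-> -> -> h1 h2]]]]|IH].
  by exists (x :: d1), y, d2; split.
case: leqP => hx; first by exists [::], x, d.
by move=> y; rewrite inE => /predU1P[->|/IH].
Qed.

Lemma pluckP l d :
  match pluck l d with
  | None => {in d, forall x, x.1 != l}
  | Some (d', x) => exists d1 d2, [/\ d = d1 ++ x :: d2, d' = d1 ++ d2 & x.1 = l]
  end.
Proof.
elim: d => [|x d IH] //=.
case: eqP => hx; first by exists [::], d.
case: (pluck l d) IH => [[d' y] [d1 [d2 [-> -> h1]]]|IH].
  by exists (x :: d1), d2.
by move=> y; rewrite inE => /predU1P[->|/IH//]; apply/eqP.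
Qed.

Lemma insert_row_at r d1 x d2 : {in d1, forall y, y.2 < r} -> r <= x.2 ->
  insert_row r (d1 ++ x :: d2) = Some (d1 ++ (x.1, r) :: d2, x.2).
Proof.
elim: d1 => [|y d1 IH] /= h hr; first by rewrite hr.
rewrite leqNgt (h y) ?mem_head //= IH // => z hz.
by apply: h; rewrite inE hz orbT.
Qed.

Lemma insert_row_none r d : {in d, forall y, y.2 < r} -> insert_row r d = None.
Proof.
elim: d => [|y d1 IH] //= h.
rewrite leqNgt (h y) ?mem_head //= IH // => z hz.
by apply: h; rewrite inE hz orbT.
Qed.

Definition lefts D := [seq x.1 | x <- flatten D].

Lemma delete_none l D : l \notin lefts D -> delete l D = None.
Proof.
elim: D => [|d D IH] //=; rewrite /lefts /= map_cat mem_cat negb_or => /andP[h1 /IH ->].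
have := pluckP l d; case: (pluck l d) => // -[d' x] [d1 [d2 [E _ hx]]].
by case/negP: h1; rewrite E map_cat mem_cat /= hx mem_head orbT.
Qed.

(** What the row above [d] has to know about a deletion in order to continue the
    bumping: the outgoing entry [s] was an entry of [d], and the right entries of
    the new row [d'] have only grown. *)
Definition head_dom d d' s :=
  (exists2 q, q < size d & (nth o d q).2 = s) /\ (size d' <= size d /\
  forall c, c < size d' -> (nth o d' c).1 = (nth o d c).1 /\ (nth o d c).2 <= (nth o d' c).2).

(** The bumping never fails: by the column condition, the entry above the one that
    left the row below is at most that entry. The replaced entry sits weakly to the
    right of this position, which keeps the columns in order and makes the step
    invertible. *)
Lemma delete_std l D : std D -> {in lefts D, forall k, k <= l} -> l \in lefts D ->
  exists D' x, [/\ delete l D = Some (D', x), std D', x.1 = l /\ insert x D' = D,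
    size D' = size D /\ perm_eq (lefts D) (l :: lefts D')
    & head_dom (head [::] D) (head [::] D') x.2].
Proof.
elim: D => [|d D IH] //= /andP[/= /andP[cd cD] pD] hle hin.
have sD : std D by rewrite /std cD (path_sorted pD).
have hleD : {in lefts D, forall k, k <= l}.
  by move=> k hk; apply: hle; rewrite /lefts /= map_cat mem_cat hk orbT.
have hled : {in d, forall x, x.1 <= l}.
  by move=> k hk; apply: hle; rewrite /lefts /= map_cat mem_cat map_f.
have [hl|hl] := boolP (l \in lefts D).
  have [D' [x [-> sD' [x1 insx] [szD' pe] [[q hq1 hq2] [hs hc]]]]] := IH sD hleD hl.
  case: D pD {IH} sD hle hin hleD hl insx szD' pe hs hc hq1 hq2 cD => [|e D] // pD sD hle hin hleD hl insx szD' pe hs hc hq1 hq2 cD.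
  case: D' sD' insx szD' pe hs hc => [|e' D'] // sD' insx szD' pe hs hc.
  rewrite /= in hq1 hq2 hs hc.
  have /row_leP[sz rle] : row_le d e by case/andP: pD.
  have [r1 r2] := rle _ hq1.
  have := bump_rowP x.2 d; case: (bump_row x.2 d) => [[d' t] [d1 [y [d2 [E E' -> yx h2]]]]|H]; last first.
    have hm : nth o d q \in d by apply: mem_nth; exact: leq_trans hq1 sz.
    by have := H _ hm; rewrite -hq2; lia.
  have szd : size d' = size d by rewrite E E' !size_cat.
  have hq : q <= size d1.
    rewrite leqNgt; apply/negP => hq.
    have : nth o d q \in d2.
      rewrite E nth_cat ltnNge (ltnW hq) /=.
      have -> : q - size d1 = (q - size d1).-1.+1 by lia.
      rewrite /=; apply: mem_nth; move: hq1 sz; rewrite E size_cat /=; lia.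
    by move/h2; lia.
  have nthE c : c != size d1 -> nth o d' c = nth o d c.
    move=> hcc; rewrite E E' !nth_cat; case: ltnP => // h.
    by have -> : c - size d1 = (c - size d1).-1.+1 by lia.
  have nth1 : nth o d (size d1) = y by rewrite E nth_cat ltnn subnn.
  have nth2 : nth o d' (size d1) = (y.1, x.2) by rewrite E' nth_cat ltnn subnn.
  have chd' : chain d'.
    move: cd; rewrite E E' => /chain_cat[c1 c2 c3 c4 c5].
    apply: chain_catI => // z hz.
      by move/c3: hz; rewrite /slt /=; lia.
    by have := c4 _ hz; have := h2 _ hz; rewrite /slt /=; lia.
  have rd' : row_le d' e'.
    apply/row_leP; rewrite szd; split=> [|c hcc]; first by lia.
    have hce : c < size e by lia.
    have [a1 a2] := hc _ hcc; have [b1 b2] := rle _ hce.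
    have [ec|ne] := eqVneq c (size d1); last by rewrite nthE //; lia.
    subst c.
    rewrite nth2 /=; split; first by rewrite -nth1; lia.
    have : (nth o e q).2 <= (nth o e (size d1)).2.
      have [->//|ne] := eqVneq q (size d1).
      have /andP[_ /ltnW //] : slt (nth o e q) (nth o e (size d1)).
      case/andP: cD => ce _.
      have lq : q < size d1 by lia.
      have le' : size d1 < size e by lia.
      by apply: (sorted_ltn_nth slt_trans o ce); rewrite ?inE.
    by lia.
  exists [:: d', e' & D'], (x.1, y.2); split => //.
  - by move: sD'; rewrite /std /= rd' chd' /=.
  - split=> //; rewrite insert_cons -[(x.1, y.2).2]/y.2.
    have -> : insert_row y.2 d' = Some (d, x.2).
      rewrite E E' insert_row_at //; first by case: (y).
      move: cd; rewrite E => /chain_cat[_ _ c3 _ _] z /c3 /andP[] //.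
    by rewrite -[(_, x.2)]/(x.1, x.2) -surjective_pairing insx.
  - split; first by move: szD' => /= [->].
    move: pe; rewrite /lefts /= !map_cat => pe.
    have -> : [seq z.1 | z <- d'] = [seq z.1 | z <- d] by rewrite E E' !map_cat.
    by rewrite (perm_catl _ pe) -cat1s perm_catCA.
  split=> /=.
    by exists (size d1); rewrite ?nth1 // E size_cat /=; lia.
  split=> [|c hcc]; first by rewrite szd.
  have [->|ne] := eqVneq c (size d1); last by rewrite nthE //; lia.
  by rewrite nth1 nth2.
have hid : l \in [seq x.1 | x <- d].
  by move: hin; rewrite /lefts /= map_cat mem_cat (negPf hl) orbF.
rewrite delete_none //.
have := pluckP l d; case: (pluck l d) => [[d' x] [d1 [d2 [E E' hx]]]|H]; last first.
  by case/mapP: hid => z /H /eqP hz E; case: hz.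
have d2E : d2 = [::].
  case: d2 E E' => // z d2 E _; move: cd; rewrite E => /chain_cat[_ _ _ h _].
  have := h z (mem_head _ _); have := hled z; rewrite E mem_cat !inE eqxx !orbT /slt hx.
  by move=> /(_ isT); lia.
move: E E'; rewrite d2E cats0 => E E'; subst d' d2.
have [cd1 _ c3 _ _] := chain_cat (etrans (congr1 chain (esym E)) cd).
have sz : size d = (size d1).+1 by rewrite E size_cat /= addn1.
have nthx : nth o d (size d1) = x by rewrite E nth_cat ltnn subnn.
exists (d1 :: D), x; split=> //.
- rewrite /std /= cd1 cD /=.
  case: D pD {IH} sD hle hin hleD hl cD => [|e D] // pD sD hle hin hleD hl cD.
  move: pD => /= /andP[/row_leP[sze hr] ->]; rewrite andbT.
  have hsz : size e <= size d1.
    rewrite leqNgt; apply/negP => h.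
    have [] := hr _ h; rewrite nthx hx => h1 _.
    have hm : (nth o e (size d1)).1 \in lefts (e :: D).
      by rewrite /lefts /= map_cat mem_cat map_f // mem_nth.
    have h2 := hleD _ hm; case/negP: hl.
    by rewrite (_ : l = (nth o e (size d1)).1) //; apply/eqP; rewrite eqn_leq h1 h2.
  apply/row_leP; split=> // c hc.
  by have := hr c hc; rewrite E nth_cat (leq_trans hc hsz).
- split=> //; rewrite insert_cons insert_row_none ?E ?cats1 // => y /c3 /andP[] //.
- split=> //; rewrite /lefts /= !map_cat E map_cat /= hx -cat1s.
  by rewrite -!catA perm_catCA.
- split=> /=; first by exists (size d1); rewrite ?nthx // sz.
  split=> [|c hc]; first by rewrite sz.
  by rewrite E nth_cat hc.
Qed.

Lemma chain_maxlast l d1 x d2 : chain (d1 ++ x :: d2) -> x.1 = l ->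
  {in d1 ++ x :: d2, forall z, z.1 <= l} -> d2 = [::].
Proof.
case: d2 => // z d2 /chain_cat[_ _ _ h _] hx hle.
have /andP[] := h z (mem_head _ _).
have := hle z; rewrite mem_cat !inE eqxx !orbT => /(_ isT).
by lia.
Qed.

Lemma delete_some l D u : delete l D = Some u -> l \in lefts D.
Proof. by move=> E; apply/negPn/negP => /delete_none; rewrite E. Qed.

Lemma lefts_cons d D : lefts (d :: D) = [seq x.1 | x <- d] ++ lefts D.
Proof. by rewrite /lefts /= map_cat. Qed.

Lemma lefts_le_cons l d D : {in lefts (d :: D), forall k, k <= l} ->
  {in d, forall z, z.1 <= l} /\ {in lefts D, forall k, k <= l}.
Proof.
move=> h; split=> [z hz|k hk]; apply: h; rewrite lefts_cons mem_cat.
  by rewrite map_f.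
by rewrite hk orbT.
Qed.

Lemma std_cons d D : std (d :: D) -> chain d /\ std D.
Proof. by move=> /andP[/= /andP[cd cD] /path_sorted pD]; rewrite /std cD. Qed.

(** The bumping paths of two successive deletions of the same left entry do not
    cross. *)
Lemma delete_mono l D D' x D'' y : std D -> {in lefts D, forall k, k <= l} ->
  delete l D = Some (D', x) -> delete l D' = Some (D'', y) -> x.2 <= y.2.
Proof.
elim: D D' x D'' y => [|d D IH] // D' x D'' y sD hle dD dD'.
have [D2 [x2 [dD2 sD2 _ _ _]]] := delete_std sD hle (delete_some dD).
move: dD2; rewrite dD => -[? ?]; subst D2 x2.
have [cd sD1] := std_cons sD.
have [hled hleD] := lefts_le_cons hle.
move: dD => /=.
case EdD: (delete l D) => [[D1' x1]|].
  have := bump_rowP x1.2 d; case: (bump_row x1.2 d) => [[d' s]|] // [d1 [u [d2 [E E' -> us h2]]]].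
  case=> ? ?; subst D' x.
  have [cd' _] := std_cons sD2.
  have hm : (u.1, x1.2) \in d' by rewrite E' mem_cat mem_head orbT.
  move: dD' => /=; case EdD': (delete l D1') => [[D1'' y1]|].
    have := bump_rowP y1.2 d'; case: (bump_row y1.2 d') => [[d'' t]|] // [e1 [w [e2 [F F' -> wy g2]]]].
    case=> _ <- /=; apply: (leq_trans us).
    have hxy := IH _ _ _ _ sD1 hleD EdD EdD'.
    move: hm; rewrite F mem_cat inE => /or3P[hm|/eqP <- //|/g2 /=]; last by lia.
    by move: cd'; rewrite F => /chain_cat[_ _ /(_ _ hm) /andP[_ /ltnW]].
  have := pluckP l d'; case: (pluck l d') => [[d'' z]|] // [e1 [e2 [F F' z1]]].
  case=> _ <- /=; apply: (leq_trans us).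
  have hle' : {in d', forall z, z.1 <= l}.
    move=> v; rewrite E' mem_cat inE => /or3P[hv|/eqP -> /=|hv]; apply: hled;
      by rewrite E mem_cat inE ?hv ?eqxx ?orbT.
  have e2E : e2 = [::] by apply: (@chain_maxlast l e1 z e2); rewrite -?F.
  move: hm; rewrite F e2E mem_cat mem_seq1 => /orP[hm|/eqP <- //].
  by move: cd'; rewrite F => /chain_cat[_ _ /(_ _ hm) /andP[_ /ltnW]].
have := pluckP l d; case: (pluck l d) => [[d' z]|] // [e1 [e2 [F F' z1]]].
case=> ? ?; subst D' z; move: dD' => /=; rewrite EdD.
have e2E : e2 = [::] by apply: (@chain_maxlast l e1 x e2); rewrite -?F.
have := pluckP l d'; case: (pluck l d') => [[d'' w]|] // [f1 [f2 [G _ w1]]].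
have hw : w \in e1 by rewrite -[e1]cats0 -e2E -F' G mem_cat mem_head orbT.
move: cd; rewrite F => /chain_cat[_ _ /(_ _ hw) /andP[]].
by rewrite w1 z1 ltnn.
Qed.

Inductive run : seq (seq pt) -> seq pt -> Prop :=
| run_nil D : flatten D = [::] -> run D [::]
| run_cons l D D' x L : {in lefts D, forall k, k <= l} ->
    delete l D = Some (D', x) -> run D' L -> run D (x :: L).

Lemma max_ex (s : seq nat) : s != [::] -> exists2 l, l \in s & {in s, forall k, k <= l}.
Proof.
elim: s => // k [|k' s] IH _.
  by exists k; rewrite ?mem_head // => ?; rewrite inE => /eqP ->.
have [//|l hl h] := IH; exists (maxn k l).
  rewrite /maxn; case: ltnP => _; first by rewrite inE hl orbT.
  by rewrite mem_head.
by move=> j; rewrite inE => /predU1P[->|/h]; lia.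
Qed.

Lemma lefts_nil D : (lefts D == [::]) = (flatten D == [::]).
Proof. by rewrite /lefts; case: (flatten D). Qed.

Lemma size_lefts D : size (lefts D) = size (flatten D).
Proof. by rewrite size_map. Qed.

Lemma run_ind_std (P : seq (seq pt) -> Prop) :
  (forall D, flatten D = [::] -> P D) ->
  (forall l D D' x, std D -> {in lefts D, forall k, k <= l} -> l \in lefts D ->
     delete l D = Some (D', x) -> std D' -> (std D' -> P D') -> P D) ->
  forall D, std D -> P D.
Proof.
move=> h0 hS D; move: {2}(size _) (erefl (size (flatten D))) => k.
elim: k D => [|k IH] D hk sD; first by apply/h0/size0nil.
have [|l hl hle] := @max_ex (lefts D); first by rewrite lefts_nil -size_eq0 hk.
have [D' [x [dD sD' _ [_ pe] _]]] := delete_std sD hle hl.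
apply: (hS l D D' x) => // _; apply: IH => //.
by have := perm_size pe; rewrite size_lefts hk /= size_lefts; lia.
Qed.

Lemma run_ex D : std D -> exists L, run D L.
Proof.
elim/run_ind_std => [D1 h|l D1 D' x _ hle _ dD sD' /(_ sD') [L rL]].
  by exists [::]; constructor.
by exists (x :: L); apply: run_cons dD rL.
Qed.

Lemma run_size D L : std D -> run D L -> size (flatten D) = size L.
Proof.
move=> sD rD; elim: rD sD => [D1 -> //|l D1 D' x L1 hle dD _ IH sD].
have [D2 [x2 [dD2 sD2 _ [_ pe] _]]] := delete_std sD hle (delete_some dD).
move: dD2; rewrite dD => -[? ?]; subst D2 x2.
by have := perm_size pe; rewrite size_lefts /= size_lefts => ->; rewrite IH.
Qed.

(** The order in which KRS removes cells, so that the sequence of removed cells can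
    be recovered from the monomial. *)
Definition krs_ord x y := (y.1 < x.1) || ((x.1 == y.1) && (x.2 <= y.2)).

Lemma run_sorted D L : std D -> run D L -> sorted krs_ord L.
Proof.
move=> sD rD; elim: rD sD => [|l D1 D' x L1 hle dD rD' IH sD] //.
have [D2 [x2 [dD2 sD2 [x1 _] [_ pe] _]]] := delete_std sD hle (delete_some dD).
move: dD2; rewrite dD => -[? ?]; subst D2 x2.
have {}IH := IH sD2; case: rD' sD2 pe IH dD => [D2 hD2|l' D2 D3 y L2 hle' dD2 rD2] sD2 pe //= IH dD.
rewrite IH andbT.
have [D4 [y2 [dD4 _ [y1 _] _ _]]] := delete_std sD2 hle' (delete_some dD2).
move: dD4; rewrite dD2 => -[? ?]; subst D4 y2.
have ll' : l' <= l.
  by apply: hle; rewrite (perm_mem pe) inE (delete_some dD2) orbT.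
rewrite /krs_ord x1 y1; case: (ltngtP l' l) ll' => //= ll' _.
by rewrite ll' in dD2; apply: delete_mono dD dD2.
Qed.

(** Every deletion is undone by [insert]. *)
Lemma run_det L D E : std D -> std E -> size D = size E -> run D L -> run E L -> D = E.
Proof.
elim: L D E => [|x L IH] D E sD sE sz rD rE.
  have fD : flatten D = [::] by inversion rD.
  have fE : flatten E = [::] by inversion rE.
  have aux : forall F : seq (seq pt), flatten F = [::] -> F = nseq (size F) [::].
    by elim=> // f F IHF /=; case: f => //= /IHF <-.
  by rewrite (aux D) // (aux E) // sz.
inversion rD as [|l1 D1 D1' x1 L1 hD dD rD']; subst.
inversion rE as [|l2 E1 E1' x2 L2 hE dE rE']; subst.
have [D2 [x2 [dD2 sD2 [_ iD] [szD _] _]]] := delete_std sD hD (delete_some dD).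
move: dD2; rewrite dD => -[? ?]; subst D2 x2.
have [E2 [x2 [dE2 sE2 [_ iE] [szE _] _]]] := delete_std sE hE (delete_some dE).
move: dE2; rewrite dE => -[? ?]; subst E2 x2.
by rewrite -iD -iE (IH D1' E1') // szD szE.
Qed.

Lemma run_perm_inj D E L L' : std D -> std E -> size D = size E ->
  run D L -> run E L' -> perm_eq L L' -> D = E.
Proof.
move=> sD sE sz rD rE pe; suff E' : L = L' by subst L'; apply: run_det rD rE.
apply: (sorted_eq _ _ (run_sorted sD rD) (run_sorted sE rE) pe).
  by move=> y x z; rewrite /krs_ord; lia.
move=> [a b] [c d]; rewrite /krs_ord /= => h.
by have [-> ->] : a = c /\ b = d by lia.
Qed.

Lemma delete_pad l D k : delete l (D ++ nseq k [::]) =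
  if delete l D is Some (D', x) then Some (D' ++ nseq k [::], x) else None.
Proof.
elim: D => [|d D IH] /=; first by elim: k => //= k ->.
rewrite IH; case: (delete l D) => [[D' x]|]; first by case: (bump_row x.2 d) => [[]|].
by case: (pluck l d) => [[]|].
Qed.

Lemma flatten_pad D k : flatten (D ++ nseq k [::]) = flatten D.
Proof. by rewrite flatten_cat; elim: k => [|k IH] //=; rewrite cats0. Qed.

Lemma run_pad D L k : run D L -> run (D ++ nseq k [::]) L.
Proof.
elim=> [D1 h|l D1 D' x L1 hle dD _ IH]; first by constructor; rewrite flatten_pad.
apply: (@run_cons l _ (D' ++ nseq k [::])) IH.
  by rewrite /lefts flatten_pad.
by rewrite delete_pad dD.
Qed.

Lemma std_pad D k : std D -> std (D ++ nseq k [::]).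
Proof.
case/andP=> cD pD; apply/andP; split.
  by rewrite all_cat cD; elim: k.
case: D pD {cD} => [_|d D /= pD].
  by case: k => // k /=; elim: k => //= k ->; rewrite andbT.
rewrite cat_path pD /=; move: (last d D) => e.
by elim: k e => //= k IH e; rewrite IH andbT; apply/row_leP.
Qed.

(** [insert] cannot create a row, so the two tableaux are first given the same
    number of rows. *)
Lemma run_inj_pad D E L L' : std D -> std E -> run D L -> run E L' -> perm_eq L L' ->
  D ++ nseq (size E) [::] = E ++ nseq (size D) [::].
Proof.
move=> sD sE rD rE; apply: run_perm_inj; rewrite ?size_cat ?size_nseq 1?addnC //;
  by [apply: std_pad | apply: run_pad].
Qed.

(** The left tableau is initial: these are the tableaux on which KRS is the product of
    the cells ([run_linit]). *)
Definition linit D := all (fun d => [seq x.1 | x <- d] == iota 0 (size d)) D.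

Lemma bump_row_last s d y : y.2 <= s -> bump_row s (rcons d y) = Some (rcons d (y.1, s), y.2).
Proof. by move=> h; elim: d => [|x d IH] /=; rewrite ?h ?IH. Qed.

Lemma linit_rcons d x : [seq x.1 | x <- rcons d x] == iota 0 (size (rcons d x)) ->
  [seq x.1 | x <- d] = iota 0 (size d) /\ x.1 = size d.
Proof.
rewrite map_rcons size_rcons -addn1 iotaD -cats1 eqseq_cat ?size_map ?size_iota //=.
by case/andP=> /eqP -> /eqP[->].
Qed.

(** The maximal left entry [l] is in position [l] of every row that is bumped. The
    right entries of that column shift up by one row, all of them next to the same
    left entry [l], so that the tableau only loses one cell as a multiset. *)
Lemma delete_linit l D : std D -> linit D -> {in lefts D, forall k, k <= l} ->
  l \in lefts D -> exists D' x d0, [/\ delete l D = Some (D', x), linit D',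
    perm_eq (flatten D) (x :: flatten D'), x.1 = l & head [::] D = rcons d0 x].
Proof.
elim: D => [|d D IH] // sD /= /andP[id iD] hle hin.
have [cd sD1] := std_cons sD.
have [hled hleD] := lefts_le_cons hle.
have [hl|hl] := boolP (l \in lefts D).
  have [D' [x [e0 [-> iD' pe x1 hd]]]] := IH sD1 iD hleD hl.
  case: D hd sD {IH} hle hin sD1 iD hleD hl pe => [|e D] /=; first by case: e0.
  move=> -> sD hle hin sD1 iD hleD hl pe.
  have [_ /esym] := linit_rcons (proj1 (andP iD)).
  rewrite x1 => e0s.
  have /row_leP[] : row_le d (rcons e0 x) by case/andP: sD => _ /= /andP[].
  rewrite size_rcons e0s => sz /(_ l (leqnn _)) [_].
  rewrite nth_rcons e0s ltnn eqxx => h.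
  case/lastP: d id hled cd sz h sD hle hin => // d y id hled cd sz h sD hle hin.
  have [d1 y1] := linit_rcons id.
  have dl : size d = l.
    apply/eqP; rewrite eqn_leq -y1 hled ?mem_rcons ?mem_head //.
    by move: sz; rewrite size_rcons y1.
  rewrite nth_rcons dl ltnn eqxx in h.
  exists (rcons d (y.1, x.2) :: D'), y, d; rewrite bump_row_last //; split=> //.
  - by rewrite -dl -y1 -surjective_pairing.
  - by rewrite /= iD' andbT map_rcons /= size_rcons y1 d1 -addn1 iotaD cats1.
  - have yx : (y.1, x.2) = x by rewrite y1 dl -x1 -surjective_pairing.
    apply/permP => a; have /permP/(_ a) := pe.
    by rewrite yx /= !count_cat -!cats1 !count_cat /=; lia.
  - by rewrite y1.
have hid : l \in [seq x.1 | x <- d].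
  by move: hin; rewrite lefts_cons mem_cat (negPf hl) orbF.
rewrite delete_none //.
have := pluckP l d; case: (pluck l d) => [[d' x] [d1 [d2 [E E' hx]]]|H]; last first.
  by case/mapP: hid => z /H /eqP hz E; case: hz.
have d2E : d2 = [::] by apply: (@chain_maxlast l d1 x d2); rewrite -?E.
rewrite d2E cats0 in E'; rewrite d2E cats1 in E; subst d d'.
exists (d1 :: D), x, d1; split=> //=.
  by rewrite iD andbT; case: (linit_rcons id) => ->.
by rewrite -cats1 -catA perm_catCA.
Qed.

Lemma run_linit D : std D -> linit D -> exists2 L, run D L & perm_eq L (flatten D).
Proof.
elim/run_ind_std => [D1 h|l D1 D' x sD hle hl dD sD' /(_ sD') IH iD].
  by exists [::]; rewrite ?h //; constructor.
have [D2 [x2 [d0 [dD2 iD2 pe _ _]]]] := delete_linit sD iD hle hl.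
move: dD2; rewrite dD => -[? ?]; subst D2 x2.
have [L rL pL] := IH iD2; exists (x :: L); first exact: run_cons dD rL.
by rewrite perm_sym (perm_trans pe) // perm_cons perm_sym.
Qed.

End KRScomb.

(** * Transfer to minors of the matrix *)

Section Transfer.
Variables m n : nat.
Implicit Types (d e L : seq (cell m n)) (D E : seq (seq (cell m n))).

Definition pos (x : cell m n) : pt := (nat_of_ord x.1, nat_of_ord x.2).
Notation posr := (map pos).
Notation post := (map (map pos)).

Lemma pos_inj : injective pos.
Proof. by case=> a b [c e] [/ord_inj -> /ord_inj ->]. Qed.

Lemma bump_row_pos (s : 'I_n) d : bump_row s (posr d) =
  if krs_bump s d is Some (d', t) then Some (posr d', nat_of_ord t) else None.
Proof.
elim: d => [|x d IH] //=; rewrite IH; case: (krs_bump s d) => [[d' t]|] //=.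
by case: ifP.
Qed.

Lemma pluck_pos l d : pluck l (posr d) =
  if krs_pluck l d is Some (d', x) then Some (posr d', pos x) else None.
Proof.
elim: d => [|x d IH] //=; case: ifP => // _.
by rewrite IH; case: (krs_pluck l d) => [[d' y]|].
Qed.

Lemma delete_pos l D : delete l (post D) =
  if krs_delete l D is Some (D', x) then Some (post D', pos x) else None.
Proof.
elim: D => [|d D IH] //=; rewrite IH; case: (krs_delete l D) => [[D' x]|] /=.
  by rewrite bump_row_pos; case: (krs_bump x.2 d) => [[]|].
by rewrite pluck_pos; case: (krs_pluck l d) => [[]|].
Qed.

Lemma is_minor_pos d : is_minor d = chain (posr d).
Proof. by rewrite /chain sorted_map. Qed.

Lemma minor_le_pos d e : minor_le d e = row_le (posr d) (posr e).
Proof.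
rewrite /minor_le /row_le !size_map; congr andb.
by elim: d e => [|x d IH] [|y e] //=; rewrite IH.
Qed.

Lemma standard_pos D : standard D = std (post D).
Proof.
rewrite /standard /bitableau /std -andbA all_map.
rewrite (eq_all is_minor_pos); congr andb.
have -> : sorted (@minor_le m n) D = sorted row_le (post D).
  by rewrite sorted_map; apply: eq_sorted => d e; exact: minor_le_pos.
rewrite andbC; case: (boolP (sorted _ _)) => //= h.
rewrite sorted_map; move: h; rewrite sorted_map; apply: sub_sorted => d e.
by case/row_leP; rewrite !size_map.
Qed.

Lemma mxvec_index_inj (x y : cell m n) :
  mxvec_index x.1 x.2 = mxvec_index y.1 y.2 -> x = y.
Proof.
by move/cast_ord_inj/enum_rank_inj; case: x y => [a b] [c e] /= [-> ->].
Qed.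

Lemma diag_mnmE L (x : cell m n) : diag_mnm L (mxvec_index x.1 x.2) = count_mem x L.
Proof.
rewrite /diag_mnm mnm_sumE -sum1_count [RHS]big_mkcond /=. apply: eq_bigr => y _.
rewrite /cell_mnm mnm1E; case: (eqVneq y x) => [->|ne]; first by rewrite eqxx.
by case: eqP => // /mxvec_index_inj E; rewrite E eqxx in ne.
Qed.

Lemma diag_mnm_cat L1 L2 : diag_mnm (L1 ++ L2) = (diag_mnm L1 + diag_mnm L2)%MM.
Proof. by rewrite /diag_mnm big_cat. Qed.

Lemma diag_mnm_cons x L : diag_mnm (x :: L) = (cell_mnm x + diag_mnm L)%MM.
Proof. by rewrite /diag_mnm big_cons. Qed.

Lemma perm_diag_mnm L1 L2 : perm_eq L1 L2 <-> diag_mnm L1 = diag_mnm L2.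
Proof.
split=> [pe|E]; first by rewrite /diag_mnm (perm_big _ pe).
by apply/allP => x _ /=; rewrite -!diag_mnmE E.
Qed.

Lemma krs_iter_run k D (L : seq pt) : std (post D) -> run (post D) L -> size L = k ->
  exists2 L', posr L' = L & krs_iter k D = diag_mnm L'.
Proof.
elim: k D L => [|k IH] D L sD rD hk.
  by rewrite (size0nil hk); exists [::]; rewrite // /diag_mnm big_nil.
inversion rD as [|l D1 D1' x L1 hle dD rD']; subst => //; move: hk => [hk].
have hl := delete_some dD.
have maxE : (\max_(y <- flatten D) y.1 = l)%N.
  rewrite /lefts -map_flatten -map_comp in hle hl.
  apply/eqP; rewrite eqn_leq; apply/andP; split.
    by apply/bigmax_leqP_seq => y hy _; apply: hle; apply/mapP; exists y.
  case/mapP: hl => y hy ->.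
  by apply: (@leq_bigmax_seq _ _ xpredT (fun y : cell m n => nat_of_ord y.1)).
rewrite /= /krs_step maxE; move: dD; rewrite delete_pos.
case E: (krs_delete l D) => [[D2 y]|] // [E1 E2]; subst D1' x.
have [D3 [z [dD3 sD3 _ _ _]]] := delete_std sD hle hl.
move: dD3; rewrite delete_pos E => -[? ?]; subst D3 z.
have [L' hL' ->] := IH _ _ sD3 rD' hk.
exists (y :: L'); first by rewrite /= hL'.
by rewrite diag_mnm_cons addmC.
Qed.

Lemma krs_mnm_run D (L : seq pt) : std (post D) -> run (post D) L ->
  exists2 L', posr L' = L & krs_mnm D = diag_mnm L'.
Proof.
move=> sD rD; apply: krs_iter_run => //.
by rewrite -(run_size sD rD) -map_flatten size_map.
Qed.

(** By [run_sorted] the monomial determines the sequence of removed cells, and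
    insertion turns this sequence back into the tableau. *)
Lemma krs_inj D E : standard D -> standard E -> krs_mnm D = krs_mnm E ->
  D ++ nseq (size E) [::] = E ++ nseq (size D) [::].
Proof.
rewrite !standard_pos => sD sE.
have [L rL] := run_ex sD; have [L' rL'] := run_ex sE.
have [L1 E1 ->] := krs_mnm_run sD rL; have [L2 E2 ->] := krs_mnm_run sE rL'.
move/perm_diag_mnm => pe.
have := run_inj_pad sD sE rL rL' _; rewrite -E1 -E2 perm_map // !size_map => /(_ isT).
have mapn k : nseq k [::] = post (nseq k [::]) by rewrite map_nseq.
by rewrite !mapn -!map_cat => /(inj_map (inj_map pos_inj)).
Qed.

Lemma krs_linit D : standard D -> linit (post D) -> krs_mnm D = diag_mnm (flatten D).
Proof.
rewrite standard_pos => sD iD; have [L rL pL] := run_linit sD iD.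
have [L' E ->] := krs_mnm_run sD rL; apply/perm_diag_mnm.
by apply: (perm_map_inj pos_inj); rewrite E (perm_trans pL) // map_flatten.
Qed.

(** A partial inverse of [pos], to get minors from lists of pairs of naturals. *)
Definition cell_of (u : pt) : option (cell m n) :=
  if insub u.1 is Some i then if insub u.2 is Some j then Some (i, j) else None else None.
Definition cells (d : seq pt) : seq (cell m n) := pmap cell_of d.
Definition inbox (u : pt) := (u.1 < m) && (u.2 < n).

Lemma pos_cells (d : seq pt) : all inbox d -> posr (cells d) = d.
Proof.
elim: d => [|[a b] d IH] //= /andP[/andP[/= h1 h2] /IH]; rewrite /cells /= /cell_of /=.
by rewrite !insubT /= => ->.
Qed.

Lemma post_cells (D : seq (seq pt)) : all (all inbox) D -> post (map cells D) = D.
Proof.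
by elim: D => [|d D IH] //= /andP[/pos_cells -> /IH ->].
Qed.

Lemma flatten_cells (D : seq (seq pt)) : flatten (map cells D) = cells (flatten D).
Proof.
elim: D => //= d D ->; rewrite /cells.
by elim: d => //= x d IH; case: (cell_of x) => //= y; rewrite IH.
Qed.

End Transfer.

(** * Ideals, initial monomials and the G-KRS hypothesis *)

Section IdealTheory.
Local Open Scope ring_scope.
Variable R : comNzRingType.
Implicit Types (A B S G H : R -> Prop).

Lemma is_ideal_sum A (T : eqType) (s : seq T) (F : T -> R) : is_ideal A ->
  (forall y, y \in s -> A (F y)) -> A (\sum_(y <- s) F y).
Proof.
move=> [A0 AD _]; elim: s => [|x s IH] h; first by rewrite big_nil.
rewrite big_cons; apply: AD; first by apply: h; rewrite mem_head.
by apply: IH => y hy; apply: h; rewrite inE hy orbT.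
Qed.

Lemma ideal_gen_ideal S : is_ideal (ideal_gen S).
Proof.
split.
- by exists [::]; rewrite ?big_nil.
- move=> x y [s hs ->] [t ht ->]; exists (s ++ t); last by rewrite big_cat.
  by move=> z; rewrite mem_cat => /orP[/hs|/ht].
move=> a x [s hs ->]; exists [seq (a * y.1, y.2) | y <- s].
  by move=> _ /mapP[y hy ->] /=; apply: hs.
by rewrite big_map mulr_sumr; apply: eq_bigr => y _; rewrite mulrA.
Qed.

Lemma ideal_gen_in S x : S x -> ideal_gen S x.
Proof.
move=> h; exists [:: (1, x)]; last by rewrite big_seq1 mul1r.
by move=> y; rewrite inE => /eqP ->.
Qed.

Lemma ideal_gen_min S A : is_ideal A -> (forall x, S x -> A x) ->
  forall x, ideal_gen S x -> A x.
Proof.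
move=> iA h x [s hs ->]; apply: is_ideal_sum => // y hy.
by have [_ _ AM] := iA; apply: AM; apply/h/hs.
Qed.

Lemma ideal_gen_mono S S' : (forall x, S x -> ideal_gen S' x) ->
  forall x, ideal_gen S x -> ideal_gen S' x.
Proof. by apply: ideal_gen_min; apply: ideal_gen_ideal. Qed.

Lemma ideal_mul_in A B x y : A x -> B y -> ideal_mul A B (x * y).
Proof. by move=> hx hy; apply: ideal_gen_in; exists x, y. Qed.

Lemma ideal_mul_gen A B G H : (forall x, A x -> ideal_gen G x) ->
  (forall x, B x -> ideal_gen H x) -> forall z, ideal_mul A B z ->
  ideal_gen (fun z => exists x y, [/\ G x, H y & z = x * y]) z.
Proof.
move=> hA hB; apply: ideal_gen_mono => _ [x [y [/hA[s hs ->] /hB hy ->]]].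
rewrite mulr_suml; apply: is_ideal_sum; first exact: ideal_gen_ideal.
move=> a /hs ha; case: hy => t ht ->; rewrite mulr_sumr.
apply: is_ideal_sum; first exact: ideal_gen_ideal.
move=> b /ht hb; rewrite mulrACA.
have [_ _ h] := ideal_gen_ideal (fun z => exists x y, [/\ G x, H y & z = x * y]).
by apply: h; apply: ideal_gen_in; exists a.2, b.2.
Qed.

End IdealTheory.

Section Bitab.
Local Open Scope ring_scope.
Variables (K : fieldType) (m n : nat).
Implicit Types (d e : seq (cell m n)) (D E : seq (seq (cell m n))).
Notation P := (mxpoly_ring K m n).
Notation mp := (@minor_poly K m n).
Notation bp := (@bitab_poly K m n).

Lemma minor_poly_nil : mp [::] = 1.
Proof. by rewrite /minor_poly det_mx00. Qed.

Lemma minor_poly1 x : mp [:: x] = 'X_[cell_mnm x].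
Proof. by rewrite /minor_poly [X in \det X]mx11_scalar det_scalar1 mxE. Qed.

Lemma bitab_cons d D : bp (d :: D) = mp d * bp D.
Proof. by rewrite /bitab_poly big_cons. Qed.

Lemma bitab_cat D E : bp (D ++ E) = bp D * bp E.
Proof. by rewrite /bitab_poly big_cat. Qed.

Lemma bitab_perm D E : perm_eq D E -> bp D = bp E.
Proof. by move=> h; rewrite /bitab_poly (perm_big _ h). Qed.

Lemma bitab_pad D k : bp (D ++ nseq k [::]) = bp D.
Proof.
rewrite bitab_cat; elim: k => [|k IH]; first by rewrite /bitab_poly big_nil mulr1.
by rewrite /= bitab_cons minor_poly_nil mul1r.
Qed.

Lemma bitab_krs_inj D E : standard D -> standard E -> krs_mnm D = krs_mnm E -> bp D = bp E.
Proof.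
by move=> sD sE /(krs_inj sD sE) h; rewrite -(bitab_pad D (size E)) h bitab_pad.
Qed.

(** The coefficient of [M] in a combination of monomials comes from one of them. *)
Lemma gen_mnm (S : P -> Prop) M : (forall f, S f -> exists u, f = 'X_[u]) ->
  ideal_gen S 'X_[M] -> exists2 u, S 'X_[u] & (u <= M)%MM.
Proof.
move=> hS [s hs E]; have : (\sum_(y <- s) y.1 * y.2)@_M != 0.
  by rewrite -E mcoeffX eqxx oner_neq0.
rewrite raddf_sum /= => h.
have /hasP[y hy hne] : has (fun y : P * P => (y.1 * y.2)@_M != 0) s.
  apply: contraR h => /hasPn h; rewrite big_seq big1 // => y /h.
  by rewrite negbK => /eqP.
have hy2 := hs _ hy; have [u eu] := hS _ hy2; exists u; first by rewrite -eu.
move: hne; rewrite eu -mcoeff_msupp (perm_mem (msuppMX _ _)) => /mapP[v _ ->].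
by rewrite lem_addr.
Qed.

Section Initial.
Variable le : rel (mxmonom m n).
Hypothesis hle : term_order le.

Lemma initial_uniq (f : P) u v : initial_mnm le f u -> initial_mnm le f v -> u = v.
Proof.
have [_ h _ _ _] := hle => -[hu hu'] [hv hv'].
by apply: h; rewrite hu' // hv'.
Qed.

Lemma le_add2 u v w z : le u v -> le w z -> le (u + w)%MM (v + z)%MM.
Proof.
have [_ _ tr _ ad] := hle => h1 h2; apply: (tr (v + w)%MM); first exact: ad.
by rewrite ![(v + _)%MM]addmC; apply: ad.
Qed.

Lemma initial1 : initial_mnm le (1 : P) 0%MM.
Proof.
have [tot _ _ _ _] := hle.
split; rewrite msupp1 ?inE //.
by move=> v; rewrite inE => /eqP ->; have := tot 0%MM 0%MM; rewrite orbb.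
Qed.

Lemma initialM (f g : P) u v : initial_mnm le f u -> initial_mnm le g v ->
  initial_mnm le (f * g) (u + v)%MM.
Proof.
have [tot anti tr _ ad] := hle => -[fu hf] [gv hg]; split; last first.
  move=> w /msuppM_le /allpairsP[[a b] /= [ha hb ->]].
  by apply: le_add2; [apply: hf | apply: hg].
have key a b : a \in msupp f -> b \in msupp g -> (a + b = u + v)%MM -> a = u /\ b = v.
  move=> /hf ha /hg hb E.
  have h1 : le (a + b)%MM (u + b)%MM by apply: ad.
  have h2 : le (u + b)%MM (a + b)%MM.
    by rewrite E ![(u + _)%MM]addmC; apply: ad.
  have E2 : (a + b = u + b)%MM by apply: anti; rewrite h1.
  have au := addIm E2; split=> //; apply: (@addmI _ u); by rewrite -E au.
rewrite mcoeff_msupp [f]mpolyE mulr_suml raddf_sum /=.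
rewrite (bigD1_seq u) ?msupp_uniq //= big_seq_cond big1 ?addr0; last first.
  move=> a /andP[ha au]; rewrite [g]mpolyE mulr_sumr raddf_sum /= big_seq big1 // => b hb.
  rewrite -scalerAl -scalerAr -mpolyXD !mcoeffZ mcoeffX; case: eqP => [E|]; last by rewrite !mulr0.
  by case: (key _ _ ha hb E) au => ->; rewrite eqxx.
rewrite [g]mpolyE mulr_sumr raddf_sum /= (bigD1_seq v) ?msupp_uniq //= big_seq_cond big1 ?addr0.
  rewrite -scalerAl -scalerAr -mpolyXD !mcoeffZ mcoeffX eqxx mulr1.
  by rewrite mulf_neq0 -?mcoeff_msupp.
move=> b /andP[hb bv].
rewrite -scalerAl -scalerAr -mpolyXD !mcoeffZ mcoeffX; case: eqP => [E|]; last by rewrite !mulr0.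
by case: (key _ _ fu hb E) bv => _ ->; rewrite eqxx.
Qed.

End Initial.

Section KRSuse.
Variable le : rel (mxmonom m n).
Hypothesis hle : @diagonal_term_order K m n le.
Variable I : P -> Prop.
Hypothesis hG : G_KRS le I.

Lemma initial_bitab D : all (@is_minor m n) D -> initial_mnm le (bp D) (diag_mnm (flatten D)).
Proof.
have [ht hm] := hle.
elim: D => [|d D IH] /=; first by rewrite /bitab_poly /diag_mnm !big_nil => _; apply: initial1.
case/andP=> hd hD; rewrite bitab_cons diag_mnm_cat; apply: initialM => //; first exact: hm.
exact: IH.
Qed.

(** KRS(I) lies in the initial ideal, which is generated by the initial monomials of
    the bitableaux in [I]; a monomial of a monomial ideal is a multiple of one of the
    generators. *)
Lemma krs_divisible D : standard D -> I (bp D) -> exists E,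
  [/\ bitableau E, I (bp E) & (diag_mnm (flatten E) <= krs_mnm D)%MM].
Proof.
move=> sD ID; have [[_ hin] [_ hgb]] := hG.
have /hin/hgb : KRS_image I 'X_[krs_mnm D].
  exists (bp D) => //; exists [:: (1, D)]; split; rewrite ?big_seq1 ?scale1r //=.
  by rewrite sD.
move/gen_mnm => [|u [f [v [[E [bE IE] ->] hv]]]].
  by move=> f [f' [u [_ _ ->]]]; exists u.
move/(congr1 (fun p : P => u \in msupp p)); rewrite !msuppX !inE eqxx => /esym/eqP -> hu.
exists E; split=> //.
suff -> : diag_mnm (flatten E) = v by [].
by apply: (initial_uniq hle.1 _ hv); apply: initial_bitab; case/andP: bE.
Qed.

(** The initial monomial of [E] belongs to KRS(I), so it is the image of some [f] in
    [I]. Since KRS is injective on standard bitableaux, [f] is the bitableau of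
    [D]. *)
Lemma krs_pullback E D : bitableau E -> I (bp E) -> standard D ->
  krs_mnm D = diag_mnm (flatten E) -> I (bp D).
Proof.
move=> bE IE sD eD; have [[_ hin] [_ hgb]] := hG.
have : initial_ideal le I 'X_[krs_mnm D].
  apply: ideal_gen_in; exists (bp E), (krs_mnm D); split=> //; rewrite eD.
  by apply: initial_bitab; case/andP: bE.
move/hin => [f If [s [/allP ss fE gE]]].
(* The expression of [f] may contain the same standard bitableau several times,
   possibly with different empty rows: its terms are grouped by KRS monomial, and
   [B M] is the common value of the bitableaux with monomial [M]. *)
pose B (M : mxmonom m n) : P :=
  if [seq y <- s | krs_mnm y.2 == M] is y :: _ then bp y.2 else 0.
have BE y : y \in s -> bp y.2 = B (krs_mnm y.2).
  move=> hy; rewrite /B; case E1 : [seq _ <- _ | _] => [|z t].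
    by have := mem_filter (fun z : K * seq (seq (cell m n)) => krs_mnm z.2 == krs_mnm y.2) y s; rewrite E1 eqxx hy.
  have : z \in [seq z <- s | krs_mnm z.2 == krs_mnm y.2] by rewrite E1 mem_head.
  rewrite mem_filter => /andP[/eqP h hz].
  by apply: bitab_krs_inj; rewrite ?h //; apply: ss.
suff -> : bp D = f by [].
have fE2 : f = \sum_(M <- undup [seq krs_mnm y.2 | y <- s])
     (\sum_(y <- s | krs_mnm y.2 == M) y.1) *: B M.
  rewrite fE.
  transitivity (\sum_(M <- undup [seq krs_mnm y.2 | y <- s])
     \sum_(y <- s | krs_mnm y.2 == M) y.1 *: bp y.2).
    rewrite (exchange_big_dep xpredT) //= big_seq [in RHS]big_seq; apply: eq_bigr => y hy.
    rewrite -big_filter.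
    have -> : [seq M <- undup [seq krs_mnm z.2 | z <- s] | krs_mnm y.2 == M] = [:: krs_mnm y.2].
      rewrite (eq_filter (a2 := pred1 (krs_mnm y.2))); last by move=> M /=; rewrite eq_sym.
      by rewrite filter_pred1_uniq ?undup_uniq // mem_undup; apply/mapP; exists y.
    by rewrite big_seq1.
  apply: eq_bigr => M _; rewrite scaler_suml big_seq_cond [RHS]big_seq_cond.
  by apply: eq_bigr => y /andP[hy /eqP <-]; rewrite BE.
have cE M : \sum_(y <- s | krs_mnm y.2 == M) y.1 = (krs_mnm D == M)%:R.
  rewrite -(mcoeffX K) gE raddf_sum /= [in LHS]big_mkcond; apply: eq_bigr => y _.
  by rewrite mcoeffZ mcoeffX; case: eqP; rewrite ?mulr1 ?mulr0.
have hD : krs_mnm D \in [seq krs_mnm y.2 | y <- s].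
  apply/negPn/negP => h; have := cE (krs_mnm D).
  rewrite eqxx big_seq_cond big1 => [/esym/eqP|y /andP[hy /eqP E1]].
    by rewrite oner_eq0.
  by case/negP: h; rewrite -E1; apply/mapP; exists y.
rewrite fE2 (bigD1_seq (krs_mnm D)) ?undup_uniq ?mem_undup //= cE eqxx scale1r big1 ?addr0.
  case/mapP: hD => y hy E1; rewrite E1 -BE //.
  by apply: bitab_krs_inj => //; apply: ss.
by move=> M /negPf hM; rewrite cE eq_sym hM scale0r.
Qed.

End KRSuse.
End Bitab.

(** * The ideals J(k,d) and the powers of the ideal of the variables *)

Section DetIdeals.
Local Open Scope ring_scope.
Variables (K : fieldType) (m n : nat).
Implicit Types (d e : seq (cell m n)) (D E : seq (seq (cell m n))).
Notation P := (mxpoly_ring K m n).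
Notation mp := (@minor_poly K m n).
Notation bp := (@bitab_poly K m n).

Definition degsum D := sumn (map size D).

Lemma minor_homog d : mp d \is (size d).-homog.
Proof.
have H l (F : 'I_l -> 'I_(m * n)) : \prod_(i < l) ('X_(F i) : P) \is l.-homog.
  elim: l F => [|l IH] F; first by rewrite big_ord0 dhomog1.
  rewrite big_ord_recl /= -[l.+1]/(1 + l)%N; apply: dhomogM; last exact: IH.
  by rewrite dhomogX /= mdeg1.
rewrite /minor_poly /determinant; apply: rpred_sum => s _.
under eq_bigr do rewrite mxE.
by rewrite -signr_odd; case: (odd _); rewrite ?expr1 ?expr0 ?mulN1r ?mul1r ?rpredN; apply: H.
Qed.

Lemma bitab_homog D : bp D \is (degsum D).-homog.
Proof.
elim: D => [|d D IH]; first by rewrite /bitab_poly big_nil dhomog1.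
by rewrite bitab_cons /degsum /=; apply: dhomogM; rewrite ?minor_homog.
Qed.

Lemma bitab_mdeg D u : u \in msupp (bp D) -> mdeg u = degsum D.
Proof. by move=> hu; move/dhomog_mf: (bitab_homog D) => /(_ _ hu). Qed.

Lemma minor_det t d : size d = t -> forall x0, mp d =
  \det (\matrix_(i < t, j < t) 'X_(mxvec_index (nth x0 d i).1 (nth x0 d j).2)).
Proof.
move=> <- x0; rewrite /minor_poly; congr (\det _); apply/matrixP => i j.
by rewrite !mxE !(tnth_nth x0).
Qed.

(** Expansion along the first row. *)
Lemma minor_laplace x d : is_minor (x :: d) ->
  ideal_gen (fun f => exists2 e, is_minor e && (size e == size d) & f = mp e) (mp (x :: d)).
Proof.
move=> hm; rewrite (minor_det (erefl (size (x :: d))) x) /=.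
rewrite (expand_det_row _ ord0).
apply: is_ideal_sum; first exact: ideal_gen_ideal.
move=> j _; rewrite /cofactor mulrA.
have [_ _ h] := ideal_gen_ideal (fun f : P => exists2 e, is_minor e && (size e == size d) & f = mp e).
apply: h; apply: ideal_gen_in.
pose e := [seq ((nth x d (nat_of_ord i)).1, (nth x (x :: d) (lift j i)).2) | i : 'I_(size d)].
have se : size e = size d by rewrite size_map size_enum_ord.
exists e.
  rewrite se eqxx andbT; move: hm; rewrite /is_minor => hm.
  have tr : transitive (fun y z : cell m n => (y.1 < z.1)%N && (y.2 < z.2)%N).
    by move=> ? ? ? /andP[a b] /andP[c f]; rewrite (ltn_trans a c) (ltn_trans b f).
  have key := sorted_ltn_nth tr x hm.
  rewrite sorted_map; apply: (sub_sorted (e := fun i k : 'I_(size d) => (i < k)%N)).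
    move=> i k ik /=; apply/andP; split.
      by have := key i.+1 k.+1; rewrite !inE /= !ltnS !ltn_ord => /(_ isT isT ik) /andP[].
    have lik : (lift j i < lift j k)%N.
      by move: ik; rewrite /= /bump; case: leqP => a; case: leqP => b /=; lia.
    have := key (lift j i) (lift j k); rewrite !inE !ltn_ord => /(_ isT isT lik) /andP[_].
    by rewrite [in X in _ -> X]/=.
  have := iota_ltn_sorted 0 (size d); rewrite -val_enum_ord sorted_map.
  by [].
rewrite (minor_det se x); congr (\det _); apply/matrixP => i k.
have hnth (a : 'I_(size d)) : nth x e a = ((nth x d a).1, (nth x (x :: d) (lift j a)).2).
  rewrite (nth_map a) ?size_enum_ord ?ltn_ord //.
  by rewrite nth_ord_enum.
by rewrite !mxE !hnth.
Qed.

Lemma bitab_ideal_exp (A : P -> Prop) D : (forall d, d \in D -> A (mp d)) ->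
  ideal_exp A (size D) (bp D).
Proof.
elim: D => [//|d D IH] h; rewrite bitab_cons; apply: ideal_mul_in.
  by apply: h; rewrite mem_head.
by apply: IH => e he; apply: h; rewrite inE he orbT.
Qed.

Lemma ideal_full_gen (f : P) : ideal_full f -> ideal_gen (fun g => exists2 D, D = [::] & g = bp D) f.
Proof.
move=> _; exists [:: (f, 1)]; last by rewrite big_seq1 mulr1.
by move=> y; rewrite inE => /eqP ->; exists [::]; rewrite // /bitab_poly big_nil.
Qed.

Lemma det_ideal_gen t (f : P) : det_ideal t f ->
  ideal_gen (fun g => exists2 d, is_minor d && (size d == t) & g = mp d) f.
Proof. by []. Qed.

Lemma ideal_exp_gen t k (f : P) : ideal_exp (det_ideal t) k f ->
  ideal_gen (fun g => exists2 D, all (fun d => is_minor d && (size d == t)) D && (size D == k)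
     & g = bp D) f.
Proof.
elim: k f => [|k IH] f.
  move=> _; move: (@ideal_full_gen f Logic.I); apply: ideal_gen_mono => _ [D -> ->].
  by apply: ideal_gen_in; exists [::].
move/(ideal_mul_gen (@det_ideal_gen t) IH); apply: ideal_gen_mono.
move=> _ [_ [_ [[d hd ->] [D /andP[hD /eqP <-] ->] ->]]].
by apply: ideal_gen_in; exists (d :: D); rewrite ?bitab_cons //= hd hD eqxx.
Qed.

Lemma is_minor_size d : is_minor d -> (size d <= minn m n)%N.
Proof.
move=> hm; rewrite leq_min; apply/andP; split.
  have : uniq [seq x.1 | x <- d].
    rewrite -(map_inj_uniq (@ord_inj m)) -map_comp.
    apply: (sorted_uniq ltn_trans ltnn); rewrite sorted_map.
    by apply: sub_sorted hm => y z /andP[].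
  by move/card_uniqP; rewrite size_map => <-; apply: leq_trans (max_card _) _; rewrite card_ord.
have : uniq [seq x.2 | x <- d].
  rewrite -(map_inj_uniq (@ord_inj n)) -map_comp.
  apply: (sorted_uniq ltn_trans ltnn); rewrite sorted_map.
  by apply: sub_sorted hm => y z /andP[].
by move/card_uniqP; rewrite size_map => <-; apply: leq_trans (max_card _) _; rewrite card_ord.
Qed.

Lemma big_ideal_mul_in (T : Type) (s : seq T) (A : T -> P -> Prop) (f : T -> P) :
  (forall i, A i (f i)) -> (\big[@ideal_mul P/@ideal_full P]_(i <- s) A i) (\prod_(i <- s) f i).
Proof.
move=> h; elim: s => [|i s IH]; rewrite ?big_nil // !big_cons.
exact: ideal_mul_in.
Qed.

Lemma prod_by_size N D : all (fun d => size d < N)%N D ->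
  bp D = \prod_(i < N) bp [seq d <- D | size d == i].
Proof.
elim: D => [|d D IH] /=; first by rewrite big1 => [|i _]; rewrite /bitab_poly big_nil.
case/andP=> hd hD; rewrite bitab_cons IH // (bigD1 (Ordinal hd)) //= [RHS](bigD1 (Ordinal hd)) //=.
rewrite eqxx bitab_cons mulrA; congr (_ * _); apply: eq_bigr => i hi.
by case: eqP => // E; case/eqP: hi; apply: val_inj.
Qed.

Lemma count_by_size N D : all (fun d => size d < N)%N D ->
  (\sum_(i < N) count (fun d => size d == i) D = size D)%N /\
  (\sum_(i < N) i * count (fun d => size d == i) D = degsum D)%N.
Proof.
elim: D => [|d D IH] /=; first by split; rewrite big1 // => i _; rewrite muln0.
case/andP=> hd /IH [E1 E2]; split.
  rewrite big_split /= E1 (bigD1 (Ordinal hd)) //= eqxx big1 ?addn0 // => i hi.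
  by case: eqP => // E; case/eqP: hi; apply: val_inj.
under eq_bigr do rewrite mulnDr.
rewrite big_split /= E2 (bigD1 (Ordinal hd)) //= eqxx muln1 big1 ?addn0 // => i hi.
by case: eqP => [E|]; rewrite ?muln0 //; case/eqP: hi; apply: val_inj.
Qed.

Lemma J_ideal_in D : all (@is_minor m n) D -> J_ideal (size D) (degsum D) (bp D).
Proof.
move=> hD; have hs : all (fun d => size d < (minn m n).+1)%N D.
  by apply: sub_all hD => d /is_minor_size; rewrite ltnS.
have [E1 E2] := count_by_size hs.
apply: ideal_gen_in; exists (fun i : 'I_(minn m n).+1 => count (fun d => size d == i) D) => //.
rewrite (prod_by_size hs); apply: big_ideal_mul_in => i.
rewrite -size_filter; apply: bitab_ideal_exp => d; rewrite mem_filter => /andP[hd hdD].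
by apply: ideal_gen_in; exists d; rewrite // hd (allP hD).
Qed.

Lemma J_ideal_ideal (k d : nat) : is_ideal (@J_ideal K m n k d).
Proof. exact: ideal_gen_ideal. Qed.

(** Laplace expansion removes one box at a time from the shape, until the sizes of
    the minors sum to [d]. *)
Lemma J_ideal_ge D (d : nat) : all (@is_minor m n) D -> (d <= degsum D)%N -> J_ideal (size D) d (bp D).
Proof.
move=> hD hd; move: {2}(degsum D - d)%N (erefl (degsum D - d)%N) => j.
elim: j D hD hd => [|j IH] D hD hd hj.
  by have -> : d = degsum D by [lia | apply: J_ideal_in]; apply: J_ideal_in.
have /hasP[e he hpos] : has (fun e => 0 < size e)%N D.
  apply/negPn/negP => /hasPn h; suff : degsum D = 0%N by lia.
  rewrite /degsum; elim: D h {IH hD hd hj} => //= e D IHD h.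
  rewrite IHD => [|f hf]; last by apply: h; rewrite inE hf orbT.
  by have := h e (mem_head _ _); rewrite addn0; case: (size e).
have pe := perm_to_rem he.
rewrite (bitab_perm _ pe) bitab_cons (perm_size pe).
have hE : all (@is_minor m n) (e :: rem e D) by rewrite -(perm_all _ pe).
case: e hpos he pe hE => // x e _ he pe /= /andP[hm hr].
have hdeg : degsum D = ((size e).+1 + degsum (rem (x :: e) D))%N.
  by rewrite /degsum (perm_sumn (perm_map size pe)).
move: (rem _ D) hr hdeg {pe} => r hr hdeg.
have [s hs ->] := minor_laplace hm; rewrite mulr_suml.
apply: is_ideal_sum; first exact: J_ideal_ideal.
move=> [a f] /hs /= [e' /andP[hm' /eqP se'] ->].
have [_ _ h] := @J_ideal_ideal (size r).+1 d.
rewrite -mulrA -bitab_cons; apply: h.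
have hd' : degsum (e' :: r) = (size e + degsum r)%N by rewrite /degsum /= se'.
by apply: (IH (e' :: r)); rewrite /= ?hm' ?hr // hd'; lia.
Qed.

Lemma J_ideal_out (k d : nat) (f : P) : J_ideal k d f ->
  ideal_gen (fun g => exists2 D, [/\ all (@is_minor m n) D, size D = k & degsum D = d] & g = bp D) f.
Proof.
apply: ideal_gen_mono => g [e [E1 E2]].
set r := index_enum _; rewrite -/r in E1 E2 *.
have aux (s : seq 'I_(minn m n).+1) (h : P) :
  (\big[@ideal_mul P/@ideal_full P]_(i <- s) ideal_exp (det_ideal i) (e i)) h ->
  ideal_gen (fun g => exists2 D, [/\ all (@is_minor m n) D, size D = \sum_(i <- s) e i
      & degsum D = \sum_(i <- s) i * e i]%N & g = bp D) h.
  elim: s h => [|i s IH] h.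
    rewrite big_nil => _; move: (@ideal_full_gen h Logic.I); apply: ideal_gen_mono => _ [D -> ->].
    by apply: ideal_gen_in; exists [::]; rewrite // !big_nil.
  rewrite big_cons => /(ideal_mul_gen (@ideal_exp_gen _ _) IH); apply: ideal_gen_mono.
  move=> _ [_ [_ [[D /andP[hD /eqP sD] ->] [D' [hD' sD' dD'] ->] ->]]].
  apply: ideal_gen_in; exists (D ++ D'); last by rewrite bitab_cat.
  rewrite !big_cons size_cat sD sD' /degsum map_cat sumn_cat -/(degsum D') dD'; split=> //.
    by rewrite all_cat hD' andbT; apply: sub_all hD => d' /andP[].
  congr addn; rewrite -sD; elim: D hD {sD} => [|d' D IHD] /=; first by rewrite muln0.
  by case/andP=> /andP[_ /eqP ->] /IHD ->; rewrite mulnS.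
by move/aux; rewrite E1 E2.
Qed.

Definition singles (L : seq (cell m n)) : seq (seq (cell m n)) := [seq [:: x] | x <- L].

Lemma singles_minor L : all (@is_minor m n) (singles L).
Proof. by apply/allP => _ /mapP[x _ ->]. Qed.

Lemma degsum_singles L : degsum (singles L) = size L.
Proof. by elim: L => //= x L; rewrite /degsum /= => ->. Qed.

Lemma bitab_singles L : bp (singles L) = 'X_[diag_mnm L].
Proof.
elim: L => [|x L IH]; first by rewrite /bitab_poly /diag_mnm !big_nil mpolyX0.
by rewrite bitab_cons minor_poly1 IH diag_mnm_cons mpolyXD.
Qed.

Lemma mnm_cells (w : mxmonom m n) : exists2 L, w = diag_mnm L & size L = mdeg w.
Proof.
move: {2}(mdeg w) (erefl (mdeg w)) => k; elim: k w => [|k IH] w hw.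
  by exists [::]; rewrite ?hw // /diag_mnm big_nil; apply/eqP; rewrite -mdeg_eq0 hw.
have [i hi] : exists i, (0 < w i)%N.
  have : w != 0%MM by rewrite -mdeg_eq0 hw.
  move=> h; apply/existsP; apply: contraR h => /existsPn h.
  by apply/eqP/mnmP => i; rewrite mnm0E; have := h i; case: (w i).
have hle : (U_(i) <= w)%MM.
  by apply/mnm_lepP => j; rewrite mnm1E; case: eqP => // <-.
have E := submK hle.
have hk : mdeg (w - U_(i))%MM = k.
  by have := congr1 (@mdeg _) E; rewrite mdegD mdeg1 hw; lia.
have [L hL sL] := IH _ hk.
rewrite hk in sL; case: i / (mxvec_indexP i) hi hle E hk hL => a b hi hle E hk hL.
exists ((a, b) :: L); last by rewrite /= sL hw.
by rewrite diag_mnm_cons -hL addmC -[LHS]E.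
Qed.

Lemma det_ideal1_var (x : cell m n) : @det_ideal K m n 1 (mp [:: x]).
Proof. by apply: ideal_gen_in; exists [:: x]. Qed.

Lemma ideal_exp_ideal (A : P -> Prop) k : is_ideal (ideal_exp A k).
Proof. by case: k => [|k]; [split | apply: ideal_gen_ideal]. Qed.

Lemma ideal_exp_mono (A : P -> Prop) k l f : (l <= k)%N -> ideal_exp A k f -> ideal_exp A l f.
Proof.
elim: k l f => [|k IH] [|l] f //= hl.
apply: ideal_gen_mono => _ [x [y [hx hy ->]]].
by apply: ideal_gen_in; exists x, y; split=> //; apply: IH.
Qed.

Lemma power_ideal_in u (f : P) : (forall w, w \in msupp f -> (u <= mdeg w)%N) ->
  ideal_exp (det_ideal 1) u f.
Proof.
move=> h; rewrite [f]mpolyE; apply: is_ideal_sum; first exact: ideal_exp_ideal.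
move=> w /h hw; rewrite -mul_mpolyC.
have [_ _ hM] := ideal_exp_ideal (@det_ideal K m n 1) u; apply: hM.
have [L wL sL] := mnm_cells w; rewrite wL -bitab_singles.
apply: (@ideal_exp_mono _ (size (singles L))); first by rewrite /singles size_map sL.
by apply: bitab_ideal_exp => _ /mapP[x _ ->]; apply: det_ideal1_var.
Qed.

Lemma power_ideal_out u (f : P) : ideal_exp (det_ideal 1) u f ->
  forall w, w \in msupp f -> (u <= mdeg w)%N.
Proof.
move/ideal_exp_gen => [s hs ->] w; rewrite -[w \in _]/(w \in msupp _) => hw.
have /hasP[y hy hyw] : has (fun y : P * P => w \in msupp (y.1 * y.2)) s.
  apply: contraLR hw => /hasPn h; rewrite mcoeff_msupp negbK raddf_sum /= big_seq big1 //.
  by move=> y /h; rewrite mcoeff_msupp negbK => /eqP.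
have [D /andP[hD /eqP <-] E] := hs _ hy; move: hyw; rewrite E => /msuppM_le /allpairsP[[a b] /= [_ hb ->]].
rewrite mdegD (bitab_mdeg hb); suff -> : degsum D = size D by rewrite leq_addl.
elim: D hD {E hb} => //= d D IH /andP[/andP[_ /eqP hd] /IH E]; rewrite /degsum /= hd -[sumn _]/(degsum D) E //.
Qed.

(** The power of the ideal of the variables consists of the polynomials without
    terms of degree less than [u]. An element of J(k,d) is a combination of products
    of monomials with homogeneous bitableaux, and the products of degree less than
    [u] cancel out. *)
Lemma J_power_span (k d u : nat) (f : P) : J_ideal k d f -> ideal_exp (det_ideal 1) u f ->
  ideal_gen (fun g => exists D L, [/\ all (@is_minor m n) D, size D = k, degsum D = d,
     (u <= d + size L)%N & g = bp (D ++ singles L)]) f.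
Proof.
move=> hJ hu; set G := (X in ideal_gen X).
have [G0 GA GM] := ideal_gen_ideal G.
have Gdeg g : ideal_gen G g -> forall w, w \in msupp g -> (u <= mdeg w)%N.
  move=> hg; apply: power_ideal_out; move: g hg; apply: ideal_gen_min; first exact: ideal_exp_ideal.
  move=> _ [D [L [_ _ hd hL ->]]]; apply: power_ideal_in => w /bitab_mdeg ->.
  by rewrite /degsum map_cat sumn_cat -!/(degsum _) degsum_singles hd.
have : exists g h : P, [/\ f = g + h, ideal_gen G g & forall w, w \in msupp h -> (mdeg w < u)%N].
  have [s hs ->] := J_ideal_out hJ.
  have Qadd : forall x y : P,
    (exists g h : P, [/\ x = g + h, ideal_gen G g & forall w, w \in msupp h -> (mdeg w < u)%N]) ->
    (exists g h : P, [/\ y = g + h, ideal_gen G g & forall w, w \in msupp h -> (mdeg w < u)%N]) ->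
    exists g h : P, [/\ x + y = g + h, ideal_gen G g & forall w, w \in msupp h -> (mdeg w < u)%N].
    move=> _ _ [g [h [-> hg hh]]] [g' [h' [-> hg' hh']]].
    exists (g + g'), (h + h'); split; [by rewrite addrACA | exact: GA | move=> w /msuppD_le].
    by rewrite mem_cat => /orP[/hh|/hh'].
  have Q0 : exists g h : P, [/\ 0 = g + h, ideal_gen G g & forall w, w \in msupp h -> (mdeg w < u)%N].
    by exists 0, 0; split; rewrite ?addr0 // => w; rewrite msupp0.
  elim: s hs => [|y s IH] hs; first by rewrite big_nil.
  rewrite big_cons; apply: (Qadd _ _ _ _); last first.
    by apply: IH => z hz; apply: hs; rewrite inE hz orbT.
  have [D [hD sD dD] ->] := hs _ (mem_head _ _).
  rewrite [y.1]mpolyE mulr_suml; elim: (msupp y.1) => [|w r IHr]; first by rewrite big_nil.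
  rewrite big_cons; apply: (Qadd _ _ _ IHr).
  have [L hL sL] := mnm_cells w.
  have E : y.1@_w *: 'X_[w] * bp D = (y.1@_w)%:MP * bp (D ++ singles L).
    by rewrite -mul_mpolyC -mulrA hL -bitab_singles bitab_cat [bp D * _]mulrC.
  rewrite E; case: (leqP u (d + size L)) => hu'.
    exists ((y.1@_w)%:MP * bp (D ++ singles L)), 0; split; rewrite ?addr0 //; last first.
      by move=> v; rewrite msupp0.
    by apply: GM; apply: ideal_gen_in; exists D, L.
  exists 0, ((y.1@_w)%:MP * bp (D ++ singles L)); split; rewrite ?add0r //.
  move=> v; rewrite mul_mpolyC => /msuppZ_le /bitab_mdeg ->.
  by rewrite /degsum map_cat sumn_cat -!/(degsum _) degsum_singles dD.
move=> [g [h [E hg hh]]]; suff h0 : h = 0 by rewrite E h0 addr0.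
apply/eqP; rewrite -msupp_eq0; case Eh : (msupp h) => [//|w r].
have hw : w \in msupp h by rewrite Eh mem_head.
have : w \in msupp f \/ w \in msupp g.
  have : h = f - g by rewrite E addrC addKr.
  move=> E2; move: hw; rewrite E2 => /msuppB_le; rewrite mem_cat => /orP[]; by [left | right].
have := hh _ hw; rewrite ltnNge => /negP hn.
by case=> [/(power_ideal_out hu)|/(Gdeg _ hg)].
Qed.

End DetIdeals.

(** * Shapes of the bitableaux in the ideal *)

Section Rows.
Implicit Types (f : nat -> pt) (d : seq pt) (D : seq (seq pt)).

Lemma chain_mkseq f k : (forall c, c.+1 < k -> slt (f c) (f c.+1)) -> chain (mkseq f k).
Proof.
move=> h; apply/(sortedP o) => i; rewrite size_mkseq => hi.
by rewrite !nth_mkseq ?h // ltnW.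
Qed.

Lemma row_le_mkseq f g k l : l <= k ->
  (forall c, c < l -> (f c).1 <= (g c).1 /\ (f c).2 <= (g c).2) ->
  row_le (mkseq f k) (mkseq g l).
Proof.
move=> lk h; apply/row_leP; rewrite !size_mkseq; split=> // c hc.
by have hk := leq_trans hc lk; rewrite !nth_mkseq //; apply: h.
Qed.

Definition diag_row k : seq pt := mkseq (fun c => (c, c)) k.

Lemma std_diag s : sorted geq s -> std (map diag_row s).
Proof.
move=> hs; apply/andP; split.
  by apply/allP => _ /mapP[k _ ->]; apply: chain_mkseq => c _; rewrite /slt /= ltnS leqnn.
rewrite sorted_map; apply: sub_sorted hs => k l lk.
exact: row_le_mkseq.
Qed.

Lemma linit_mkseq f k : (forall c, c < k -> (f c).1 = c) ->
  [seq x.1 | x <- mkseq f k] == iota 0 (size (mkseq f k)).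
Proof.
move=> h; rewrite size_mkseq -[X in _ == X]map_id -map_comp; apply/eqP/eq_in_map => c.
by rewrite mem_iota => /h.
Qed.

Lemma linit_diag s : linit (map diag_row s).
Proof. by apply/allP => _ /mapP[k _ ->]; apply: linit_mkseq. Qed.

End Rows.

(** Shapes are compared up to order and empty rows, so that concatenated tableaux
    need not be sorted. *)
Definition eqsh (s s' : seq nat) := perm_eq [seq t <- s | 0 < t] [seq t <- s' | 0 < t].

Lemma eqsh_refl s : eqsh s s. Proof. exact: perm_refl. Qed.
#[local] Hint Resolve eqsh_refl : core.

Section Shapes.
Variables (K : fieldType) (m n : nat) (le : rel (mxmonom m n)).
Notation P := (mxpoly_ring K m n).
Notation bp := (@bitab_poly K m n).
Variable I : P -> Prop.
Hypothesis hle : @diagonal_term_order K m n le.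
Hypothesis hI : is_ideal I.
Hypothesis hshape : defined_by_shape I.
Hypothesis hG : G_KRS le I.
Implicit Types (D E : seq (seq (cell m n))) (s : seq nat).

Definition shape_in s := exists D, [/\ all (@is_minor m n) D, eqsh (map size D) s & I (bp D)].

Lemma eqsh_sym s s' : eqsh s s' = eqsh s' s.
Proof. by rewrite /eqsh perm_sym. Qed.

Lemma eqsh_trans s1 s2 s3 : eqsh s1 s2 -> eqsh s2 s3 -> eqsh s1 s3.
Proof. exact: perm_trans. Qed.

Lemma eqsh_perm s s' : perm_eq s s' -> eqsh s s'.
Proof. exact: perm_filter. Qed.

Lemma bitableau_sort D : all (@is_minor m n) D -> exists D',
  [/\ bitableau D', perm_eq D D' & Defs.shape D' = sort geq [seq t <- map size D | 0 < t]].
Proof.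
move=> hD; pose r := (fun d e : seq (cell m n) => size e <= size d).
have rtot : total r by move=> d e; rewrite /r; apply: leq_total.
have rtr : transitive r by move=> d e f; rewrite /r => h1 h2; apply: leq_trans h2 h1.
have gtr : transitive geq by move=> a b c h1 h2; apply: leq_trans h2 h1.
have ganti : antisymmetric geq by move=> a b; rewrite /geq /= => h; apply/eqP; rewrite eqn_leq andbC.
have gtot : total geq by move=> a b; apply: leq_total.
have ss : sorted geq (map size (sort r D)).
  by rewrite sorted_map; apply: sort_sorted.
exists (sort r D); split.
- by rewrite /bitableau all_sort hD ss.
- by rewrite perm_sym perm_sort.
- rewrite /Defs.shape; apply: (sorted_eq gtr ganti).
  + exact: (sorted_filter gtr _ ss).
  + exact: (sort_sorted gtot).
  + by rewrite perm_sym perm_sort perm_filter // perm_map // perm_sym perm_sort.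
Qed.

Lemma shape_in_all s D : shape_in s -> all (@is_minor m n) D -> eqsh (map size D) s -> I (bp D).
Proof.
move=> [E [hE sE IE]] hD sD.
have [D' [bD' pD' sD']] := bitableau_sort hD.
have [E' [bE' pE' sE']] := bitableau_sort hE.
rewrite (bitab_perm _ pD'); rewrite (bitab_perm _ pE') in IE.
apply/(hshape.2 _ _ bD' bE') => //; rewrite sD' sE'.
have h : eqsh (map size D) (map size E).
  by rewrite eqsh_sym in sE; apply: eqsh_trans sD sE.
apply/perm_sortP => //.
- by move=> a b; apply: leq_total.
- by move=> a b c h1 h2; apply: leq_trans h2 h1.
- by move=> a b; rewrite /geq /= => h'; apply/eqP; rewrite eqn_leq andbC.
Qed.

Lemma shape_in_eqsh s s' : eqsh s s' -> shape_in s -> shape_in s'.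
Proof. by move=> h [D [h1 h2 h3]]; exists D; split=> //; apply: eqsh_trans h2 h. Qed.

Definition cellsD (D : seq (seq pt)) : seq (seq (cell m n)) := map (@cells m n) D.

Lemma size_cells (d : seq pt) : all (inbox m n) d -> size (cells m n d) = size d.
Proof. by move/pos_cells => h; rewrite -(size_map (@pos m n)) h. Qed.

Lemma map_size_cells (D : seq (seq pt)) : all (all (inbox m n)) D -> map size (cellsD D) = map size D.
Proof.
move=> /allP h; rewrite /cellsD -map_comp; apply/eq_in_map => d /h; exact: size_cells.
Qed.

Lemma minor_cells (D : seq (seq pt)) : all (all (inbox m n)) D -> all chain D ->
  all (@is_minor m n) (cellsD D).
Proof.
move=> /allP h /allP hc; apply/allP => _ /mapP[d hd ->].
by rewrite is_minor_pos pos_cells ?hc ?h.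
Qed.

(** On [D] KRS is the product of the diagonals, so [krs_pullback] applies as soon as
    the cells of [D] can be regrouped into chains forming a bitableau in the ideal. *)
Lemma KRS_up (D E : seq (seq pt)) : std D -> linit D -> all (all (inbox m n)) D ->
  all chain E -> all (all (inbox m n)) E -> perm_eq (flatten D) (flatten E) ->
  shape_in (map size E) -> shape_in (map size D).
Proof.
move=> sD iD bD cE bE pe hS.
have hE := minor_cells bE cE.
have IE : I (bp (cellsD E)) by apply: (shape_in_all hS hE); rewrite map_size_cells.
have [E' [bE' pE' _]] := bitableau_sort hE.
have sD' : standard (cellsD D) by rewrite standard_pos post_cells.
exists (cellsD D); split.
- by case/andP: sD' => /andP[].
- by rewrite map_size_cells.
apply: (krs_pullback hle hG bE') => //; first by rewrite -(bitab_perm _ pE').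
rewrite krs_linit // ?post_cells //; apply/perm_diag_mnm.
have h1 := perm_flatten pE'; rewrite perm_sym in h1.
rewrite perm_sym; apply: (perm_trans h1); rewrite perm_sym !flatten_cells.
exact: perm_pmap.
Qed.

(** This is [krs_divisible] in terms of cells, [M] being a list of the cells removed
    from [D]. *)
Lemma KRS_down (D : seq (seq pt)) (L M : seq pt) : std D -> all (all (inbox m n)) D ->
  run D L -> perm_eq L M -> shape_in (map size D) ->
  exists E : seq (seq pt), [/\ all chain E, sorted geq (map size E), shape_in (map size E)
     & forall u, count_mem u (flatten E) <= count_mem u M].
Proof.
move=> sD bD rD pL hS.
have sD' : standard (cellsD D) by rewrite standard_pos post_cells.
have ID : I (bp (cellsD D)).
  by apply: (shape_in_all hS); [case/andP: sD' => /andP[] | rewrite map_size_cells].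
have [E [/andP[cE srt] IE /mnm_lepP hdiv]] := krs_divisible hle hG sD' ID.
have post : map (map (@pos m n)) (cellsD D) = D by rewrite post_cells.
have [L' eL kD] : exists2 L', map (@pos m n) L' = L & krs_mnm (cellsD D) = diag_mnm L'.
  by apply: krs_mnm_run; rewrite post.
have sz : map size (map (map (@pos m n)) E) = map size E.
  by rewrite -map_comp; apply: eq_map => d /=; rewrite size_map.
exists (map (map (@pos m n)) E); rewrite sz; split=> //.
- by apply/allP => _ /mapP[d hd ->]; rewrite -is_minor_pos (allP cE).
- by exists E; split.
move=> u; rewrite -(permP pL) -eL -map_flatten.
case: (boolP (u \in map (@pos m n) (flatten E))) => [/mapP[x _ ->]|/count_memPn -> //].
have hc (A : seq (cell m n)) : count_mem (pos x) (map (@pos m n) A) = count_mem x A.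
  by rewrite count_map; apply: eq_count => y /=; rewrite (inj_eq (@pos_inj m n)).
by rewrite !hc -!diag_mnmE -kD; apply: hdiv.
Qed.

Definition pmin := minn m n.

Lemma inbox_diag s : all (fun k => k <= pmin) s -> all (all (inbox m n)) (map diag_row s).
Proof.
move=> /allP h; apply/allP => _ /mapP[k hk ->]; apply/allP => u /mapP[c].
by rewrite mem_iota /inbox /= => hc -> /=; move: (h _ hk); rewrite /pmin; lia.
Qed.

Lemma geq_trans : transitive geq.
Proof. by move=> a b c h1 h2; apply: leq_trans h2 h1. Qed.
Lemma geq_total : total geq.
Proof. by move=> a b; apply: leq_total. Qed.

Lemma map_size_diag s : map size (map diag_row s) = s.
Proof. by rewrite -map_comp -[RHS]map_id; apply: eq_map => k /=; rewrite size_mkseq. Qed.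

(** The diagonals of lengths [x.+1] and [y.-1] consist of the same cells as two
    chains of lengths [x] and [y]: the last cell [(x, x)] of the longer one also
    extends the shorter one. *)
Lemma move_box x y r : 0 < y <= x -> x < pmin -> all (fun k => k <= pmin) r ->
  shape_in [:: x, y & r] -> shape_in [:: x.+1, y.-1 & r].
Proof.
move=> /andP[y0 yx] xp hr hS.
set t := [:: x.+1, y.-1 & r].
have pt : perm_eq (sort geq t) t by rewrite perm_sort.
have ht : all (fun k => k <= pmin) t by rewrite /= xp hr andbT; lia.
suff : shape_in (map size (map diag_row (sort geq t))).
  by rewrite map_size_diag; apply: shape_in_eqsh; apply: eqsh_perm.
have cd k : chain (diag_row k) by apply: chain_mkseq => c _; rewrite /slt /= ltnS leqnn.
apply: (KRS_up (E := [:: diag_row x, rcons (diag_row y.-1) (x, x) & map diag_row r])).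
- by apply: std_diag; apply: sort_sorted geq_total _.
- exact: linit_diag.
- by apply: inbox_diag; rewrite all_sort.
- rewrite /= cd /=; apply/andP; split; last by apply/allP => _ /mapP[k _ ->].
  rewrite -cats1; apply: chain_catI => // u /mapP[c]; rewrite mem_iota => hc ->.
  by rewrite /slt /=; lia.
- have ht' : all (fun k => k <= pmin) [:: x, y.-1 & r] by rewrite /= hr andbT; lia.
  have /= /and3P[h1 h2 h3] := inbox_diag ht'.
  rewrite /= h1 h3 andbT all_rcons h2 andbT.
  by rewrite /inbox /=; move: xp; rewrite /pmin; lia.
- have pf := perm_flatten (perm_map diag_row pt).
  apply: (perm_trans pf).
  have -> : map diag_row t = [:: rcons (diag_row x) (x, x), diag_row y.-1 & map diag_row r].
    by congr cons; apply: mkseqS.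
  by apply/permP => a; rewrite /= -!cats1 !count_cat /=; lia.
- rewrite /= map_size_diag size_rcons !size_mkseq prednK //.
Qed.

End Shapes.

(** * Tools for explicit KRS computations *)

Section Steps.
Implicit Types (f : nat -> pt) (d : seq pt) (D : seq (seq pt)).

Lemma bump_row_nth s d q : q < size d -> (nth o d q).2 <= s ->
  (forall c, q < c < size d -> s < (nth o d c).2) ->
  bump_row s d = Some (set_nth o d q ((nth o d q).1, s), (nth o d q).2).
Proof.
elim: d q => [|x d IH] [|q] //= hq hs h.
  have -> : bump_row s d = None.
    have := bump_rowP s d; case: (bump_row s d) => [[d' t] [d1 [y [d2 [E _ _ hy _]]]]|] //.
    have := h (size d1).+1; rewrite /= E nth_cat ltnn subnn /= size_cat /=.
    by lia.
  by rewrite hs.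
by rewrite (IH q) // => c hc; apply: (h c.+1).
Qed.

Lemma bump_mkseq s f g k q : q < k -> (f q).2 <= s -> (forall c, q < c < k -> s < (f c).2) ->
  (forall c, c < k -> g c = if c == q then ((f q).1, s) else f c) ->
  bump_row s (mkseq f k) = Some (mkseq g k, (f q).2).
Proof.
move=> hq hs h hg; rewrite (@bump_row_nth _ _ q) ?size_mkseq ?nth_mkseq //.
  congr (Some (_, _)); apply: (@eq_from_nth _ o); rewrite size_set_nth !size_mkseq.
    by apply/maxn_idPr.
  move=> i; rewrite (maxn_idPr hq) => hi.
  by rewrite nth_set_nth /= !nth_mkseq // hg.
by move=> c /andP[h1 h2]; rewrite nth_mkseq // h // h1.
Qed.

Definition inert s d := bump_row s d = Some (d, s).

Lemma inert_mkseq s f k q : q < k -> (f q).2 = s -> (forall c, q < c < k -> s < (f c).2) ->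
  inert s (mkseq f k).
Proof.
move=> hq hs h; rewrite /inert -{2}hs; apply: (bump_mkseq hq _ h); rewrite ?hs // => c _.
by case: eqP => // ->; rewrite -hs -surjective_pairing.
Qed.

Lemma inert_mem s d u : chain d -> u \in d -> u.2 = s -> inert s d.
Proof.
move=> cd ud us; have := bump_rowP s d; rewrite /inert.
case: (bump_row s d) => [[d' t] [d1 [x [d2 [E E' -> xs h]]]]|h]; last first.
  by have := h _ ud; rewrite us ltnn.
suff xE : x = u by rewrite E' E xE -us -surjective_pairing.
move: cd ud; rewrite E => /chain_cat[_ _ h1 _ _].
rewrite mem_cat inE => /or3P[/h1|/eqP -> //|/h]; rewrite /slt us ?ltnn //.
by move=> /andP[_]; rewrite ltnNge xs.
Qed.

(** The part of [delete] above the plucked row: the entry [s] climbs through all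
    the rows of [D]. *)
Fixpoint bumps s D : option (seq (seq pt) * nat) :=
  if D is d :: D1 then
    if bumps s D1 is Some (D1', t) then
      if bump_row t d is Some (d', t') then Some (d' :: D1', t') else None
    else None
  else Some ([::], s).

Lemma bumps_cat s D1 D2 : bumps s (D1 ++ D2) =
  if bumps s D2 is Some (D2', t) then
    if bumps t D1 is Some (D1', t') then Some (D1' ++ D2', t') else None
  else None.
Proof.
elim: D1 => [|d D1 IH] /=; first by case: (bumps s D2) => [[]|].
rewrite IH; case: (bumps s D2) => [[D2' t]|] //.
by case: (bumps t D1) => [[D1' t']|] //; case: (bump_row t' d) => [[]|].
Qed.

Lemma bumps_inert s D : {in D, forall d, inert s d} -> bumps s D = Some (D, s).
Proof.
elim: D => //= d D IH h; rewrite IH => [|e he]; last by apply: h; rewrite inE he orbT.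
by have := h d (mem_head _ _); rewrite /inert => ->.
Qed.

Lemma delete_cat l D1 d D2 d' x D1' s : l \notin lefts D2 -> pluck l d = Some (d', x) ->
  bumps x.2 D1 = Some (D1', s) -> delete l (D1 ++ d :: D2) = Some (D1' ++ d' :: D2, (x.1, s)).
Proof.
move=> hl hp; elim: D1 D1' s => [|e D1 IH] D1' s /=.
  by move=> [<- <-]; rewrite delete_none // hp -surjective_pairing.
case: (bumps x.2 D1) IH => [[D3 t]|] // /(_ _ _ erefl) -> /=.
by case: (bump_row t e) => [[e' t']|] // [<- <-].
Qed.

Lemma pluck_rcons l d x : x.1 = l -> {in d, forall y, y.1 != l} -> pluck l (rcons d x) = Some (d, x).
Proof.
move=> hx; elim: d => [|y d IH] h /=; first by rewrite hx eqxx.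
rewrite (negPf (h y (mem_head _ _))) IH // => z hz.
by apply: h; rewrite inE hz orbT.
Qed.

Inductive steps : seq (seq pt) -> seq pt -> seq (seq pt) -> Prop :=
| steps_nil D : steps D [::] D
| steps_cons l D D1 x L D2 : {in lefts D, forall k, k <= l} ->
    delete l D = Some (D1, x) -> steps D1 L D2 -> steps D (x :: L) D2.

Lemma steps_run D1 L1 D2 L2 : steps D1 L1 D2 -> run D2 L2 -> run D1 (L1 ++ L2).
Proof.
elim=> // l D E x L F h1 h2 _ IH /IH h3 /=.
exact: run_cons h2 h3.
Qed.

Lemma steps_std D1 L D2 : steps D1 L D2 -> std D1 -> std D2.
Proof.
elim=> // l D E x {}L F h1 h2 _ IH sD; apply: IH.
have [D' [y [dD sD' _ _ _]]] := delete_std sD h1 (delete_some h2).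
by move: dD; rewrite h2 => -[-> _].
Qed.

Lemma lefts_leP l D : all (all (fun x => x.1 <= l)) D -> {in lefts D, forall k, k <= l}.
Proof.
move=> /allP h k /mapP[x hf ->]; case/flattenP: hf => d hd hx.
by have /allP := h _ hd; apply.
Qed.

Lemma lefts_notin l D : all (all (fun x => x.1 != l)) D -> l \notin lefts D.
Proof.
move=> /allP h; apply/negP => /mapP[x hf E]; case/flattenP: hf => d hd hx.
by have /allP/(_ _ hx) := h _ hd; rewrite E eqxx.
Qed.

Lemma all_mkseq (a : pred pt) f k : (forall c, c < k -> a (f c)) -> all a (mkseq f k).
Proof. by move=> h; apply/allP => u /mapP[c]; rewrite mem_iota => hc ->; apply: h. Qed.

Lemma lefts_split l D : l \in lefts D -> exists D1 d D2,
  [/\ D = D1 ++ d :: D2, l \in [seq x.1 | x <- d] & l \notin lefts D2].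
Proof.
elim: D => [|d D IH] //; rewrite lefts_cons mem_cat => hl.
have [/IH [D1 [e [D2 [-> h1 h2]]]]|hD] := boolP (l \in lefts D).
  by exists (d :: D1), e, D2.
by exists [::], d, D; split=> //; move: hl; rewrite (negPf hD) orbF.
Qed.

Definition trim k D := map (filter (fun u : pt => u.1 <= k)) D.

Lemma trim_id k D : {in lefts D, forall l, l <= k} -> trim k D = D.
Proof.
move=> h; rewrite /trim -[RHS]map_id; apply/eq_in_map => d hd.
apply/all_filterP/allP => u hu; apply: h; apply/mapP; exists u => //.
by apply/flattenP; exists d.
Qed.

(** When each cell to be removed has its right entry repeated in all the rows
    above it, every bump replaces an entry by itself, and the cells with left
    entry above [k] leave the tableau as they are. *)
Lemma steps_trim k D : std D ->
  (forall i j u, i < j < size D -> u \in nth [::] D j -> k < u.1 ->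
     exists2 v, v \in nth [::] D i & v.2 = u.2 /\ v.1 <= u.1) ->
  exists2 L, steps D L (trim k D) & perm_eq (flatten D) (L ++ flatten (trim k D)).
Proof.
elim/run_ind_std => [D1 h _|l D1 D' x sD hle hl dD sD' /(_ sD') IH H].
  have hk : {in lefts D1, forall l, l <= k} by move=> l; rewrite /lefts h.
  by exists [::]; rewrite (trim_id hk) ?perm_refl //; apply: steps_nil.
case: (leqP l k) => hlk.
  have hk : {in lefts D1, forall l', l' <= k} by move=> l' /hle h; apply: leq_trans h hlk.
  by exists [::]; rewrite (trim_id hk) ?perm_refl //; apply: steps_nil.
have [E1 [d [E2 [E hd hE2]]]] := lefts_split hl.
have cd : chain d by move: sD; rewrite E => /andP[]; rewrite all_cat /= => /and3P[].
have := pluckP l d; case hp : (pluck l d) => [[d' y]|]; last first.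
  by move=> h; case/mapP: hd => z /h /eqP hz Ez; case: hz.
move=> [d1 [d2 [Ed Ed' y1]]].
have d2E : d2 = [::].
  apply: (@chain_maxlast l d1 y d2); rewrite -?Ed // => z hz; apply: hle.
  by apply/mapP; exists z => //; rewrite E flatten_cat mem_cat /= mem_cat hz orbT.
rewrite d2E cats0 in Ed'; rewrite d2E cats1 in Ed; subst d d' d2.
have szE : size D1 = (size E1 + (size E2).+1) by rewrite E size_cat.
have inE1 : bumps y.2 E1 = Some (E1, y.2).
  apply: bumps_inert => e he.
  have [i hi Ei] : exists2 i, i < size E1 & nth [::] E1 i = e.
    by exists (index e E1); rewrite ?index_mem // nth_index.
  have [|||v hv [v2 _]] := H i (size E1) y; rewrite ?y1 //.
  - by rewrite hi szE; lia.
  - by rewrite E nth_cat ltnn subnn /= mem_rcons mem_head.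
  rewrite E nth_cat hi Ei in hv.
  apply: inert_mem hv v2; move: sD; rewrite E => /andP[]; rewrite all_cat => /andP[/allP h _] _.
  exact: h.
have := delete_cat hE2 hp inE1; rewrite -E dD => -[? xE]; subst D'.
have [|L sL pL] := IH.
  move=> i j u; rewrite size_cat /= => hij hu hku.
  have hnth a : a != size E1 -> nth [::] (E1 ++ d1 :: E2) a = nth [::] D1 a.
    move=> ha; rewrite E !nth_cat; case: ltnP => // hge.
    by have -> : a - size E1 = (a - size E1).-1.+1 by lia.
  have hu' : u \in nth [::] D1 j.
    have [ej|/hnth <- //] := eqVneq j (size E1).
    by move: hu; rewrite ej E !nth_cat ltnn subnn /= mem_rcons inE => ->; rewrite orbT.
  have [|||v hv [v2 v1]] := H i j u; rewrite ?szE //.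
  have [ei|ni] := eqVneq i (size E1); last by exists v; rewrite ?hnth.
  have nv : v != y.
    apply/eqP => Ev; case/negP: hE2; apply/mapP.
    have hul : u.1 = l.
      apply/eqP; rewrite eqn_leq -{2}y1 -Ev v1 andbT; apply: hle; apply/mapP; exists u => //.
      by apply/flattenP; exists (nth [::] D1 j) => //; apply: mem_nth; rewrite szE; case/andP: hij.
    exists u => //; apply/flattenP; exists (nth [::] D1 j) => //.
    rewrite E nth_cat ifN; last by rewrite -leqNgt; lia.
    have hs : (j - size E1).-1 < size E2 by move: hij; rewrite ei; lia.
    have -> : j - size E1 = (j - size E1).-1.+1 by lia.
    by rewrite /= mem_nth.
  exists v => //; move: hv; rewrite ei E !nth_cat ltnn subnn /= mem_rcons inE.
  by rewrite (negPf nv).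
have tE : trim k (E1 ++ d1 :: E2) = trim k D1.
  by rewrite E /trim !map_cat /= filter_rcons leqNgt y1 hlk.
exists (x :: L).
  by apply: steps_cons dD _; rewrite // -tE.
rewrite -tE /=; have -> : x = y by rewrite xE -surjective_pairing.
have h1 : perm_eq (flatten D1) (y :: flatten (E1 ++ d1 :: E2)).
  by rewrite E !flatten_cat /= -cats1; apply/permP => a; rewrite /= !count_cat /=; lia.
by apply: perm_trans h1 _; rewrite perm_cons.
Qed.

Lemma sorted_join (T : eqType) (R : rel T) A x B : sorted R A -> {in A, forall a, R a x} ->
  path R x B -> sorted R (A ++ x :: B).
Proof.
case: A => [|a A] //= h1 h2 h3; rewrite cat_path h1 /= h3 andbT.
by apply: h2; rewrite mem_last.
Qed.

Lemma diag_inert k s : s < k -> inert s (diag_row k).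
Proof. by move=> h; apply: (@inert_mkseq s (fun c => (c, c)) k s) => //= c /andP[]. Qed.

Lemma chain_diag k : chain (diag_row k).
Proof. by apply: chain_mkseq => c _; rewrite /slt /= ltnS leqnn. Qed.

End Steps.

(** * Two standard tableaux of unbalanced shape *)

Lemma filter_mkseq (a : pred pt) f j k : j <= k -> (forall c, c < j -> a (f c)) ->
  (forall c, j <= c < k -> ~~ a (f c)) -> filter a (mkseq f k) = mkseq f j.
Proof.
move=> jk h1 h2; rewrite /mkseq -(subnKC jk) iotaD map_cat filter_cat add0n.
have -> : [seq u <- [seq f i | i <- iota 0 j] | a u] = [seq f i | i <- iota 0 j].
  by apply/all_filterP/allP => u /mapP[c]; rewrite mem_iota => hc ->; apply: h1.
rewrite [X in _ ++ X](_ : _ = [::]) ?cats0 //; apply/eqP; rewrite -(negbK (_ == _)) -has_filter.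
apply/hasPn => u /mapP[c]; rewrite mem_iota => hc ->; apply: h2.
by move: hc jk; clear; lia.
Qed.

Lemma count_mkseq_swap (a : pred pt) f g k q : q < k -> (forall c, c < k -> c != q -> f c = g c) ->
  count a (mkseq f k) + a (g q) = count a (mkseq g k) + a (f q).
Proof.
elim: k => // k IH hq h; rewrite !mkseqS -!cats1 !count_cat /= !addn0.
have [qk|ne] := eqVneq q k.
  have -> : mkseq f k = mkseq g k.
    by apply/eq_in_map => c; rewrite mem_iota add0n /= => hc; apply: h; [exact: ltnW | rewrite qk neq_ltn hc].
  by rewrite qk; clear; lia.
have {}IH : count a (mkseq f k) + a (g q) = count a (mkseq g k) + a (f q).
  by apply: IH => [|c hc]; [rewrite ltn_neqAle ne -ltnS | apply: h; exact: ltnW].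
by rewrite (h k) // 1?eq_sym //; move: IH; clear; lia.
Qed.

Lemma steps_singles l A i j : {in A, forall d, inert 0 d} -> all (all (fun u => u.1 <= l)) A ->
  0 < l -> steps (A ++ nseq i [:: (l, 0)] ++ nseq j [::]) (nseq i (l, 0)) (A ++ nseq (i + j) [::]).
Proof.
move=> hA hl l0; elim: i j => [|i IH] j; first exact: steps_nil.
apply: (@steps_cons l _ (A ++ nseq i [:: (l, 0)] ++ nseq j.+1 [::])); last by rewrite addSnnS; apply: IH.
  by apply: lefts_leP; rewrite !all_cat hl !all_nseq /= leqnn orbT.
have -> : A ++ nseq i.+1 [:: (l, 0)] ++ nseq j [::] = (A ++ nseq i [:: (l, 0)]) ++ [:: (l, 0)] :: nseq j [::].
  by rewrite -addn1 nseqD -!catA.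
have -> : A ++ nseq i [:: (l, 0)] ++ nseq j.+1 [::] = (A ++ nseq i [:: (l, 0)]) ++ [::] :: nseq j [::].
  by rewrite -!catA.
apply: (@delete_cat l _ _ _ _ (l, 0)).
- by apply: lefts_notin; rewrite all_nseq orbT.
- by rewrite /= eqxx.
- apply: bumps_inert => d; rewrite mem_cat mem_nseq => /orP[/hA //|/andP[_ /eqP ->]].
  by rewrite /inert /=.
Qed.

Section Shape.
Variables (m n b x : nat) (T Z : seq nat) (N : nat).
Hypothesis hx : b + 4 <= x.
Hypothesis hxm : x <= m.
Hypothesis hxn : x <= n.
Hypothesis sT : sorted geq T.
Hypothesis hT : all (fun y => (x <= y) && (y <= minn m n)) T.
Hypothesis sZ : sorted geq Z.
Hypothesis hZ : all (fun z => (z == b.+2) || (z == b.+3)) Z.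

Lemma hTP y : y \in T -> x <= y /\ y <= minn m n.
Proof. by move/(allP hT)/andP. Qed.

Lemma hZP z : z \in Z -> z = b.+2 \/ z = b.+3.
Proof. by move/(allP hZ)/orP => [/eqP|/eqP]; [left | right]. Qed.

(** The shape of these tableaux is [T], [x], [Z], [b.+2], followed by [N] parts 1:
    [b.+2] is the smallest part above 1, [Z] collects the other parts that are
    [b.+2] or [b.+3], and [x] is the smallest part above those. *)
Definition tabl (rx : seq pt) (rm : nat -> seq pt) (rl rs : seq pt) :=
  map diag_row T ++ rx :: map rm Z ++ rl :: nseq N rs.

Lemma tabl_sizes f g h s1 : map size (tabl (mkseq f x) (fun z => mkseq (g z) z) (mkseq h b.+2) [:: s1]) =
  T ++ x :: Z ++ b.+2 :: nseq N 1.
Proof.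
rewrite /tabl !map_cat /= map_cat /= map_nseq /= !size_mkseq -!map_comp.
congr (_ ++ _ :: _ ++ _).
- by rewrite -[RHS]map_id; apply: eq_map => k /=; rewrite size_mkseq.
- by rewrite -[RHS]map_id; apply: eq_map => k /=; rewrite size_mkseq.
- by rewrite size_map size_iota.
Qed.

Lemma tabl_all (a : pred (seq pt)) rx rm rl rs : {in T, forall y, a (diag_row y)} -> a rx ->
  {in Z, forall z, a (rm z)} -> a rl -> a rs -> all a (tabl rx rm rl rs).
Proof.
move=> h1 h2 h3 h4 h5.
have A1 : all a (map diag_row T) by apply/allP => d /mapP[k hk ->]; apply: h1.
have A2 : all a (map rm Z) by apply/allP => d /mapP[k hk ->]; apply: h3.
by rewrite /tabl all_cat A1 /= h2 all_cat A2 /= h4 all_nseq h5 orbT.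
Qed.

Lemma tabl_std rx rm rl rs : chain rx -> {in Z, forall z, chain (rm z)} -> chain rl -> chain rs ->
  {in T, forall y, row_le (diag_row y) rx} -> {in Z, forall z, row_le rx (rm z)} ->
  {in Z &, forall y z, z <= y -> row_le (rm y) (rm z)} -> row_le rx rl ->
  {in Z, forall z, row_le (rm z) rl} -> row_le rl rs -> row_le rs rs ->
  std (tabl rx rm rl rs).
Proof.
move=> c1 c2 c3 c4 h1 h2 h3 h4 h5 h6 h7; apply/andP; split.
  by apply: tabl_all => // y _; apply: chain_diag.
apply: sorted_join.
- rewrite sorted_map; apply: sub_sorted sT => k l lk.
  exact: row_le_mkseq.
- by move=> _ /mapP[y hy ->]; apply: h1.
rewrite -[path _ _ _]/(sorted row_le ((rx :: map rm Z) ++ rl :: nseq N rs)).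
apply: sorted_join.
- rewrite /=; have : {in map rm Z, forall d, row_le rx d} by move=> _ /mapP[z hz ->]; apply: h2.
  have : sorted row_le (map rm Z).
    rewrite sorted_map; apply: (sub_in_sorted (P := mem Z)) sZ; last exact/allP.
    by move=> y z hy hz; apply: h3.
  by case: (map rm Z) => //= d D -> h; rewrite h ?mem_head.
- by move=> d; rewrite inE => /predU1P[-> //|/mapP[z hz ->]]; apply: h5.
- by case: N => //= k; rewrite h6 /=; elim: k => //= k ->; rewrite h7.
Qed.

Section Wide.
Hypothesis hxn1 : x < n.
Let m1 := m.-1.
Definition wide_rx k := mkseq (fun c => if c < k then (c, c) else (c, c.+1)) x.
Definition wide_rm e z := mkseq (fun c => if c.+1 == z then (m1, e) else (c, c)) z.
Definition wide_rl e := mkseq (fun c => if c < b then (c, c) else if c == b then (b, b.+2) else (m1, e)) b.+2.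
Definition wide_rs : seq pt := [:: (0, b.+2)].

(** For a matrix with more than [x] columns. The KRS monomial of [wideD] is the
    product of the cells of [wideM]. The rows of
    [wideM] have the same lengths, but the row [wide_rl b.+2] is not a chain: its
    cells [(b, b.+2)] and [(m.-1, b.+2)] lie in one column. The last part of the
    argument is that the cells of [wideM] cannot be rearranged into chains of these
    lengths. *)
Definition wideD := tabl (wide_rx b.+3) (wide_rm b.+2) (wide_rl b.+3) wide_rs.
Definition wideM := tabl (wide_rx b.+2) (wide_rm b.+2) (wide_rl b.+2) wide_rs.

Lemma wideD_std : std wideD.
Proof.
apply: tabl_std.
- by apply: chain_mkseq => c hc; rewrite /slt; case: ifP => ?; case: ifP => ? /=; lia.
- move=> z /hZP hz; apply: chain_mkseq => c hc; rewrite /slt /m1.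
  by case: ifP => ?; case: ifP => ? /=; lia.
- apply: chain_mkseq => c hc; rewrite /slt /m1.
  by do ![case: ifP => ?] => //=; lia.
- by [].
- move=> y /hTP [h1 h2]; apply: row_le_mkseq => // c hc.
  by case: ifP => ? /=; lia.
- move=> z /hZP hz; apply: row_le_mkseq => [|c hc]; first by lia.
  by rewrite /m1; case: ifP => ?; case: ifP => ? /=; lia.
- move=> y z /hZP hy /hZP hz zy; apply: row_le_mkseq => // c hc.
  by rewrite /m1; case: ifP => ?; case: ifP => ? /=; lia.
- apply: row_le_mkseq => [|c hc]; first by lia.
  by rewrite /m1; do ![case: ifP => ?] => //=; lia.
- move=> z /hZP hz; apply: row_le_mkseq => [|c hc]; first by lia.
  by rewrite /m1; do ![case: ifP => ?] => //=; lia.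
- apply: (@row_le_mkseq _ (fun=> (0, b.+2)) b.+2 1) => // c.
  by case: c => // _; case: ifP => //=; case: b.
- exact: (@row_le_mkseq (fun=> (0, b.+2)) (fun=> (0, b.+2)) 1 1).
Qed.

Lemma wideD_inbox : all (all (inbox m n)) wideD.
Proof.
rewrite /inbox; apply: tabl_all.
- by move=> y /hTP [h1 h2]; apply: all_mkseq => c hc /=; lia.
- by apply: all_mkseq => c hc; case: ifP => ? /=; lia.
- by move=> z /hZP hz; apply: all_mkseq => c hc; rewrite /m1; case: ifP => ? /=; lia.
- by apply: all_mkseq => c hc; rewrite /m1; do ![case: ifP => ?] => /=; lia.
- by rewrite /=; lia.
Qed.

Let rb z := diag_row z.-1.

Lemma bump_wide_rx : bump_row b.+3 (wide_rx b.+3) = Some (wide_rx b.+2, b.+2).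
Proof.
clear -hx; rewrite /wide_rx.
rewrite (@bump_mkseq _ _ (fun c => if c < b.+2 then (c, c) else (c, c.+1)) _ b.+2).
- by rewrite ltnSn.
- by lia.
- by rewrite ltnSn /=.
- by move=> c hc; case: ifP => ? /=; lia.
- move=> c hc; rewrite ltnSn /=; have [->|ne] := eqVneq c b.+2; first by rewrite ltnn.
  by do ![case: ifP => ?] => //; lia.
Qed.

Lemma inert_wide_rx : inert b.+2 (wide_rx b.+3).
Proof.
clear -hx; apply: (@inert_mkseq _ _ _ b.+2) => [||c hc]; first by lia.
  by rewrite ltnSn.
by case: ifP => ? /=; lia.
Qed.

Lemma bump_wide_rm z : z = b.+2 \/ z = b.+3 ->
  bump_row b.+3 (wide_rm b.+2 z) = Some (rcons (rb z) (m1, b.+3), b.+2).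
Proof.
clear; move=> hz; have {hz} [z' -> hz] : exists2 z', z = z'.+1 & z' = b.+1 \/ z' = b.+2.
  by case: hz => ->; [exists b.+1 | exists b.+2]; auto.
have -> : rcons (rb z'.+1) (m1, b.+3) = wide_rm b.+3 z'.+1.
  rewrite /wide_rm mkseqS eqxx; congr rcons; apply/eq_in_map => c; rewrite mem_iota => hc.
  by rewrite eqSS; case: ifP => //; lia.
rewrite /wide_rm (@bump_mkseq _ _ (fun c => if c.+1 == z'.+1 then (m1, b.+3) else (c, c)) _ z') ?eqxx //=.
- by move=> c; lia.
- by move=> c hc; rewrite eqSS; case: ifP.
Qed.

Lemma inert_wide_rm z : z = b.+2 \/ z = b.+3 -> inert b.+2 (wide_rm b.+2 z).
Proof.
clear; move=> hz; apply: (@inert_mkseq _ _ _ z.-1) => [||c hc]; first by lia.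
  by case: ifP => ? //; lia.
by lia.
Qed.

Lemma lefts_wide_rm e z : 0 < m -> z = b.+2 \/ z = b.+3 -> b.+3 < m -> all (fun u : pt => u.1 <= m1) (wide_rm e z).
Proof.
clear; move=> m0 hz hm; apply: all_mkseq => c hc; case: ifP => ? //=.
by rewrite /m1; lia.
Qed.

Lemma all_diag_m1 k : k <= m -> all (fun u : pt => u.1 <= m1) (diag_row k).
Proof. by clear; move=> h; apply: all_mkseq => c hc /=; rewrite /m1; lia. Qed.

(** Deletions of the left entry [m.-1]. The plucked right entry [b.+3] replaces
    [b.+2] in the row above, and [b.+2] climbs unchanged through the remaining rows;
    the next deletion thus starts one row higher. After the rows of [Z], the entry
    [b.+3] ends up in the row of length [x]. *)
Lemma wide_steps Z' e0 Bs : all (fun z => (z == b.+2) || (z == b.+3)) Z' ->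
  all (all (fun u => u.1 <= m1)) Bs -> all (fun u => u.1 <= m1) e0 ->
  all (all (fun u => u.1 != m1)) Bs -> all (fun u => u.1 != m1) e0 ->
  steps (map diag_row T ++ wide_rx b.+3 :: map (wide_rm b.+2) Z' ++ rcons e0 (m1, b.+3) :: Bs)
    (nseq (size Z').+1 (m1, b.+2))
    (map diag_row T ++ wide_rx b.+2 :: map rb Z' ++ e0 :: Bs).
Proof.
have hTl : all (all (fun u : pt => u.1 <= m1)) (map diag_row T).
  by apply/allP => _ /mapP[y /hTP [h1 h2] ->]; apply: all_diag_m1; clear -h2; lia.
have hxl k : all (fun u : pt => u.1 <= m1) (wide_rx k).
  by clear -hxm; apply: all_mkseq => c hc; rewrite /m1; case: ifP => _ /=; lia.
have hTi : {in map diag_row T, forall d, inert b.+2 d}.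
  by move=> _ /mapP[y /hTP [h1 h2] ->]; apply: diag_inert; clear -h1 hx; lia.
have hm : b.+3 < m by clear -hx hxm; lia.
elim/last_ind: Z' e0 Bs => [|Z' z IH] e0 Bs hZ' hB1 he1 hB2 he2.
all: have hpl : pluck m1 (rcons e0 (m1, b.+3)) = Some (e0, (m1, b.+3)) by
  apply: pluck_rcons => //; exact/allP.
all: have hBl : m1 \notin lefts Bs by apply: lefts_notin.
  apply: (@steps_cons m1 _ (map diag_row T ++ wide_rx b.+2 :: e0 :: Bs)); last exact: steps_nil.
    by apply: lefts_leP; rewrite all_cat hTl /= hxl all_rcons leqnn he1 hB1.
  rewrite /= -cat_rcons -[in RHS]cat_rcons; apply: (delete_cat hBl hpl).
  by rewrite -!cats1 bumps_cat /= bump_wide_rx (bumps_inert hTi).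
move: hZ'; rewrite all_rcons => /andP[hz hZ'].
have hZP' y : y \in Z' -> y = b.+2 \/ y = b.+3.
  by move/(allP hZ')/orP => [] /eqP ->; [left | right].
have hz' : z = b.+2 \/ z = b.+3 by case/orP: hz => /eqP ->; [left | right].
apply: (@steps_cons m1 _ (map diag_row T ++ wide_rx b.+3 :: map (wide_rm b.+2) Z' ++
    rcons (rb z) (m1, b.+3) :: e0 :: Bs)).
- apply: lefts_leP; rewrite all_cat hTl /= hxl all_cat /= all_rcons leqnn he1 hB1 !andbT.
  apply/allP => d /mapP[y]; rewrite mem_rcons inE => hy ->; apply: lefts_wide_rm => //.
    by clear -hm; lia.
  by case/predU1P: hy => [-> //|/hZP'].
- have -> : map diag_row T ++ wide_rx b.+3 :: map (wide_rm b.+2) (rcons Z' z) ++ rcons e0 (m1, b.+3) :: Bs =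
      ((map diag_row T ++ wide_rx b.+3 :: map (wide_rm b.+2) Z') ++ [:: wide_rm b.+2 z]) ++ rcons e0 (m1, b.+3) :: Bs.
    by rewrite map_rcons -cats1 -!catA /= -?catA.
  have -> : map diag_row T ++ wide_rx b.+3 :: map (wide_rm b.+2) Z' ++ rcons (rb z) (m1, b.+3) :: e0 :: Bs =
      ((map diag_row T ++ wide_rx b.+3 :: map (wide_rm b.+2) Z') ++ [:: rcons (rb z) (m1, b.+3)]) ++ e0 :: Bs.
    by rewrite -!catA /= -?catA.
  apply: (delete_cat hBl hpl).
  rewrite bumps_cat [bumps _ [:: _]]/= bump_wide_rm // bumps_inert // => d.
  rewrite mem_cat inE => /or3P[/hTi //|/eqP ->|/mapP[y /hZP' hy ->]]; first exact: inert_wide_rx.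
  exact: inert_wide_rm.
have e1 : all (fun u : pt => u.1 <= m1) (rb z) by apply: all_diag_m1; clear -hz' hm; lia.
have e2 : all (fun u : pt => u.1 != m1) (rb z).
  by clear -hz' hm; apply: all_mkseq => c hc; rewrite /m1 /=; lia.
have -> : map rb (rcons Z' z) ++ e0 :: Bs = map rb Z' ++ rb z :: e0 :: Bs by rewrite map_rcons cat_rcons.
rewrite size_rcons; apply: IH => //=; first by rewrite he1.
by rewrite he2.
Qed.

(** Once the left entries [m.-1] are gone, the tableau is left initial and
    [run_linit] applies. *)
Lemma wide_run : exists2 L, run wideD L & perm_eq L (flatten wideM).
Proof.
pose e0 : seq pt := mkseq (fun c => if c < b then (c, c) else (b, b.+2)) b.+1.
have rlE e : wide_rl e = rcons e0 (m1, e).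
  clear; rewrite /wide_rl mkseqS; congr rcons; last by do ![case: ifP => ?] => //; lia.
  apply/eq_in_map => c; rewrite mem_iota => hc; case: ifP => // ?.
  by have -> : c == b by lia.
have st := @wide_steps Z e0 (nseq N wide_rs) hZ.
have {st} [] := (st, wideD_std).
have a1 : all (all (fun u : pt => u.1 <= m1)) (nseq N wide_rs) by rewrite all_nseq /= orbT.
have a2 : all (fun u : pt => u.1 <= m1) e0.
  by clear -hx hxm; apply: all_mkseq => c hc; rewrite /m1; case: ifP => ? /=; lia.
have a3 : all (all (fun u : pt => u.1 != m1)) (nseq N wide_rs).
  by rewrite all_nseq /=; apply/orP; right; rewrite /m1; clear -hx hxm; lia.
have a4 : all (fun u : pt => u.1 != m1) e0.
  by clear -hx hxm; apply: all_mkseq => c hc; rewrite /m1; case: ifP => ? /=; lia.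
move=> /(_ a1 a2 a3 a4); rewrite -rlE -/(tabl _ _ _ _) -/wideD => st sD.
have sD' := steps_std st sD.
have [|L rL pL] := run_linit sD'.
  apply/allP => d; rewrite mem_cat inE mem_cat inE => /or4P[/mapP[y _ ->]|/eqP ->|/mapP[z _ ->]|].
  - exact: linit_mkseq.
  - by apply: linit_mkseq => c hc; case: ifP.
  - exact: linit_mkseq.
  case/orP=> [/eqP ->|].
    by clear; apply: linit_mkseq => c hc; case: ifP => //= ?; lia.
  by rewrite mem_nseq => /andP[_ /eqP ->].
exists (nseq (size Z).+1 (m1, b.+2) ++ L); first exact: steps_run st rL.
rewrite /wideM /tabl rlE.
have rmE z : z \in Z -> wide_rm b.+2 z = rcons (rb z) (m1, b.+2).
  move=> /hZP hz; clear -hz; rewrite /wide_rm /rb /diag_row; have -> : z = z.-1.+1 by lia.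
  rewrite mkseqS eqxx; congr rcons; apply/eq_in_map => c; rewrite mem_iota => hc.
  by case: ifP => //; lia.
have cntZ a : count a (flatten (map (wide_rm b.+2) Z)) =
    size Z * a (m1, b.+2) + count a (flatten (map rb Z)).
  clear -rmE; elim: Z rmE => //= z Z' IH h; rewrite !count_cat h ?mem_head // IH => [|z' hz'].
    by clear; rewrite -cats1 count_cat /=; lia.
  by apply: h; rewrite inE hz' orbT.
apply/permP => a; rewrite count_cat (permP pL) !flatten_cat /= !flatten_cat /= !count_cat /=.
by rewrite count_nseq cntZ -cats1 !count_cat /=; clear; lia.
Qed.

End Wide.

Section Tall.
Hypothesis hxm1 : x < m.
Let n1 := n.-1.
Definition tall_rx k := mkseq (fun c => if c < k then (c, c) else (c.+1, c)) x.
Definition tall_rm z := mkseq (fun c => if c.+1 == z then (c, n1) else (c, c)) z.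
Definition tall_rl e := mkseq (fun c => if c < b then (c, c) else if c == b then (b.+2, b) else (e, n1)) b.+2.
Definition tall_rs : seq pt := [:: (b.+2, 0)].

(** The counterpart of [wideD] with rows and columns exchanged, for a matrix with
    more than [x] rows. As KRS treats rows and columns differently, its computation
    is not the transpose of the previous one. *)
Definition tallD := tabl (tall_rx b.+3) tall_rm (tall_rl b.+3) tall_rs.
Definition tallM := tabl (tall_rx b.+2) tall_rm (tall_rl b.+2) tall_rs.

Lemma tallD_std : std tallD.
Proof.
apply: tabl_std.
- by clear -hx; apply: chain_mkseq => c hc; case: ifP => ?; case: ifP => ?; rewrite /slt /=; lia.
- move=> z /hZP hz; clear -hz hx hxn; apply: chain_mkseq => c hc; rewrite /n1.
  by case: ifP => ?; case: ifP => ?; rewrite /slt /=; lia.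
- clear -hx hxn; apply: chain_mkseq => c hc; rewrite /n1.
  by do ![case: ifP => ?] => //=; rewrite /slt /=; lia.
- by [].
- move=> y /hTP [h1 h2]; clear -h1; apply: row_le_mkseq => // c hc.
  by case: ifP => ? /=; lia.
- move=> z /hZP hz; clear -hz hx hxn; apply: row_le_mkseq => [|c hc]; first by lia.
  by rewrite /n1; case: ifP => ?; case: ifP => ? /=; lia.
- move=> y z /hZP hy /hZP hz zy; clear -hy hz zy hx hxn; apply: row_le_mkseq => // c hc.
  by rewrite /n1; case: ifP => ?; case: ifP => ? /=; lia.
- clear -hx hxn; apply: row_le_mkseq => [|c hc]; first by lia.
  by rewrite /n1; do ![case: ifP => ?] => //=; lia.
- move=> z /hZP hz; clear -hz hx hxn; apply: row_le_mkseq => [|c hc]; first by lia.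
  by rewrite /n1; do ![case: ifP => ?] => //=; lia.
- clear; apply: (@row_le_mkseq _ (fun=> (b.+2, 0)) b.+2 1) => // c.
  by case: c => // _; do ![case: ifP => ?] => //=; lia.
- exact: (@row_le_mkseq (fun=> (b.+2, 0)) (fun=> (b.+2, 0)) 1 1).
Qed.

Lemma tallD_inbox : all (all (inbox m n)) tallD.
Proof.
rewrite /inbox; apply: tabl_all.
- by move=> y /hTP [h1 h2]; clear -h2; apply: all_mkseq => c hc /=; lia.
- by clear -hx hxm1 hxn; apply: all_mkseq => c hc; case: ifP => ? /=; lia.
- move=> z /hZP hz; clear -hz hx hxm hxn; apply: all_mkseq => c hc; rewrite /n1.
  by case: ifP => ? /=; lia.
- by clear -hx hxm1 hxn; apply: all_mkseq => c hc; rewrite /n1; do ![case: ifP => ?] => /=; lia.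
- by clear -hx hxm hxn; rewrite /=; lia.
Qed.

Let rx' := mkseq (fun c => if c < b.+2 then (c, c) else (c, n1)) b.+3.
Let rl' := mkseq (fun c => if c < b then (c, c) else (b.+2, b)) b.+1.

Lemma tall_rlE e : tall_rl e = rcons rl' (e, n1).
Proof.
clear; rewrite /tall_rl mkseqS; congr rcons; last by do ![case: ifP => ?] => //; lia.
apply/eq_in_map => c; rewrite mem_iota => hc; case: ifP => // ?.
by have -> : c == b by lia.
Qed.

Lemma rl'E : rl' = rcons (diag_row b) (b.+2, b).
Proof.
clear; rewrite /rl' mkseqS ltnn; congr rcons.
by apply/eq_in_map => c; rewrite mem_iota add0n /= => ->.
Qed.

Lemma rx'E : rx' = rcons (diag_row b.+2) (b.+2, n1).
Proof.
clear; rewrite /rx' mkseqS ltnn; congr rcons.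
by apply/eq_in_map => c; rewrite mem_iota add0n /= => ->.
Qed.

Definition tab2 k rx rl rs := map (fun=> diag_row k) T ++ rx :: map tall_rm Z ++ rl :: nseq N rs.

Lemma tab2E k rx rl rs : tab2 k rx rl rs =
  ((map (fun=> diag_row k) T ++ [:: rx]) ++ map tall_rm Z) ++ rl :: nseq N rs.
Proof. by rewrite /tab2 -!catA. Qed.

Lemma trim_diag k y : k < y -> [seq u <- diag_row y | u.1 <= k] = diag_row k.+1.
Proof. by clear; move=> h; apply: filter_mkseq => [|c hc|c hc] /=; lia. Qed.

Lemma trim_tab k X rx rl rs k' : b.+2 <= k -> (forall y, y \in T -> [seq u <- X y | u.1 <= k] = diag_row k') ->
  all (fun u : pt => u.1 <= k) rl -> all (fun u : pt => u.1 <= k) rs ->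
  trim k (map X T ++ rx :: map tall_rm Z ++ rl :: nseq N rs) =
  tab2 k' [seq u <- rx | u.1 <= k] rl rs.
Proof.
move=> hk h1 h2 h3; rewrite /trim /tab2 !map_cat /= map_cat /= map_nseq.
rewrite (all_filterP h2) (all_filterP h3) -!map_comp; congr (_ ++ _ :: _ ++ _).
  by apply/eq_in_map => y /h1.
apply/eq_in_map => z /hZP hz; apply/all_filterP; clear -hz hk; apply: all_mkseq => c hc.
by case: ifP => ? /=; lia.
Qed.

Lemma rl'_le k : b.+2 <= k -> all (fun u : pt => u.1 <= k) rl'.
Proof. by clear; move=> h; apply: all_mkseq => c hc; case: ifP => ? /=; lia. Qed.

Lemma tall_rm_le k z : b.+2 <= k -> z \in Z -> all (fun u : pt => u.1 <= k) (tall_rm z).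
Proof.
by move=> hk /hZP hz; clear -hz hk; apply: all_mkseq => c hc; case: ifP => ? /=; lia.
Qed.

Lemma tab2_le l k rx rl rs : k <= l.+1 -> b.+2 <= l -> all (fun u : pt => u.1 <= l) rx ->
  all (fun u : pt => u.1 <= l) rl -> all (fun u : pt => u.1 <= l) rs ->
  {in lefts (tab2 k rx rl rs), forall j, j <= l}.
Proof.
move=> hk hl h1 h2 h3; apply: lefts_leP; rewrite /tab2 all_cat /= all_cat /= h1 h2 all_nseq h3 orbT !andbT.
apply/andP; split; apply/allP => d /mapP[y hy ->]; last exact: tall_rm_le.
by clear -hk; apply: all_mkseq => c hc /=; lia.
Qed.

(** The hypothesis of [steps_trim] for tableaux in which only the first
    [(size T).+1] rows have left entries above [k]. *)
Lemma trim_hyp k X rx rl rs :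
  (forall i j u, i < j < size T -> u \in X (nth 0 T j) -> k < u.1 ->
     exists2 v, v \in X (nth 0 T i) & v.2 = u.2 /\ v.1 <= u.1) ->
  (forall i u, i < size T -> u \in rx -> k < u.1 ->
     exists2 v, v \in X (nth 0 T i) & v.2 = u.2 /\ v.1 <= u.1) ->
  b.+2 <= k -> all (fun u : pt => u.1 <= k) rl -> all (fun u : pt => u.1 <= k) rs ->
  let D := map X T ++ rx :: map tall_rm Z ++ rl :: nseq N rs in
  forall i j u, i < j < size D -> u \in nth [::] D j -> k < u.1 ->
     exists2 v, v \in nth [::] D i & v.2 = u.2 /\ v.1 <= u.1.
Proof.
move=> h1 h2 hk h3 h4 D i j u /andP[ij jD] hu ku.
have hj : j <= size T.
  rewrite leqNgt; apply/negP => hj.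
  move: hu jD; rewrite /D nth_cat size_map ltnNge (ltnW hj) /= size_cat /= size_map.
  have -> : j - size T = (j - size T).-1.+1 by move: hj; clear; lia.
  rewrite /= => hu jD.
  have hall : all (all (fun u : pt => u.1 <= k)) (map tall_rm Z ++ rl :: nseq N rs).
    rewrite all_cat /= h3 all_nseq h4 orbT !andbT.
    by apply/allP => _ /mapP[z hz ->]; apply: tall_rm_le.
  have hs : (j - size T).-1 < size (map tall_rm Z ++ rl :: nseq N rs).
    by rewrite -ltnS prednK ?subn_gt0 // ltn_subLR // ltnW.
  have /(all_nthP [::])/(_ _ hs)/allP/(_ _ hu) := hall.
  by rewrite leqNgt ku.
have hi : i < size T := leq_trans ij hj.
have -> : nth [::] D i = X (nth 0 T i) by rewrite /D nth_cat size_map hi (nth_map 0).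
move: hj; rewrite leq_eqVlt => /orP[/eqP ej|hj].
  by apply: h2 => //; move: hu; rewrite /D nth_cat size_map ej ltnn subnn.
have hu' : u \in X (nth 0 T j) by move: hu; rewrite /D nth_cat size_map hj (nth_map 0).
by apply: (h1 i j u _ hu' ku); rewrite ij hj.
Qed.

Lemma mem_diag u k : (u \in diag_row k) = (u.1 == u.2) && (u.1 < k).
Proof.
apply/mapP/andP => [[c]|[/eqP h1 h2]].
  by rewrite mem_iota => hc -> /=.
by exists u.1; rewrite ?mem_iota // {2}h1 -surjective_pairing.
Qed.

Lemma T_nth i j : i < j < size T -> nth 0 T j <= nth 0 T i.
Proof.
move=> /andP[ij jT]; have iT := ltn_trans ij jT.
by apply: (sorted_ltn_nth geq_trans 0 sT) => //; rewrite inE.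
Qed.

Lemma T_nth_x i : i < size T -> x <= nth 0 T i.
Proof. by move=> h; have [] := hTP (mem_nth 0 h). Qed.

(** The cells with left entry at least [b.+3] leave as they are, except for
    [(b.+3, n.-1)], which exchanges [n.-1] for [b.+2] in the row of length [x]. *)
Lemma tall_run : exists2 L, run tallD L & perm_eq L (flatten tallM).
Proof.
have sD := tallD_std.
have [|L0 sL0 pL0] := @steps_trim b.+3 tallD sD.
  apply: trim_hyp => //.
  - move=> i j u hij; rewrite mem_diag => /andP[/eqP h1 h2] _; exists u => //.
    by rewrite mem_diag h1 eqxx -h1 /=; apply: leq_trans h2 (T_nth hij).
  - move=> i u hi /mapP[c]; rewrite mem_iota => /andP[_ hc] -> hk.
    exists (c, c); first by rewrite mem_diag eqxx /=; apply: leq_trans hc (T_nth_x hi).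
    by case: ifP => _ /=.
  - by rewrite tall_rlE all_rcons leqnn rl'_le.
  - by rewrite /= andbT.
have trim0 : trim b.+3 tallD = tab2 b.+4 (diag_row b.+3) (tall_rl b.+3) tall_rs.
  rewrite /tallD /tabl (@trim_tab _ _ _ _ _ b.+4) //.
  - congr (tab2 _ _ _ _); rewrite /tall_rx (@filter_mkseq _ _ b.+3).
    + by apply/eq_in_map => c; rewrite mem_iota add0n /= => ->.
    + by clear -hx; lia.
    + by clear; move=> c hc; rewrite hc /=; lia.
    + by clear; move=> c hc; case: ifP => ? /=; lia.
  - by move=> y /hTP [h1 h2]; apply: trim_diag; clear -h1 hx; lia.
  - by rewrite tall_rlE all_rcons leqnn rl'_le.
  - by rewrite /= andbT.
rewrite trim0 in sL0 pL0.
have sE0 := steps_std sL0 sD.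
(* Deletion of [(b.+3, n.-1)], the only one that changes an entry. *)
have hTi k s : s < k -> {in map (fun=> diag_row k) T, forall d, inert s d}.
  by move=> h _ /mapP[y _ ->]; apply: diag_inert.
have ev : steps (tab2 b.+4 (diag_row b.+3) (tall_rl b.+3) tall_rs) [:: (b.+3, b.+2)] (tab2 b.+4 rx' rl' tall_rs).
  apply: (@steps_cons b.+3 _ (tab2 b.+4 rx' rl' tall_rs)); last exact: steps_nil.
    apply: tab2_le => //; first by clear; apply: all_mkseq => c hc /=; lia.
      by rewrite tall_rlE all_rcons leqnn rl'_le.
    by rewrite /= leqnSn.
  rewrite !tab2E tall_rlE; apply: (@delete_cat _ _ _ _ _ (b.+3, n1)).
  - by apply: lefts_notin; rewrite all_nseq /= orbC neq_ltn ltnSn.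
  - apply: pluck_rcons => // u /(allP (rl'_le (leqnn _))) /= h; clear -h; lia.
  have hb : bumps n1 [:: diag_row b.+3] = Some ([:: rx'], b.+2).
    rewrite /bumps /diag_row (@bump_mkseq _ _ (fun c => if c < b.+2 then (c, c) else (c, n1)) _ b.+2) //.
    - by clear -hx hxn; rewrite /n1 /=; lia.
    - by clear; move=> c; lia.
    - move=> c hc; have [->|ne] := eqVneq c b.+2; first by rewrite ltnn.
      by case: ifP => //; clear -hc ne; lia.
  rewrite bumps_cat bumps_inert; last first.
    move=> d /mapP[z /hZP hz ->]; clear -hz hx hxn; apply: (@inert_mkseq _ _ _ z.-1) => [||c hc].
    + by lia.
    + by case: ifP => ? //=; lia.
    + by lia.
  by rewrite bumps_cat hb (bumps_inert (hTi _ _ _)).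
have sE1 := steps_std ev sE0.
have rx'_le k : b.+2 <= k -> all (fun u : pt => u.1 <= k) rx'.
  by clear; move=> h; apply: all_mkseq => c hc; case: ifP => ? /=; lia.
have [|L2 sL2 pL2] := @steps_trim b.+2 _ sE1.
  apply: trim_hyp => //.
  - by move=> i j u hij hu _; exists u.
  - by move=> i u hi hu; rewrite ltnNge (allP (rx'_le _ (leqnn _)) _ hu).
  - exact: rl'_le.
  - by rewrite /= leqnn.
have trim1 : trim b.+2 (tab2 b.+4 rx' rl' tall_rs) = tab2 b.+3 rx' rl' tall_rs.
  rewrite /tab2 (@trim_tab _ _ _ _ _ b.+3) //.
  - by congr (tab2 _ _ _ _); apply/all_filterP/rx'_le.
  - by move=> y _; apply: trim_diag.
  - exact: rl'_le.
  - by rewrite /= leqnn.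
rewrite trim1 in sL2 pL2.
have crx : chain rx'.
  by clear -hx hxn; apply: chain_mkseq => c hc; rewrite /n1; case: ifP => ?; case: ifP => ?; rewrite /slt /=; lia.
have crl : chain rl'.
  by clear; apply: chain_mkseq => c hc; case: ifP => ?; case: ifP => ?; rewrite /slt /=; lia.
have crm z : z \in Z -> chain (tall_rm z).
  move=> /hZP hz; clear -hz hx hxn; apply: chain_mkseq => c hc; rewrite /n1.
  by case: ifP => ?; case: ifP => ?; rewrite /slt /=; lia.
have mem0 f k s : s < k -> f s = (s, s) -> (s, s) \in mkseq f k.
  by clear; move=> h e; apply/mapP; exists s; rewrite ?mem_iota.
(* The cells in rows of length 1, then [(b.+2, b)], also leave as they are; the
   rest is left initial. *)
have st3 : steps (tab2 b.+3 rx' rl' tall_rs) (nseq N (b.+2, 0)) (tab2 b.+3 rx' rl' [::]).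
  have E rs : tab2 b.+3 rx' rl' rs = tab2 b.+3 rx' rl' rs by [].
  pose A := map (fun=> diag_row b.+3) T ++ rx' :: map tall_rm Z ++ [:: rl'].
  have EA B : map (fun=> diag_row b.+3) T ++ rx' :: map tall_rm Z ++ rl' :: B = A ++ B.
    by rewrite /A -catA /= -catA.
  rewrite /tab2 !EA; have := @steps_singles b.+2 A N 0; rewrite cats0 addn0; apply => //.
    move=> d; rewrite mem_cat inE mem_cat inE => /or4P[hd|/eqP ->|/mapP[z hz ->]|/eqP ->].
    - exact: hTi hd.
    - exact: (@inert_mem _ _ (0, 0)) crx (mem0 _ _ _ _ _) _.
    - apply: (@inert_mem _ _ (0, 0)) (crm z hz) (mem0 _ _ _ _ _) _ => //; move/hZP: hz; clear.
        by lia.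
      by case: ifP => //; lia.
    - apply: (@inert_mem _ _ (if 0 < b then (0, 0) else (b.+2, b))) crl _ _.
        by apply/mapP; exists 0; rewrite ?mem_iota.
      by clear; case: ifP => //=; lia.
  apply/allP => d; rewrite mem_cat inE mem_cat inE => /or4P[/mapP[y _ ->]|/eqP ->|/mapP[z hz ->]|/eqP ->].
  - by clear; apply: all_mkseq => c hc /=; lia.
  - exact: rx'_le.
  - exact: tall_rm_le.
  - exact: rl'_le.
have sE3 := steps_std st3 (steps_std sL2 sE1).
have st4 : steps (tab2 b.+3 rx' rl' [::]) [:: (b.+2, b)] (tab2 b.+3 rx' (diag_row b) [::]).
  apply: (@steps_cons b.+2 _ (tab2 b.+3 rx' (diag_row b) [::])); last exact: steps_nil.
    by apply: tab2_le => //; [exact: rx'_le | exact: rl'_le].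
  rewrite !tab2E rl'E; apply: (@delete_cat _ _ _ _ _ (b.+2, b)).
  - by apply: lefts_notin; rewrite all_nseq orbT.
  - by apply: pluck_rcons => // u; rewrite mem_diag => /andP[_ h]; clear -h; lia.
  apply: bumps_inert => d; rewrite mem_cat mem_cat inE => /orP[/orP[hd|/eqP ->]|/mapP[z hz ->]].
  - by apply: hTi hd; rewrite ltnW // ltnW.
  - apply: (@inert_mem _ _ (b, b)) crx (mem0 _ _ _ _ _) _ => //; first by rewrite ltnW // ltnW.
    by rewrite ltnW.
  - apply: (@inert_mem _ _ (b, b)) (crm z hz) (mem0 _ _ _ _ _) _ => //; move/hZP: hz; clear.
      by lia.
    by case: ifP => //; lia.
have sE4 := steps_std st4 sE3.
have [|Lf rLf pLf] := run_linit sE4.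
  apply/allP => d; rewrite mem_cat inE mem_cat inE => /or4P[/mapP[y _ ->]|/eqP ->|/mapP[z _ ->]|].
  - exact: linit_mkseq.
  - by clear; apply: linit_mkseq => c hc; case: ifP.
  - by clear; apply: linit_mkseq => c hc; case: ifP.
  - by case/orP=> [/eqP ->|]; [exact: linit_mkseq | rewrite mem_nseq => /andP[_ /eqP ->]].
exists (L0 ++ [:: (b.+3, b.+2)] ++ L2 ++ nseq N (b.+2, 0) ++ [:: (b.+2, b)] ++ Lf).
  apply: steps_run sL0 _; apply: steps_run ev _; apply: steps_run sL2 _.
  by apply: steps_run st3 _; apply: steps_run st4 _.
have rxE a : count a (tall_rx b.+3) + a (b.+3, b.+2) = count a (tall_rx b.+2) + a (b.+2, b.+2).
  clear -hx; have := @count_mkseq_swap a (fun c => if c < b.+3 then (c, c) else (c.+1, c))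
    (fun c => if c < b.+2 then (c, c) else (c.+1, c)) x b.+2.
  rewrite ltnSn ltnn; apply; first by lia.
  by move=> c hc ne; do ![case: ifP => //]; lia.
have cN a : count a (flatten (nseq N [::])) = 0 by clear; elim: N.
have cN2 a : count a (flatten (nseq N tall_rs)) = N * a (b.+2, 0).
  by clear; elim: N => //= k ->; lia.
have tc k r1 r2 r3 a : count a (flatten (tab2 k r1 r2 r3)) =
   count a (flatten (map (fun=> diag_row k) T)) + (count a r1 + (count a (flatten (map tall_rm Z))
    + (count a r2 + count a (flatten (nseq N r3))))).
  by rewrite /tab2 !flatten_cat /= flatten_cat /= !count_cat.
have tc' r1 r2 r3 a : count a (flatten (tabl r1 tall_rm r2 r3)) =
   count a (flatten (map diag_row T)) + (count a r1 + (count a (flatten (map tall_rm Z))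
    + (count a r2 + count a (flatten (nseq N r3))))).
  by rewrite /tabl !flatten_cat /= flatten_cat /= !count_cat.
have cr (d : seq pt) u a : count a (rcons d u) = count a d + a u.
  by rewrite -cats1 count_cat [count a [:: _]]/= addn0.
have c1 e a : count a (tall_rl e) = count a (diag_row b) + a (b.+2, b) + a (e, n1).
  by rewrite tall_rlE rl'E !cr.
have c2 a : count a rl' = count a (diag_row b) + a (b.+2, b) by rewrite rl'E cr.
have c3 a : count a rx' = count a (diag_row b.+2) + a (b.+2, n1) by rewrite rx'E cr.
have c4 a : count a (diag_row b.+3) = count a (diag_row b.+2) + a (b.+2, b.+2).
  by rewrite -cr -mkseqS.
apply/permP => a; have := permP pL0 a; have := permP pL2 a; have := permP pLf a.
rewrite /tallD /tallM !count_cat !tc !tc' !count_nseq !cN !cN2 !c1 !c2 !c3 !c4.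
rewrite [count a [:: (b.+3, b.+2)]]/= [count a [:: (b.+2, b)]]/= !addn0; move: (rxE a).
move: (count a (diag_row b.+2)) (count a (diag_row b)) (count a (tall_rx _)) (count a (tall_rx _)).
by clear; lia.
Qed.

End Tall.
End Shape.

(** * Decompositions of a multiset of cells into chains *)

Section Greene.
Implicit Types (d g : seq pt) (E F M : seq (seq pt)) (s : seq nat).

Lemma msub_count (T : eqType) (s s' : seq T) :
  (forall u, count_mem u s <= count_mem u s') -> forall a, count a s <= count a s'.
Proof.
elim: s s' => [|x s IH] s' h a //=.
have hx : x \in s' by rewrite -has_pred1 has_count; apply: leq_trans (h x); rewrite /= eqxx.
have pe := perm_to_rem hx; rewrite (permP pe) /= leq_add2l; apply: IH => u.
by have := h u; rewrite (permP pe) /= leq_add2l.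
Qed.

Lemma count_gt_sorted s t c : sorted geq s ->
  count (fun z => c < z) (take t s) = minn t (count (fun z => c < z) s).
Proof.
elim: s t => [|z s IH] [|t] //= hs; rewrite ?min0n ?minn0 //.
rewrite (IH _ (path_sorted hs)); case: (ltnP c z) => hz /=; first by rewrite !add1n minnSS.
have -> : count (fun z => c < z) s = 0.
  apply/eqP; rewrite -leqn0 leqNgt -has_count; apply/hasPn => y hy.
  have /allP/(_ _ hy) : all (geq z) s := order_path_min geq_trans hs.
  by rewrite /= -leqNgt => h; apply: leq_trans h hz.
by rewrite !minn0.
Qed.

Lemma sum_count_gt s C : all (fun z => z <= C) s ->
  sumn s = \sum_(c < C) count (fun z => c < z) s.
Proof.
elim: s => [|z s IH] /=; first by rewrite big1.
case/andP=> hz /IH ->; rewrite big_split /=; congr addn.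
rewrite -(subnKC hz) big_split_ord /= -[LHS]addn0; congr addn.
  rewrite -[LHS]card_ord -sum1_card; apply: eq_bigr => i _ /=.
  by rewrite ltn_ord.
by rewrite big1 // => i _; rewrite /= ltnNge leq_addr.
Qed.

Lemma sum_count_cls (T : Type) (f : T -> nat) (l : seq T) C : all (fun u => f u < C) l ->
  size l = \sum_(c < C) count (fun u => f u == c) l.
Proof.
elim: l => [|u l IH] /=; first by rewrite big1.
case/andP=> hu /IH ->; rewrite big_split /=.
suff -> : \sum_(c < C) (f u == c) = 1 by rewrite add1n.
rewrite (bigD1 (Ordinal hu)) //= eqxx big1 // => i hi.
by case: eqP => // E; case/eqP: hi; apply: val_inj.
Qed.

Lemma sum_tight C (f g : nat -> nat) : (forall c, c < C -> f c <= g c) ->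
  \sum_(c < C) f c = \sum_(c < C) g c -> forall c, c < C -> f c = g c.
Proof.
elim: C => // C IH h; rewrite !big_ord_recr /= => E c.
have h' c' : c' < C -> f c' <= g c' by move=> hc; apply: h; apply: ltnW.
have hs : \sum_(c < C) f c <= \sum_(c < C) g c by apply: leq_sum => i _; apply: h'.
have hC := h C (ltnSn C).
have E2 : \sum_(c < C) f c = \sum_(c < C) g c by move: E hs hC; move: (\sum_(c < C) f c) (\sum_(c < C) g c) => A B; clear; lia.
rewrite ltnS leq_eqVlt => /orP[/eqP ->|]; first by move: E; rewrite E2 => /addnI.
exact: IH.
Qed.

(** [E] is a family of chains made of cells of [M]. The classes of [cls] are
    antichains covering [M], and each row of [M] meets the first ones once: as in
    Greene's theorem, this bounds the lengths of disjoint chains. *)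
Variables (cls : pt -> nat) (E M : seq (seq pt)).
Hypothesis cE : all chain E.
Hypothesis sM : sorted geq (map size M).
Hypothesis clsM : {in M, forall d, perm_eq (map cls d) (iota 0 (size d))}.
Hypothesis cls_inj : {in flatten M &, forall u v, slt u v -> cls u != cls v}.
Hypothesis hsub : forall u, count_mem u (flatten E) <= count_mem u (flatten M).

Let Ncls c := count (fun u => cls u == c) (flatten M).

Lemma mem_E u g : g \in E -> u \in g -> u \in flatten M.
Proof.
move=> hg hu; have : u \in flatten E by apply/flattenP; exists g.
rewrite -!has_pred1 !has_count => h; exact: leq_trans h (hsub u).
Qed.

Lemma chain_cmp g u v : chain g -> u \in g -> v \in g -> [\/ u = v, slt u v | slt v u].
Proof.
elim: g => //= x g IH hc; have hg : chain g by exact: path_sorted hc.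
have hx : {in g, forall y, slt x y} by apply/allP; exact: order_path_min slt_trans hc.
rewrite !inE => /predU1P[->|hu] /predU1P[->|hv]; first by constructor 1.
- by constructor 2; apply: hx.
- by constructor 3; apply: hx.
exact: IH.
Qed.

Lemma cls_count g c : g \in E -> count (fun u => cls u == c) g <= 1.
Proof.
move=> hg; have cg := allP cE _ hg; have := fun u => @mem_E u _ hg.
elim: g cg {hg} => //= x g IH hc hm; have hcg : chain g by exact: path_sorted hc.
have hx : {in g, forall y, slt x y} by apply/allP; exact: order_path_min slt_trans hc.
have {}IH : count (fun u => cls u == c) g <= 1.
  by apply: IH => // u hu; apply: hm; rewrite inE hu orbT.
case: eqP => hxc //=; rewrite add1n ltnS leqNgt -has_count; apply/hasPn => y hy.
rewrite -hxc eq_sym; apply: cls_inj (hx _ hy); first by rewrite hm ?mem_head.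
by rewrite hm // inE hy orbT.
Qed.

Lemma NclsE c : Ncls c = count (fun z => c < z) (map size M).
Proof.
rewrite /Ncls; elim: M clsM => //= d M' IH h.
rewrite count_cat IH => [|e he]; last by apply: h; rewrite inE he orbT.
congr addn; rewrite -[LHS](count_map cls (pred1 c)) (permP (h d (mem_head _ _))).
rewrite count_uniq_mem ?iota_uniq // mem_iota //.
Qed.

Let C := (\max_(z <- map size M) z).

Lemma size_C : all (fun z => z <= C) (map size M).
Proof. by apply/allP => z hz; apply: (@leq_bigmax_seq _ _ xpredT id). Qed.

Lemma cls_C u : u \in flatten M -> cls u < C.
Proof.
case/flattenP=> d hd hu; have : cls u \in iota 0 (size d).
  by rewrite -(perm_mem (clsM hd)) map_f.
by rewrite mem_iota add0n /= => h; apply: leq_trans h (allP size_C _ _); apply: map_f.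
Qed.

Lemma take_cls t c : count (fun u => cls u == c) (flatten (take t E)) <= minn t (Ncls c).
Proof.
rewrite leq_min; apply/andP; split.
  elim: E cE (fun g => @cls_count g c) t => [|g F IH] //= /andP[_ cF] h [|t] //=.
  rewrite count_cat -add1n leq_add ?h ?mem_head // IH // => e he.
  by apply: h; rewrite inE he orbT.
apply: leq_trans (msub_count hsub _).
by rewrite -{2}[E](cat_take_drop t) flatten_cat count_cat leq_addr.
Qed.

Lemma size_take_E t : size (flatten (take t E)) =
  \sum_(c < C) count (fun u => cls u == c) (flatten (take t E)).
Proof.
apply: sum_count_cls; apply/allP => u /flattenP[g hg hu]; apply: cls_C.
by apply: mem_E hu; apply: mem_take hg.
Qed.

Lemma sum_take_M t : sumn (take t (map size M)) = \sum_(c < C) minn t (Ncls c).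
Proof.
rewrite (@sum_count_gt _ C); last by apply/allP => z /mem_take; exact: (allP size_C).
by apply: eq_bigr => c _; rewrite count_gt_sorted // NclsE.
Qed.

Lemma sumn_size F : sumn (map size F) = size (flatten F).
Proof. by rewrite size_flatten. Qed.

(** A chain meets a class at most once, so [t] chains have at most
    [minn t (Ncls c)] cells of class [c], and the first [t] rows of [M] have exactly
    that many. *)
Lemma dominated t : sumn (take t (map size E)) <= sumn (take t (map size M)).
Proof.
rewrite -map_take sumn_size size_take_E sum_take_M.
by apply: leq_sum => c _; apply: take_cls.
Qed.

Hypothesis sizeEM : map size E = map size M.

(** Equal lengths turn the inequalities of [dominated] into equalities, class by
    class. *)
Lemma tight t c : count (fun u => cls u == c) (flatten (take t E)) = minn t (Ncls c).
Proof.
have [hc|hc] := ltnP c C.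
  apply: (@sum_tight C (fun c => count (fun u => cls u == c) (flatten (take t E)))
      (fun c => minn t (Ncls c))) => //.
    by move=> c' _; apply: take_cls.
  by rewrite -size_take_E -sum_take_M -sizeEM -map_take sumn_size.
have N0 : Ncls c = 0.
  apply/eqP; rewrite -leqn0 leqNgt -has_count; apply/hasPn => u /cls_C h.
  by rewrite neq_ltn (leq_trans h hc).
by have := take_cls t c; rewrite N0 minn0 leqn0 => /eqP.
Qed.

Lemma all_has_flatten (a : pred pt) (F : seq (seq pt)) : {in F, forall g, count a g <= 1} ->
  size F <= count a (flatten F) -> {in F, forall g, has a g}.
Proof.
elim: F => // g F IH h /=; rewrite count_cat => hs.
have hF : {in F, forall g, count a g <= 1} by move=> e he; apply: h; rewrite inE he orbT.
have hle : count a (flatten F) <= size F.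
  elim: F hF {IH h hs} => //= e F IHF hF; rewrite count_cat -add1n leq_add ?hF ?mem_head //.
  by apply: IHF => e' he'; apply: hF; rewrite inE he' orbT.
have h1 := h g (mem_head _ _).
move=> e; rewrite inE => /predU1P[->|he].
  by rewrite has_count; move: hs hle h1; clear; lia.
by apply: IH he; [exact: hF | move: hs hle h1; clear; lia].
Qed.

Lemma has_all_flatten (a : pred pt) (F : seq (seq pt)) : {in F, forall g, has a g} ->
  size F <= count a (flatten F).
Proof.
elim: F => //= g F IH h; rewrite count_cat -add1n leq_add //.
  by rewrite -has_count h ?mem_head.
by apply: IH => e he; apply: h; rewrite inE he orbT.
Qed.

Section NoDecomp.
Variables (b k h : nat) (q : pt) (up : pred pt).
Hypothesis kM : k <= size M.
Hypothesis hkk : h <= k.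
Hypothesis hk : forall i, i < k -> b.+2 <= nth 0 (map size M) i.
Hypothesis Nb : k <= Ncls b.
Hypothesis N1 : h <= Ncls b.+1.
Hypothesis N2 : h <= Ncls b.+2.
Hypothesis N3 : h <= Ncls b.+3.
Hypothesis N3' : forall c, b.+3 <= c -> Ncls c <= h.
Hypothesis nonq : count (fun u => (cls u == b) && (u != q)) (flatten M) < k.
Hypothesis upM : count (fun u => (cls u == b.+1) && up u) (flatten M) <= h.
Hypothesis clsq : cls q = b.
Hypothesis incq : {in flatten M, forall w, cls w = b.+2 -> ~~ slt w q /\ ~~ slt q w}.
Hypothesis predq : {in flatten M, forall w, slt w q -> cls w < b}.
Hypothesis succq : {in flatten M, forall w, slt q w ->
  (cls w = b.+1 /\ up w) \/ b.+3 <= cls w}.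
Hypothesis upcmp : {in flatten M &, forall v w, cls v = b.+1 -> cls w = b.+3 ->
  slt v w || slt w v -> up v}.

Lemma take_sub a t : count a (flatten (take t E)) + count a (flatten (drop t E)) <= count a (flatten M).
Proof. by rewrite -count_cat -flatten_cat cat_take_drop; apply: msub_count. Qed.

Lemma size_E : size E = size M.
Proof. by rewrite -(size_map size E) sizeEM size_map. Qed.

Lemma take_has c : h <= Ncls c -> {in take h E, forall g, has (fun u => cls u == c) g}.
Proof.
move=> hc; apply: all_has_flatten => [g /mem_take hg|]; first exact: cls_count.
by rewrite tight (minn_idPl hc) size_take geq_minl.
Qed.

(** Each of the first [k] chains has a cell of class [b], and [M] has too few such
    cells other than [q], so one of these chains, [g], contains [q]. It is not one of
    the first [h] chains, since each of those contains a cell of class [b.+2], which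
    is incomparable to [q]. As [g] has length at least [b.+2], it contains a cell
    after [q]: either a cell of class at least [b.+3], or an upper cell of class
    [b.+1]. But the first [h] chains use up the cells of both kinds; for the second
    kind, because their cell of class [b.+1] is comparable to one of class [b.+3],
    hence upper. *)
Lemma no_decomposition : False.
Proof.
have hE : h <= size E by rewrite size_E; apply: leq_trans kM.
have hq : q \in flatten (take k E).
  apply/negPn/negP => hq; have := tight k b; rewrite (minn_idPl Nb) => hc.
  have E1 : count (fun u => (cls u == b) && (u != q)) (flatten (take k E)) = k.
    rewrite -[RHS]hc; apply: eq_in_count => u hu.
    have hu' : u != q by apply: contraNneq hq => <-.
    by rewrite hu' andbT.
  have := take_sub (fun u => (cls u == b) && (u != q)) k; rewrite E1; move: nonq.
  by clear; lia.
case/flattenP: hq => g hg qg.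
have gE : g \in E by apply: mem_take hg.
have cg := allP cE _ gE.
have hmem u : u \in g -> u \in flatten M by apply: mem_E.
have [ght|gnt] := boolP (g \in take h E).
  have /hasP[w wg /eqP wc] := take_has N2 ght.
  have [i1 i2] := incq (hmem _ wg) wc.
  case: (chain_cmp cg qg wg) => [E1|E1|E1]; last by rewrite E1 in i1.
    by move: wc; rewrite -E1 clsq; clear; lia.
  by rewrite E1 in i2.
have gd : g \in drop h E.
  by move: gE; rewrite -{1}(cat_take_drop h E) mem_cat (negPf gnt).
have sg : b.+2 <= size g.
  have hi : index g (take k E) < size (take k E) by rewrite index_mem.
  have hi' : index g (take k E) < k by apply: leq_trans hi _; rewrite size_take geq_minl.
  have := hk hi'; rewrite -sizeEM (nth_map [::]); last by rewrite size_E; apply: leq_trans kM.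
  by rewrite -(nth_take _ hi') nth_index.
have /hasP[w wg qw] : has (slt q) g.
  apply/negPn/negP => /hasPn hn.
  have hall : all (fun u => cls u < b.+1) g.
    apply/allP => u ug; have := hn _ ug; case: (chain_cmp cg qg ug) => [<-|->|uq] // _.
      by rewrite clsq.
    by rewrite ltnS ltnW // predq // hmem.
  suff : size g <= b.+1 by rewrite leqNgt sg.
  rewrite (sum_count_cls hall) -[X in _ <= X]card_ord -sum1_card.
  by apply: leq_sum => c _; apply: cls_count.
have wd : w \in flatten (drop h E) by apply/flattenP; exists g.
have cnt (a : pred pt) : a w -> 0 < count a (flatten (drop h E)).
  by move=> aw; rewrite -has_count; apply/hasP; exists w.
case: (succq (hmem _ wg) qw) => [[wc uw]|wc].
  pose a u := (cls u == b.+1) && up u.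
  have hs : size (take h E) = h by rewrite size_takel.
  have : h <= count a (flatten (take h E)).
    rewrite -{1}hs; apply: has_all_flatten => g' hg'.
    have gE' : g' \in E by apply: mem_take hg'.
    have /hasP[v vg /eqP vc] := take_has N1 hg'.
    have /hasP[w' wg' /eqP wc'] := take_has N3 hg'.
    apply/hasP; exists v => //; rewrite /a vc eqxx /=.
    apply: (upcmp (mem_E gE' vg) (mem_E gE' wg') vc wc').
    case: (chain_cmp (allP cE _ gE') vg wg') => [E1|->|->]; rewrite ?orbT //.
    by move: vc; rewrite E1 wc'; clear; lia.
  have := cnt a; rewrite /a wc eqxx uw => /(_ isT).
  have := take_sub a h; move: upM; rewrite -/a.
  move: (count _ (flatten M)) (count _ (flatten (take h E))) (count _ (flatten (drop h E))).
  by clear; lia.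
pose a u := cls u == cls w.
have := take_sub a h; rewrite [count a (flatten (take h E))]tight (minn_idPr (N3' wc)).
have := cnt a (eqxx _); rewrite /a /Ncls.
move: (count _ (flatten M)) (count _ (flatten (drop h E))).
by clear; lia.
Qed.

End NoDecomp.

End Greene.

(** * The two tableaux have no decomposition of their own shape *)

Lemma count_flatten_le (a : pred pt) (F : seq (seq pt)) : {in F, forall g, count a g <= 1} ->
  count a (flatten F) <= size F.
Proof.
elim: F => //= g F IH h; rewrite count_cat -add1n leq_add ?h ?mem_head // IH // => e he.
by apply: h; rewrite inE he orbT.
Qed.

Lemma count_flatten_0 (a : pred pt) (F : seq (seq pt)) : {in F, forall g, count a g = 0} ->
  count a (flatten F) = 0.
Proof.
elim: F => //= g F IH h; rewrite count_cat h ?mem_head // IH // => e he.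
by apply: h; rewrite inE he orbT.
Qed.

Lemma count_mkseq0 (a : pred pt) f k : (forall c, c < k -> ~~ a (f c)) -> count a (mkseq f k) = 0.
Proof.
move=> h; apply/eqP; rewrite -leqn0 leqNgt -has_count; apply/hasPn => u /mapP[c].
by rewrite mem_iota => hc ->; apply: h.
Qed.

Section Inst.
Variables (m n b x : nat) (T Z : seq nat) (N : nat).
Hypothesis hx : b + 4 <= x.
Hypothesis hxm : x <= m.
Hypothesis hxn : x <= n.
Hypothesis sT : sorted geq T.
Hypothesis hT : all (fun y => (x <= y) && (y <= minn m n)) T.
Hypothesis sZ : sorted geq Z.
Hypothesis hZ : all (fun z => (z == b.+2) || (z == b.+3)) Z.

Let hTP := hTP hT.
Let hZP := hZP hZ.

Definition tau := T ++ x :: Z ++ b.+2 :: nseq N 1.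

(** The class of a cell is essentially its row index, or its column index for
    [tallM], up to this exchange: the cells with index [b.+1] are incomparable to the
    special cell [q] and have to form the class [b.+2]. *)
Definition sw c := if c == b.+1 then b.+2 else if c == b.+2 then b.+1 else c.

Lemma swK : involutive sw.
Proof.
clear; have ne : (b.+2 == b.+1) = false by rewrite gtn_eqF.
move=> c; rewrite /sw; have [->|h1] := eqVneq c b.+1; first by rewrite ne eqxx.
have [->|h2] := eqVneq c b.+2; first by rewrite eqxx.
by rewrite (negPf h1) (negPf h2).
Qed.

Lemma perm_sw z : b.+3 <= z -> perm_eq (map sw (iota 0 z)) (iota 0 z).
Proof.
move=> hz; apply: uniq_perm; rewrite ?(map_inj_uniq (inv_inj swK)) ?iota_uniq // => c.
have hsw d : d < z -> sw d < z by clear -hz; rewrite /sw; do ?[case: ifP => ?]; lia.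
rewrite mem_iota add0n /=; apply/mapP/idP => [[d]|hc].
  by rewrite mem_iota => /hsw h ->.
by exists (sw c); rewrite ?swK // mem_iota add0n /= hsw.
Qed.

Lemma row_sw (cls : pt -> nat) f z : b.+3 <= z -> (forall c, c < z -> cls (f c) = sw c) ->
  perm_eq (map cls (mkseq f z)) (iota 0 (size (mkseq f z))).
Proof.
move=> hz h; rewrite size_mkseq; apply: perm_trans (perm_sw hz).
rewrite -map_comp (_ : map _ _ = map sw (iota 0 z)) //.
by apply/eq_in_map => c; rewrite mem_iota => /h.
Qed.

Lemma row_id (cls : pt -> nat) f z : (forall c, c < z -> cls (f c) = c) ->
  perm_eq (map cls (mkseq f z)) (iota 0 (size (mkseq f z))).
Proof.
move=> h; rewrite size_mkseq -map_comp (_ : map _ _ = iota 0 z) //.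
by rewrite -[RHS]map_id; apply/eq_in_map => c; rewrite mem_iota => /h.
Qed.

Lemma tabl_allP (rx : seq pt) (rm : nat -> seq pt) rl rs (Q : seq pt -> Prop) :
  (forall y, y \in T -> Q (diag_row y)) -> Q rx -> (forall z, z \in Z -> Q (rm z)) -> Q rl -> Q rs ->
  forall d, d \in tabl T Z N rx rm rl rs -> Q d.
Proof.
move=> h1 h2 h3 h4 h5 d; rewrite mem_cat inE mem_cat inE mem_nseq.
case/orP=> [/mapP[y hy ->]|/orP[/eqP -> //|/orP[/mapP[z hz ->]|/orP[/eqP -> //|/andP[_ /eqP -> //]]]]].
  exact: h1.
exact: h3.
Qed.

Lemma count_tabl (a : pred pt) rx rm rl rs : count a (flatten (tabl T Z N rx rm rl rs)) =
  count a (flatten (map diag_row T)) + (count a rx + (count a (flatten (map rm Z)) +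
   (count a rl + count a (flatten (nseq N rs))))).
Proof. by rewrite /tabl !flatten_cat /= flatten_cat /= !count_cat. Qed.

Lemma cls_row_le1 (cls : pt -> nat) d c (a : pred pt) : perm_eq (map cls d) (iota 0 (size d)) ->
  count (fun u => (cls u == c) && a u) d <= 1.
Proof.
move=> pe; apply: (@leq_trans (count (fun u => cls u == c) d)).
  by apply: sub_count => u /andP[].
rewrite -[X in X <= _](count_map cls (pred1 c)) (permP pe) count_uniq_mem ?iota_uniq //.
by case: (_ \in _).
Qed.

Section Common.
Variables (cls : pt -> nat) (q : pt) (up ok : pred pt).
Variables (rx : seq pt) (rm : nat -> seq pt) (rl rs : seq pt).
Let M := tabl T Z N rx rm rl rs.
Hypothesis szM : map size M = tau.
Hypothesis clsM : forall d, d \in M -> perm_eq (map cls d) (iota 0 (size d)).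
Hypothesis okM : forall d, d \in M -> all ok d.
Hypothesis cls_inj : forall u v, ok u -> ok v -> slt u v -> cls u != cls v.
Hypothesis clsq : cls q = b.
Hypothesis incq : forall w, ok w -> cls w = b.+2 -> ~~ slt w q /\ ~~ slt q w.
Hypothesis predq : forall w, ok w -> slt w q -> cls w < b.
Hypothesis succq : forall w, ok w -> slt q w -> (cls w = b.+1 /\ up w) \/ b.+3 <= cls w.
Hypothesis upcmp : forall v w, ok v -> ok w -> cls v = b.+1 -> cls w = b.+3 ->
  slt v w || slt w v -> up v.
Hypothesis rl_q : count (fun u => (cls u == b) && (u != q)) rl = 0.
Hypothesis rs_q : count (fun u => (cls u == b) && (u != q)) rs = 0.
Hypothesis rm_up : {in Z, forall z, count (fun u => (cls u == b.+1) && up u) (rm z) = 0}.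
Hypothesis rl_up : count (fun u => (cls u == b.+1) && up u) rl = 0.
Hypothesis rs_up : count (fun u => (cls u == b.+1) && up u) rs = 0.

Lemma sorted_tau : sorted geq tau.
Proof.
have Zge : {in Z, forall z, b.+2 <= z <= b.+3} by move=> z /hZP; clear; lia.
apply: sorted_join => //; first by move=> y /hTP [].
rewrite -[path _ _ _]/(sorted geq ((x :: Z) ++ b.+2 :: nseq N 1)); apply: sorted_join.
- case: (Z) sZ Zge => //= z Z' -> h; rewrite andbT.
  by have := h z (mem_head _ _); move: hx; clear; rewrite /geq /=; lia.
- move=> z; rewrite inE => /predU1P[->|/Zge]; last by rewrite /geq /=; case/andP.
  by move: hx; clear; rewrite /geq /=; lia.
- by clear; case: N => //= k; elim: k => //= k ->.
Qed.

Lemma ok_flat u : u \in flatten M -> ok u.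
Proof. by case/flattenP => d /okM/allP h /h. Qed.

Lemma count_tau (a : pred nat) : count a tau =
  count a T + (a x + (count a Z + (a b.+2 + N * a 1))).
Proof. by rewrite /tau count_cat /= count_cat /= count_nseq mulnC. Qed.

(** [dominated] and [no_decomposition] for the shape [tau], where [k] counts the
    parts above 1 and [h] those above [b.+3]. *)
Lemma common_down (E : seq (seq pt)) : all chain E ->
  (forall u, count_mem u (flatten E) <= count_mem u (flatten M)) ->
  (forall t, sumn (take t (map size E)) <= sumn (take t tau)) /\ map size E <> tau.
Proof.
move=> cE hs.
have sM : sorted geq (map size M) by rewrite szM; apply: sorted_tau.
have cM : {in M, forall d, perm_eq (map cls d) (iota 0 (size d))} by [].
have ci : {in flatten M &, forall u v, slt u v -> cls u != cls v}.
  by move=> u v /ok_flat hu /ok_flat hv; apply: cls_inj.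
split=> [t|sE]; first by rewrite -szM; apply: dominated cE sM cM ci hs t.
have sEM : map size E = map size M by rewrite sE szM.
have NE c : count (fun u => cls u == c) (flatten M) = count (fun z => c < z) tau.
  by rewrite -szM; apply: (NclsE cM).
have Zge z : z \in Z -> b.+2 <= z <= b.+3 by move=> /hZP; clear; lia.
have cT c : c < x -> count (fun z => c < z) T = size T.
  move=> hc; apply/eqP; rewrite -all_count; apply/allP => y /hTP [h _].
  exact: leq_trans hc h.
have cx c : c < x -> (c < x) = true by [].
have hT4 c : c < b.+4 -> (size T).+1 <= count (fun z => c < z) tau.
  move=> hc; have hcx : c < x by move: hc hx; clear; lia.
  by rewrite count_tau cT // hcx addnA addn1 leq_addr.
have szt : size tau = (size T + size Z).+2 + N.
  by rewrite /tau size_cat /= size_cat /= size_nseq; clear; lia.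
apply: (no_decomposition cE sM cM ci hs sEM (b := b) (k := (size T + size Z).+2) (h := (size T).+1) (q := q) (up := up)).
- by rewrite -(size_map size M) szM szt leq_addr.
- by rewrite ltnS leqW // leq_addr.
- move=> i hi; rewrite szM.
  have -> : tau = (T ++ x :: Z ++ [:: b.+2]) ++ nseq N 1 by rewrite /tau -catA /= -catA.
  have sz : size (T ++ x :: Z ++ [:: b.+2]) = (size T + size Z).+2.
    by rewrite size_cat /= size_cat /=; clear; lia.
  rewrite nth_cat sz hi.
  have /(all_nthP 0) : all (fun z => b.+2 <= z) (T ++ x :: Z ++ [:: b.+2]).
    rewrite all_cat /= all_cat /= leqnn !andbT; apply/and3P; split.
    + by apply/allP => y /hTP [h _]; move: h hx; clear; lia.
    + by move: hx; clear; lia.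
    + by apply/allP => z /Zge/andP[].
  by apply; rewrite sz.
- rewrite NE count_tau cT; last by move: hx; clear; lia.
  have -> : count (fun z => b < z) Z = size Z.
    by apply/eqP; rewrite -all_count; apply/allP => z /Zge/andP[h _]; exact: ltnW.
  have -> : b < x by move: hx; clear; lia.
  have -> : b < b.+2 by rewrite ltnS leqnSn.
  by clear; lia.
- by rewrite NE; apply: hT4; clear; lia.
- by rewrite NE; apply: hT4; clear; lia.
- by rewrite NE; apply: hT4; clear; lia.
- move=> c hc; rewrite NE count_tau.
  have -> : count (fun z => c < z) Z = 0.
    apply/eqP; rewrite -leqn0 leqNgt -has_count; apply/hasPn => z /Zge /andP[_ h].
    by rewrite -leqNgt; apply: leq_trans h hc.
  have -> : (c < b.+2) = false by move: hc; clear; lia.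
  have -> : (c < 1) = false by move: hc; clear; lia.
  have := count_size (fun z => c < z) T; case: (c < x); clear; lia.
- rewrite /M count_tabl rl_q.
  have -> : count (fun u => (cls u == b) && (u != q)) (flatten (nseq N rs)) = 0.
    by apply: count_flatten_0 => g; rewrite mem_nseq => /andP[_ /eqP ->].
  have mT : {in map diag_row T, forall g, count (fun u => (cls u == b) && (u != q)) g <= 1}.
    by move=> g hg; apply: cls_row_le1; apply: clsM; rewrite mem_cat hg.
  have mZ : {in map rm Z, forall g, count (fun u => (cls u == b) && (u != q)) g <= 1}.
    by move=> g hg; apply: cls_row_le1; apply: clsM; rewrite mem_cat inE mem_cat hg !orbT.
  have mx : count (fun u => (cls u == b) && (u != q)) rx <= 1.
    by apply: cls_row_le1; apply: clsM; rewrite mem_cat mem_head orbT.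
  have := count_flatten_le mT; have := count_flatten_le mZ; rewrite !size_map; move: mx.
  by clear; lia.
- rewrite /M count_tabl rl_up.
  have -> : count (fun u => (cls u == b.+1) && up u) (flatten (nseq N rs)) = 0.
    by apply: count_flatten_0 => g; rewrite mem_nseq => /andP[_ /eqP ->].
  have -> : count (fun u => (cls u == b.+1) && up u) (flatten (map rm Z)) = 0.
    by apply: count_flatten_0 => g /mapP[z hz ->]; apply: rm_up.
  have mT : {in map diag_row T, forall g, count (fun u => (cls u == b.+1) && up u) g <= 1}.
    by move=> g hg; apply: cls_row_le1; apply: clsM; rewrite mem_cat hg.
  have mx : count (fun u => (cls u == b.+1) && up u) rx <= 1.
    by apply: cls_row_le1; apply: clsM; rewrite mem_cat mem_head orbT.
  have := count_flatten_le mT; rewrite !size_map; move: mx.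
  by clear; lia.
- by [].
- by move=> w /ok_flat; apply: incq.
- by move=> w /ok_flat; apply: predq.
- by move=> w /ok_flat; apply: succq.
- by move=> v w /ok_flat hv /ok_flat hw; apply: upcmp.
Qed.

End Common.

Let m1 := m.-1.
(** The exception is the cell [(m.-1, b.+2)], which ends rows of lengths [b.+2] and
    [b.+3] and provides the class missing in them. *)
Definition wide_class (u : pt) := if (u.2 == b.+2) && (b.+3 <= u.1) then b.+1 else sw u.1.
(** Covers the cells of [wideM] by a condition that is decidable by arithmetic. *)
Definition wide_cell (u : pt) := [|| u.1 == u.2, (u.2 == u.1.+1) && (b.+2 <= u.1),
  (u.1 == m1) && (u.2 == b.+2), (u.1 == b) && (u.2 == b.+2) | (u.1 == 0) && (u.2 == b.+2)].

Lemma wide_down (E : seq (seq pt)) : all chain E ->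
  (forall u, count_mem u (flatten E) <= count_mem u (flatten (wideM m b x T Z N))) ->
  (forall t, sumn (take t (map size E)) <= sumn (take t tau)) /\ map size E <> tau.
Proof.
have hm : b.+3 <= m1 by rewrite /m1; move: hx hxm; clear; lia.
apply: (common_down (cls := wide_class) (q := (b, b.+2)) (up := fun u => u.1 == b.+2) (ok := wide_cell)).
- exact: tabl_sizes.
- apply: tabl_allP.
  + move=> y /hTP [h _]; apply: row_sw => [|c hc]; first by move: h hx; clear; lia.
    by rewrite /wide_class /sw /=; clear; do ?[case: ifP => ?]; lia.
  + apply: row_sw => [|c hc]; first by move: hx; clear; lia.
    by clear; case: ifP => ?; rewrite /wide_class /sw /=; do ?[case: ifP => ?]; lia.
  + move=> z /hZP hz; case: hz => ->.
      apply: row_id => c hc; rewrite /wide_class /sw; move: hm hc; rewrite -/m1; move: m1; clear => m1.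
      by have [?|?] := eqVneq c.+1 b.+2 => /=; do ?[case: ifP => ?]; lia.
    apply: row_sw => // c hc; rewrite /wide_class /sw; move: hm hc; rewrite -/m1; move: m1; clear => m1.
    by have [?|?] := eqVneq c.+1 b.+3 => /=; do ?[case: ifP => ?]; lia.
  + apply: row_id => c hc; rewrite /wide_class /sw; move: hm hc; rewrite -/m1; move: m1; clear => m1.
    by have [?|?] := ltnP c b => /=; last have [?|?] := eqVneq c b => /=; do ?[case: ifP => ?]; lia.
  + apply: (@row_id wide_class (fun=> (0, b.+2)) 1) => c; rewrite /wide_class /sw /=; clear.
    by do ?[case: ifP => ?]; lia.
- apply: tabl_allP.
  + by move=> y _; apply: all_mkseq => c hc; rewrite /wide_cell eqxx.
  + by apply: all_mkseq => c hc; rewrite /wide_cell; clear; have [?|?] := ltnP c b.+2 => /=; lia.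
  + move=> z _; apply: all_mkseq => c hc; rewrite /wide_cell -/m1; case: ifP => _ /=; rewrite ?eqxx ?orbT //.
  + apply: all_mkseq => c hc; rewrite /wide_cell -/m1; do ![case: ifP => _ /=]; rewrite ?eqxx ?orbT //.
  + by rewrite /= /wide_cell /= !eqxx !orbT.
- move=> [u1 u2] [v1 v2]; rewrite /wide_cell /wide_class /sw /slt /=; move: hm; move: m1; clear => m1.
  by do ?[case: ifP => ?]; lia.
- by rewrite /wide_class /sw /=; clear; do ?[case: ifP => ?]; lia.
- move=> [w1 w2]; rewrite /wide_cell /wide_class /sw /slt /=; move: hm; move: m1; clear => m1.
  by do ?[case: ifP => ?]; lia.
- move=> [w1 w2]; rewrite /wide_cell /wide_class /sw /slt /=; move: hm; move: m1; clear => m1.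
  by do ?[case: ifP => ?]; lia.
- move=> [w1 w2]; rewrite /wide_cell /wide_class /sw /slt /=; move: hm; move: m1; clear => m1.
  by do ?[case: ifP => ?]; lia.
- move=> [v1 v2] [w1 w2]; rewrite /wide_cell /wide_class /sw /slt /=; move: hm; move: m1; clear => m1.
  by do ?[case: ifP => ?]; lia.
- apply: count_mkseq0 => c hc; rewrite /wide_class /sw -/m1; move: hm hc; move: m1; clear => m1.
  by (have [?|?] := ltnP c b; [|have [?|?] := eqVneq c b]); rewrite ?xpair_eqE /= ?xpair_eqE;
    do ?[case: ifP => ?]; lia.
- rewrite /= /wide_class /sw ?xpair_eqE /=; clear.
  by do ?[case: ifP => ?]; lia.
- move=> z /hZP hz; apply: count_mkseq0 => c hc; rewrite -/m1; move: hm hc hz; move: m1; clear => m1.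
  by have [?|?] := eqVneq c.+1 z => /=; lia.
- apply: count_mkseq0 => c hc; rewrite -/m1; move: hm hc; move: m1; clear => m1.
  by have [?|?] := ltnP c b => /=; last have [?|?] := eqVneq c b => /=; lia.
- by rewrite /= andbF.
Qed.

Let n1 := n.-1.
Definition tall_class (u : pt) := if (u.2 == n1) && (u.1 <= b.+2) then b.+1 else sw u.2.
Definition tall_cell (u : pt) := [|| u.1 == u.2, (u.1 == u.2.+1) && (b.+2 <= u.2),
  (u.2 == n1) && (u.1 <= b.+2), (u.1 == b.+2) && (u.2 == b) | (u.1 == b.+2) && (u.2 == 0)].

Lemma tall_down (E : seq (seq pt)) : all chain E ->
  (forall u, count_mem u (flatten E) <= count_mem u (flatten (tallM n b x T Z N))) ->
  (forall t, sumn (take t (map size E)) <= sumn (take t tau)) /\ map size E <> tau.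
Proof.
have hm : b.+3 <= n1 by rewrite /n1; move: hx hxn; clear; lia.
apply: (common_down (cls := tall_class) (q := (b.+2, b)) (up := fun u => u.2 == b.+2) (ok := tall_cell)).
- exact: tabl_sizes.
- apply: tabl_allP.
  + move=> y /hTP [h _]; apply: row_sw => [|c hc]; first by move: h hx; clear; lia.
    by rewrite /tall_class /sw /=; move: hm; move: n1; clear => n1; do ?[case: ifP => ?]; lia.
  + apply: row_sw => [|c hc]; first by move: hx; clear; lia.
    by rewrite /tall_class; move: hm; move: n1; clear => n1; have [?|?] := ltnP c b.+2; rewrite /sw /=; do ?[case: ifP => ?]; lia.
  + move=> z /hZP hz; case: hz => ->.
      apply: row_id => c hc; rewrite /tall_class /sw; move: hm hc; rewrite -/n1; move: n1; clear => n1.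
      by have [?|?] := eqVneq c.+1 b.+2 => /=; do ?[case: ifP => ?]; lia.
    apply: row_sw => // c hc; rewrite /tall_class /sw; move: hm hc; rewrite -/n1; move: n1; clear => n1.
    by have [?|?] := eqVneq c.+1 b.+3 => /=; do ?[case: ifP => ?]; lia.
  + apply: row_id => c hc; rewrite /tall_class /sw; move: hm hc; rewrite -/n1; move: n1; clear => n1.
    by have [?|?] := ltnP c b => /=; last have [?|?] := eqVneq c b => /=; do ?[case: ifP => ?]; lia.
  + apply: (@row_id tall_class (fun=> (b.+2, 0)) 1) => c; rewrite /tall_class /sw /=; move: hm; move: n1; clear => n1.
    by do ?[case: ifP => ?]; lia.
- apply: tabl_allP.
  + by move=> y _; apply: all_mkseq => c hc; rewrite /tall_cell eqxx.
  + by apply: all_mkseq => c hc; rewrite /tall_cell; clear; have [?|?] := ltnP c b.+2 => /=; lia.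
  + move=> z /hZP hz; apply: all_mkseq => c hc; rewrite /tall_cell -/n1; move: hz hc; move: n1; clear => n1.
    by have [?|?] := eqVneq c.+1 z => /=; lia.
  + apply: all_mkseq => c hc; rewrite /tall_cell -/n1; move: hc; move: n1; clear => n1.
    by have [?|?] := ltnP c b => /=; last have [?|?] := eqVneq c b => /=; lia.
  + by rewrite /= /tall_cell /= !eqxx !orbT.
- move=> [u1 u2] [v1 v2]; rewrite /tall_cell /tall_class /sw /slt /=; move: hm; move: n1; clear => n1.
  by do ?[case: ifP => ?]; lia.
- by rewrite /tall_class /sw /=; move: hm; move: n1; clear => n1; do ?[case: ifP => ?]; lia.
- move=> [w1 w2]; rewrite /tall_cell /tall_class /sw /slt /=; move: hm; move: n1; clear => n1.
  by do ?[case: ifP => ?]; lia.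
- move=> [w1 w2]; rewrite /tall_cell /tall_class /sw /slt /=; move: hm; move: n1; clear => n1.
  by do ?[case: ifP => ?]; lia.
- move=> [w1 w2]; rewrite /tall_cell /tall_class /sw /slt /=; move: hm; move: n1; clear => n1.
  by do ?[case: ifP => ?]; lia.
- move=> [v1 v2] [w1 w2]; rewrite /tall_cell /tall_class /sw /slt /=; move: hm; move: n1; clear => n1.
  by do ?[case: ifP => ?]; lia.
- apply: count_mkseq0 => c hc; rewrite /tall_class /sw -/n1; move: hm hc; move: n1; clear => n1.
  by (have [?|?] := ltnP c b; [|have [?|?] := eqVneq c b]); rewrite ?xpair_eqE /= ?xpair_eqE;
    do ?[case: ifP => ?]; lia.
- rewrite /= /tall_class /sw ?xpair_eqE /=; move: hm; move: n1; clear => n1.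
  by do ?[case: ifP => ?]; lia.
- move=> z /hZP hz; apply: count_mkseq0 => c hc; rewrite -/n1 negb_and; apply/orP; right.
  move: hm hc hz; move: n1; clear => n1.
  by have [?|?] := eqVneq c.+1 z => /=; lia.
- apply: count_mkseq0 => c hc; rewrite -/n1 negb_and; apply/orP; right.
  move: hm hc; move: n1; clear => n1.
  by have [?|?] := ltnP c b => /=; last have [?|?] := eqVneq c b => /=; lia.
- by rewrite /= andbF.
Qed.

End Inst.

(** * Partitions: dominance, balanced parts and Dickson's lemma *)

Lemma mem_tail (A : eqType) (x y : A) s : y \in s -> y \in x :: s.
Proof. by rewrite inE orbC => ->. Qed.

Section SeqFacts.
Implicit Types s r : seq nat.

Lemma sorted_split s c : sorted geq s -> s = [seq z <- s | c <= z] ++ [seq z <- s | z < c].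
Proof.
elim: s => //= z s IH hs; rewrite leqNgt; case: ltnP => hz /=; last by rewrite -IH // (path_sorted hs).
have h0 y : y \in s -> y < c.
  move=> hy; have /allP/(_ _ hy) : all (geq z) s := order_path_min geq_trans hs.
  by move=> h; apply: leq_ltn_trans h hz.
have -> : [seq y <- s | c <= y] = [::].
  by apply/eqP; rewrite -(negbK (_ == _)) -has_filter; apply/hasPn => y /h0; rewrite -ltnNge.
by rewrite /=; congr cons; apply/esym/all_filterP/allP.
Qed.

Lemma sorted_last_le s x : sorted geq (rcons s x) -> {in rcons s x, forall y, x <= y}.
Proof.
elim: s => [|z s IH] /=; first by move=> _ y; rewrite inE => /eqP ->.
move=> hs y; rewrite inE => /predU1P[->|]; last by apply: IH; apply: path_sorted hs.
by have /allP := order_path_min geq_trans hs; apply; rewrite mem_rcons mem_head.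
Qed.

Definition pos_le p s := all (fun z => (0 < z) && (z <= p)) s.

(** [b.+2] is the smallest part above 1, and [x] the smallest part exceeding it by
    at least 2. *)
Lemma shape_split s p a x0 : sorted geq s -> pos_le p s -> a \in s -> x0 \in s -> 2 <= a -> a + 2 <= x0 ->
  exists b x T Z N, [/\ s = tau b x T Z N, b + 4 <= x /\ x <= x0, 
    sorted geq T /\ all (fun y => x <= y <= p) T,
    sorted geq Z & all (fun z => (z == b.+2) || (z == b.+3)) Z].
Proof.
move=> ss hp ha0 hx0 a2 ax.
pose B0 := [seq z <- s | 2 <= z].
have [a' [ha' min_a]] : exists a', a' \in B0 /\ {in B0, forall z, a' <= z}.
  have : B0 != [::] by apply/eqP => E; have : a \in B0 by [rewrite mem_filter a2]; rewrite E.
  have : sorted geq B0 by apply: sorted_filter ss; apply: geq_trans.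
  case/lastP: (B0) => // B z hB _; exists z; split; first by rewrite mem_rcons mem_head.
  exact: sorted_last_le.
have a'2 : 2 <= a' by move: ha'; rewrite mem_filter => /andP[].
have a'a : a' <= a by apply: min_a; rewrite mem_filter a2.
pose A := [seq z <- s | a' + 2 <= z].
pose R := [seq z <- s | z < a' + 2].
have sA : sorted geq A by apply: sorted_filter ss; apply: geq_trans.
have sR : sorted geq R by apply: sorted_filter ss; apply: geq_trans.
have eR := sorted_split 2 sR.
pose B := [seq z <- R | 2 <= z].
have sB : sorted geq B by apply: sorted_filter sR; apply: geq_trans.
have hBmem z : z \in B -> a' <= z < a' + 2.
  by rewrite mem_filter mem_filter => /and3P[z2 za zs]; rewrite za andbT; apply: min_a; rewrite mem_filter z2.
have haB : a' \in B.
  by move: ha'; rewrite !mem_filter => /andP[-> ->]; rewrite andbT /= -addn1 leq_add2l.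
have hx0A : x0 \in A by rewrite mem_filter hx0 andbT; move: a'a ax; clear; lia.
have eC : [seq z <- R | z < 2] = nseq (size [seq z <- R | z < 2]) 1.
  apply/all_pred1P/allP => z; rewrite !mem_filter => /and3P[z2 _ /(allP hp)/andP[z0 _]].
  by move: z2 z0 => /=; clear; lia.
have eA : exists T x, A = rcons T x by case/lastP: (A) hx0A => // T x _; exists T, x.
have [T [x EA]] := eA.
have eB : exists Z, B = rcons Z a'.
  case/lastP E : (B) haB => [//|Z z] haB; exists Z; congr rcons.
  rewrite E in sB; have h1 := sorted_last_le sB haB.
  have /hBmem/andP[h2 _] : z \in B by rewrite E mem_rcons mem_head.
  by apply/eqP; rewrite eqn_leq h1.
have [Z EB] := eB.
exists (a' - 2), x, T, Z, (size [seq z <- R | z < 2]).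
have ea : (a' - 2).+2 = a' by move: a'2; clear; lia.
have hxA : x \in A by rewrite EA mem_rcons mem_head.
split.
- rewrite /tau ea [LHS](sorted_split (a' + 2) ss) -/A -/R [in LHS]eR -/B [in LHS]eC EA EB.
  by rewrite !cat_rcons.
- split; first by move: hxA; rewrite mem_filter => /andP[h _]; move: h a'2; clear; lia.
  by rewrite EA in sA hx0A; apply: sorted_last_le sA _ hx0A.
- split; first by move: sA; rewrite EA; apply: (@subseq_sorted _ _ geq_trans); apply: subseq_rcons.
  apply/allP => y hy; rewrite EA in sA; apply/andP; split.
    by apply: sorted_last_le sA _ _; rewrite mem_rcons inE hy orbT.
  have : y \in A by rewrite EA mem_rcons inE hy orbT.
  by rewrite mem_filter => /andP[_ /(allP hp)/andP[]].
- by move: sB; rewrite EB; apply: (@subseq_sorted _ _ geq_trans); apply: subseq_rcons.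
- apply/allP => z hz; have /hBmem : z \in B by rewrite EB mem_rcons inE hz orbT.
  by move: a'2; clear; lia.
Qed.

Definition dom s r := forall t, sumn (take t s) <= sumn (take t r).

Lemma take_sumn_eq K s r : all (fun z => 0 < z) s -> all (fun z => 0 < z) r ->
  size s <= K -> size r <= K ->
  (forall t, t <= K -> sumn (take t s) = sumn (take t r)) -> s = r.
Proof.
elim: K s r => [|K IH] [|x s] [|y r] //=.
- by move=> _ /andP[y0 _] _ _ /(_ 1 isT) /=; rewrite take0 addn0; move: y0; clear; case: y.
- by move=> /andP[y0 _] _ _ _ /(_ 1 isT) /=; rewrite take0 addn0; move: y0; clear; case: x.
move=> /andP[x0 hs] /andP[y0 hr] ss sr h.
have xy : x = y by have := h 1 isT; rewrite /= !take0 !addn0.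
subst y; congr cons; apply: IH => // t ht.
by have := h t.+1 ht; rewrite /= => /addnI.
Qed.

Lemma size_le_sumn s : all (fun z => 0 < z) s -> size s <= sumn s.
Proof. by elim: s => //= x s IH /andP[x0 /IH h]; move: x0 h; clear; lia. Qed.

(** Increases strictly with the dominance order on partitions of size at most
    [B]. *)
Definition mu B s := \sum_(t < B.+1) sumn (take t s).

Lemma mu_lt B s r : all (fun z => 0 < z) s -> all (fun z => 0 < z) r ->
  sumn r <= B -> dom s r -> s <> r -> mu B s < mu B r.
Proof.
move=> ps pr hB hd ne; rewrite ltn_neqAle; apply/andP; split; last by apply: leq_sum => t _.
apply/negP => /eqP E; apply: ne.
have sr : sumn s <= sumn r.
  have := hd (maxn (size s) (size r)); rewrite !take_oversize ?leq_maxl ?leq_maxr //.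
apply: (@take_sumn_eq B) => //.
- by apply: leq_trans (size_le_sumn ps) _; apply: leq_trans sr hB.
- exact: leq_trans (size_le_sumn pr) hB.
move=> t ht; apply: (@sum_tight B.+1 (fun t => sumn (take t s)) (fun t => sumn (take t r))) => //.
Qed.

Definition balanced s := {in s &, forall x y, x <= y.+1}.

(** The parts are the quotient of the sum by the length and its successor, the
    latter as many times as the remainder says. *)
Lemma balanced_perm s r : balanced s -> balanced r -> size s = size r -> sumn s = sumn r -> perm_eq s r.
Proof.
have key (s0 : seq nat) : balanced s0 -> 0 < size s0 -> exists q c, [/\ c < size s0,
    sumn s0 = size s0 * q + c & perm_eq s0 (nseq c q.+1 ++ nseq (size s0 - c) q)].
  move=> bs s0p; have [q hq hmin] : exists2 q, q \in s0 & {in s0, forall z, q <= z}.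
    elim: s0 {bs} s0p => // x [|y s0] IH _; first by exists x; rewrite ?mem_head // => z; rewrite inE => /eqP ->.
    have [//|q hq h] := IH; exists (minn x q).
      by rewrite /minn; case: ifP => _; rewrite inE ?hq ?eqxx ?orbT.
    by move=> z; rewrite inE => /predU1P[->|/h h']; rewrite ?geq_minl // (leq_trans (geq_minr _ _)).
  have h2 : all (fun z => (z == q) || (z == q.+1)) s0.
    by apply/allP => z hz; have := hmin _ hz; have := bs _ _ hz hq; clear; lia.
  have aux (t : seq nat) : all (fun z => (z == q) || (z == q.+1)) t -> 
      [/\ sumn t = size t * q + count_mem q.+1 t, count_mem q t + count_mem q.+1 t = size t
      & perm_eq t (nseq (count_mem q.+1 t) q.+1 ++ nseq (count_mem q t) q)].
    elim: t => [//|z t IH] /= /andP[hz /IH [e1 e2 e3]].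
    have qq : (q == q.+1) = false by clear; lia.
    have qq' : (q.+1 == q) = false by clear; lia.
    case/orP: hz => /eqP ->; rewrite eqxx ?qq ?qq' /= !add0n ?add1n; split.
    - by rewrite e1 mulSn addnA.
    - by rewrite -e2 addSn.
    - by apply/permP => a; have := permP e3 a; rewrite /= !count_cat /=; clear; lia.
    - by rewrite e1 mulSn addnS addSn addnA.
    - by rewrite -e2 addnS.
    - by rewrite perm_cons.
  have [e1 e2 e3] := aux _ h2; exists q, (count_mem q.+1 s0); split=> //.
    by rewrite -e2 -add1n leq_add2r -has_count has_pred1.
  by rewrite -[X in X - _]e2 addnK.
move=> bs br hsz hsum; case: (posnP (size s)) => [s0|sp].
  by rewrite (size0nil s0) (size0nil (etrans (esym hsz) s0)).
have [q [c [c1 c2 c3]]] := key _ bs sp; rewrite hsz in sp.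
have [q' [c' [c1' c2' c3']]] := key _ br sp.
have [eq ec] : q = q' /\ c = c'.
  move: hsum; rewrite c2 c2' hsz => hsum; rewrite hsz in c1.
  have e1 : (size r * q + c) %/ size r = q by rewrite mulnC divnMDl // divn_small // addn0.
  have e2 : (size r * q' + c') %/ size r = q' by rewrite mulnC divnMDl // divn_small // addn0.
  have eq : q = q' by rewrite -e1 -e2 hsum.
  by split=> //; move: hsum; rewrite eq => /addnI.
by rewrite (perm_trans c3) // perm_sym (perm_trans c3') // eq ec hsz.
Qed.

Lemma perm_map_inv (A : eqType) (f : A -> nat) (D : seq A) t : perm_eq (map f D) t ->
  exists2 D', perm_eq D D' & map f D' = t.
Proof.
elim: t D => [|x t IH] D h.
  by exists [::] => //; move: (perm_size h); rewrite size_map => /size0nil ->.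
have /mapP[d hd xd] : x \in map f D by rewrite (perm_mem h) mem_head.
have pe := perm_to_rem hd.
have [|D' p1 e1] := IH (rem d D).
  by rewrite -(perm_cons x) xd -[_ :: _]/(map f (d :: rem d D)) -xd (perm_trans _ h) // perm_map // perm_sym.
by exists (d :: D'); [rewrite (perm_trans pe) // perm_cons | rewrite /= e1 xd].
Qed.

Lemma perm_map_split (A : eqType) (f : A -> nat) (D : seq A) s r : perm_eq (map f D) (s ++ r) ->
  exists D1 D2, [/\ perm_eq D (D1 ++ D2), map f D1 = s & map f D2 = r].
Proof.
move=> /perm_map_inv[D' p e]; exists (take (size s) D'), (drop (size s) D').
by rewrite cat_take_drop map_take map_drop e take_size_cat // drop_size_cat.
Qed.

Lemma msub_perm (A : eqType) (s r : seq A) : (forall u, count_mem u s <= count_mem u r) ->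
  exists t, perm_eq r (s ++ t).
Proof.
elim: s r => [|x s IH] r h; first by exists r.
have hx : x \in r by rewrite -has_pred1 has_count; apply: leq_trans (h x); rewrite /= eqxx.
have pe := perm_to_rem hx.
have [u|t ht] := IH (rem x r); first by have := h u; rewrite (permP pe) /= leq_add2l.
by exists t; rewrite (perm_trans pe) // perm_cons.
Qed.

(** Induction on [p]. Finitely many tails suffice, each with a head at most [H]; a
    vector with head at least [H] is above one of these, and each of the finitely
    many smaller heads is treated by induction. *)
Lemma dickson p (Q : seq nat -> Prop) : exists l : seq (seq nat),
  (forall w, w \in l -> Q w) /\
  forall v, Q v -> size v = p -> exists2 w, w \in l & size w = p /\ all2 leq w v.
Proof.
elim: p Q => [|p IH] Q.
  case: (classic (Q [::])) => h.
    by exists [:: [::]]; split=> [w|v _ /size0nil ->]; [rewrite inE => /eqP -> | exists [::]].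
  by exists [::]; split=> // v hv /size0nil E; case: h; rewrite -E.
have [l0 [h1 h2]] := IH (fun w => exists c, Q (c :: w)).
have [H hH] : exists H, forall w, w \in l0 -> exists2 c, c <= H & Q (c :: w).
  elim: l0 h1 {h2} => [|w l0 IHl] h1; first by exists 0.
  have [H hH] := IHl (fun w hw => h1 w (mem_tail _ hw)).
  have [c hc] := h1 w (mem_head _ _); exists (maxn c H) => w'.
  rewrite inE => /predU1P[->|/hH [c' h' h'']]; first by exists c; rewrite ?leq_maxl.
  by exists c' => //; exact: leq_trans h' (leq_maxr c H).
have slices k : exists l : seq (seq nat), (forall w, w \in l -> Q w) /\ forall c v, c < k -> Q (c :: v) -> size v = p ->
    exists2 w, w \in l & size w = p.+1 /\ all2 leq w (c :: v).
  elim: k => [|H' [l [a1 a2]]]; first by exists [::].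
  have [l' [b1 b2]] := IH (fun w => Q (H' :: w)).
  exists (l ++ map (cons H') l'); split=> [w|c v].
    by rewrite mem_cat => /orP[/a1 //|/mapP[w' /b1 h ->]].
  rewrite ltnS leq_eqVlt => /orP[/eqP ->|hc] hQ hs.
    have [w hw [sw hle]] := b2 v hQ hs; exists (H' :: w); first by rewrite mem_cat map_f ?orbT.
    by rewrite /= leqnn sw.
  by have [w hw h] := a2 c v hc hQ hs; exists w => //; rewrite mem_cat hw.
have [l [a1 a2]] := slices H.
have tops : exists lt : seq (seq nat), (forall w, w \in lt -> Q w) /\ forall w, w \in l0 -> exists2 c, c <= H & c :: w \in lt.
  elim: l0 hH {h1 h2} => [|w l0 IHl] hH; first by exists [::].
  have [lt [b1 b2]] := IHl (fun w hw => hH w (mem_tail _ hw)).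
  have [c hc hQ] := hH w (mem_head _ _); exists ((c :: w) :: lt); split=> [w'|w'].
    by rewrite inE => /predU1P[->|/b1].
  rewrite inE => /predU1P[->|/b2 [c' h' h'']]; first by exists c; rewrite ?mem_head.
  by exists c' => //; rewrite inE h'' orbT.
have [lt [b1 b2]] := tops.
exists (l ++ lt); split=> [w|[//|c v] hQ [hs]]; first by rewrite mem_cat => /orP[/a1|/b1].
case: (ltnP c H) => hc.
  by have [w hw h] := a2 c v hc hQ hs; exists w => //; rewrite mem_cat hw.
have [|w hw [sw hle]] := h2 v _ hs; first by exists c.
have [c' hc' hw'] := b2 w hw; exists (c' :: w); first by rewrite mem_cat hw' orbT.
by rewrite /= sw (leq_trans hc' hc).
Qed.

End SeqFacts.

(** * The ideals attached to minimal shapes *)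

Lemma sumn_take_mono s t t' : t <= t' -> sumn (take t s) <= sumn (take t' s).
Proof.
elim: s t t' => [|x s IH] [|t] [|t'] //= h.
by rewrite leq_add2l IH.
Qed.

Lemma sumn_take_insert0 s r t : sumn (take t (s ++ 0 :: r)) <= sumn (take t (s ++ r)).
Proof.
elim: s t => [|x s IH] [|t] //=; last by rewrite leq_add2l IH.
by rewrite add0n; apply: sumn_take_mono.
Qed.

Section Final.
Variables (K : fieldType) (m n : nat) (le : rel (mxmonom m n)).
Notation P := (mxpoly_ring K m n).
Notation bp := (@bitab_poly K m n).
Variable I : P -> Prop.
Hypothesis hle : @diagonal_term_order K m n le.
Hypothesis hI : is_ideal I.
Hypothesis hshape : defined_by_shape I.
Hypothesis hG : G_KRS le I.
Implicit Types (D E : seq (seq (cell m n))) (s r : seq nat).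
Notation shape_in := (shape_in I).
Notation p := (pmin m n).

Definition good s := [/\ shape_in s, sorted geq s & pos_le p s].

Lemma pos_le_pos s : pos_le p s -> all (fun z => 0 < z) s.
Proof. by apply: sub_all => z /andP[]. Qed.

Lemma filter_pos s : all (fun z => 0 < z) s -> [seq z <- s | 0 < z] = s.
Proof. by move/all_filterP. Qed.

Lemma shape_in_le s : shape_in s -> all (fun z => z <= p) s.
Proof.
case=> D [hD sD _]; apply/allP => z hz; case: (posnP z) => [-> //|z0].
have : z \in [seq t <- s | 0 < t] by rewrite mem_filter z0.
rewrite -(perm_mem sD) mem_filter => /andP[_ /mapP[d hd ->]].
by apply: is_minor_size; apply: (allP hD).
Qed.

Lemma good_of_shape_in s : shape_in s -> sorted geq s -> good [seq z <- s | 0 < z].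
Proof.
move=> h ss; split.
- by apply: shape_in_eqsh h; rewrite /eqsh filter_id.
- by apply: sorted_filter ss; apply: geq_trans.
- apply/allP => z; rewrite mem_filter => /andP[-> /=]; exact: (allP (shape_in_le h)).
Qed.

(** By [KRS_down], the KRS monomial of [wideD] or [tallD] contains chains whose
    lengths are a shape of the ideal; this shape is dominated by [s] and differs
    from it. *)
Lemma unbalanced s a x0 : good s -> a \in s -> x0 \in s -> 2 <= a -> a + 2 <= x0 ->
  x0 < maxn m n -> exists r, [/\ good r, dom r s & r <> s].
Proof.
move=> [hS ss hp] ha hx0 a2 ax xm.
have [b [x [T [Z [N [es [bx xx0] [sT hT] sZ hZ]]]]]] := shape_split ss hp ha hx0 a2 ax.
have xp : x <= p.
  have : x \in s by rewrite es /tau mem_cat mem_head orbT.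
  by move/(allP hp)/andP => [].
have xm' : x <= m by move: xp; rewrite /pmin; clear; lia.
have xn' : x <= n by move: xp; rewrite /pmin; clear; lia.
have hT' : all (fun y => (x <= y) && (y <= minn m n)) T by exact: hT.
suff [E [cE sE SE dE nE]] : exists E : seq (seq pt), [/\ all chain E, sorted geq (map size E),
    shape_in (map size E), dom (map size [seq d <- E | 0 < size d]) s
    & map size [seq d <- E | 0 < size d] <> s].
  have e1 : map size [seq d <- E | 0 < size d] = [seq z <- map size E | 0 < z].
    by rewrite filter_map.
  exists [seq z <- map size E | 0 < z]; rewrite -e1; split=> //.
  by rewrite e1; apply: good_of_shape_in.
have flatE (E : seq (seq pt)) : flatten [seq d <- E | 0 < size d] = flatten E.
  by elim: E => //= d E IH; case: d => //= u d; rewrite IH.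
have chE (E : seq (seq pt)) : all chain E -> all chain [seq d <- E | 0 < size d].
  by rewrite all_filter; apply: sub_all => d hd; apply/implyP.
case: (ltnP x n) => xn.
  have [L rL pL] := wide_run N bx xm' xn' sT hT' sZ hZ xn.
  have [|E [cE sE SE cnt]] := KRS_down hle hshape hG (wideD_std N bx xm' xn' sT hT' sZ hZ xn)
    (wideD_inbox N bx xm' xn' sT hT' sZ hZ xn) rL pL.
    by rewrite tabl_sizes -/(tau b x T Z N) -es.
  have [|d1 d2] := wide_down bx xm' sT hT' sZ hZ (chE _ cE) (N := N); first by move=> u; rewrite flatE.
  by exists E; split=> //; rewrite es.
have xm1 : x < m by move: xn xm xx0 xn'; clear; lia.
have [L rL pL] := tall_run N bx xn' sT hT' sZ hZ.
have [|E [cE sE SE cnt]] := KRS_down hle hshape hG (tallD_std N bx xn' sT hT' sZ hZ)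
  (tallD_inbox N bx xm' xn' hT' hZ xm1) rL pL.
  by rewrite tabl_sizes -/(tau b x T Z N) -es.
have [|d1 d2] := tall_down bx xn' sT hT' sZ hZ (chE _ cE) (N := N); first by move=> u; rewrite flatE.
by exists E; split=> //; rewrite es.
Qed.

Lemma dom_trans s1 s2 s3 : dom s1 s2 -> dom s2 s3 -> dom s1 s3.
Proof. by move=> h1 h2 t; apply: leq_trans (h1 t) (h2 t). Qed.

Lemma dom_sumn s r : dom s r -> sumn s <= sumn r.
Proof.
move=> h; have := h (maxn (size s) (size r)).
by rewrite !take_oversize ?leq_maxl ?leq_maxr.
Qed.

(** A part of size [maxn m n] only occurs for [m = n]. *)
Definition nearly_balanced s := forall a x, a \in s -> x \in s -> 2 <= a -> a + 2 <= x -> maxn m n <= x.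

Lemma reduce s : good s -> exists r, [/\ good r, dom r s & nearly_balanced r].
Proof.
move=> gs; pose B := sumn s.
suff H k r : mu B r < k -> good r -> dom r s -> exists r', [/\ good r', dom r' s & nearly_balanced r'].
  by apply: (H (mu B s).+1 s) => // t.
elim: k r => // k IH r hk gr dr.
pose bad := has (fun a => has (fun x => [&& 2 <= a, a + 2 <= x & x < maxn m n]) r) r.
case: (boolP bad) => [/hasP[a ha /hasP[x hx /and3P[h1 h2 h3]]]|nb].
  have [r' [g' d' n']] := unbalanced gr ha hx h1 h2 h3.
  apply: (IH r') => //; last exact: dom_trans d' dr.
  have [_ _ p'] := g'; have [_ _ pr] := gr.
  have := mu_lt (pos_le_pos p') (pos_le_pos pr) (dom_sumn dr) d' n'.
  by rewrite -/B; move: hk; clear; lia.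
exists r; split=> // a x ha hx h1 h2; rewrite leqNgt; apply/negP => h3.
by case/negP: nb; apply/hasP; exists a => //; apply/hasP; exists x => //; rewrite h1 h2 h3.
Qed.

Lemma shape_in_cat s r : shape_in s -> all (fun z => z <= p) r -> shape_in (s ++ r).
Proof.
move=> [D [hD sD ID]] hr; pose F := map diag_row r.
have bF : all (all (inbox m n)) F by apply: inbox_diag.
exists (D ++ cellsD m n F); split.
- rewrite all_cat hD /=; apply: minor_cells => //.
  by apply/allP => _ /mapP[k _ ->]; apply: chain_diag.
- rewrite map_cat map_size_cells // map_size_diag /eqsh !filter_cat.
  by apply: perm_cat => //; exact: sD.
- by rewrite bitab_cat mulrC; have [_ _ h] := hI; apply: h.
Qed.

(** Induction on the sum of the squares of the parts: two parts of [s] that differ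
    by more than 1 are brought closer, and [move_box] leads back. *)
Lemma reshape_balanced big s r : shape_in (big ++ r) -> balanced big -> size s = size big ->
  sumn s = sumn big -> all (fun z => z <= p) (s ++ r) -> shape_in (s ++ r).
Proof.
move=> hS bb; move: {2}(sumn [seq z * z | z <- s]).+1 (ltnSn (sumn [seq z * z | z <- s])) => k.
elim: k s => // k IH s hk hsz hsum hp.
pose bad := has (fun y => has (fun x => y + 2 <= x) s) s.
case: (boolP bad) => [/hasP[y hy /hasP[x hx yx]]|nb]; last first.
  apply: shape_in_eqsh hS; apply: eqsh_perm; rewrite perm_cat2r; apply: balanced_perm => //.
  move=> u v hu hv; rewrite leqNgt; apply/negP => h; case/negP: nb.
  by apply/hasP; exists v => //; apply/hasP; exists u => //; rewrite addn2.
have p1 := perm_to_rem hx.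
have hy' : y \in rem x s.
  have : y \in x :: rem x s by rewrite -(perm_mem p1).
  by rewrite inE => /predU1P[E|//]; move: yx; rewrite E; clear; lia.
have p2 := perm_to_rem hy'.
set s' := rem y (rem x s) in p2.
have ps : perm_eq s [:: x, y & s'] by rewrite (perm_trans p1) // perm_cons.
have hall : all (fun z => z <= p) [:: x, y & s' ++ r].
  by rewrite -(perm_all _ (perm_cat ps (perm_refl r))).
have {hall} /and3P[xp yp sp] := hall.
have IHs : shape_in (([:: x.-1, y.+1 & s']) ++ r).
  apply: IH.
  - have := perm_sumn (perm_map (fun z => z * z) ps); rewrite /= => E; move: hk; rewrite E.
    by move: yx; clear; nia.
  - by rewrite -hsz (perm_size ps).
  - by rewrite -hsum (perm_sumn ps) /=; move: yx; clear; lia.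
  - by apply/and3P; split=> //; move: xp yx; clear; lia.
have h := move_box hle hshape hG (x := x.-1) (y := y.+1) (r := s' ++ r).
apply: (@shape_in_eqsh _ _ _ _ ([:: x.-1.+1, y.+1.-1 & s' ++ r])).
  apply: eqsh_perm; rewrite prednK; last by move: yx; clear; lia.
  by rewrite perm_sym -[_ :: _]/([:: x, y & s'] ++ r) perm_cat2r.
by apply: h => //; move: xp yx; clear; lia.
Qed.

Definition J_cap k d u : P -> Prop := set_inter (@J_ideal K m n k d) (ideal_exp (@det_ideal K m n 1) u).
Definition summand k d u v : P -> Prop :=
  if m == n then ideal_mul (J_cap k d u) (ideal_exp (@det_ideal K m n n) v) else J_cap k d u.

Definition admissible (A : P -> Prop) :=
  (exists k d u : nat, 0 < k /\ same_set A (J_cap k d u)) \/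
  (m = n /\ exists k d u v : nat, 0 < k /\
     same_set A (ideal_mul (J_cap k d u) (ideal_exp (@det_ideal K m n n) v))).

Lemma summand_admissible k d u v : 0 < k -> admissible (summand k d u v).
Proof.
rewrite /summand; case: eqP => [e|_] k0; [right | left].
  by split=> //; exists k, d, u, v; split.
by exists k, d, u; split.
Qed.

Lemma J_cap_ideal k d u : is_ideal (J_cap k d u).
Proof.
have [j0 jD jM] := @J_ideal_ideal K m n k d.
have [e0 eD eM] := ideal_exp_ideal (@det_ideal K m n 1) u.
split=> [|x y [h1 h2] [h3 h4]|a x [h1 h2]]; split; auto.
Qed.

Lemma summand_ideal k d u v : is_ideal (summand k d u v).
Proof. by rewrite /summand; case: eqP => _; [apply: ideal_gen_ideal | apply: J_cap_ideal]. Qed.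

(** A generator is the product of a bitableau with [k] minors of total size [d], of
    at least [l] variables and of [v] minors of size [n]. By box moves and additional
    factors, its shape is obtained from that of the hypothesis. *)
Lemma summand_sub k d u v l big : (m != n -> v = 0) ->
  size big = k -> sumn big = d -> u = d + l -> balanced big ->
  shape_in (nseq v n ++ big ++ nseq l 1) -> forall f, summand k d u v f -> I f.
Proof.
move=> v0 hk hd hu bb hS.
have key D L V : all (@is_minor m n) D -> size D = k -> degsum D = d -> u <= d + size L ->
    all (fun d => is_minor d && (size d == n)) V -> size V = v ->
    I (bp ((D ++ singles L) ++ V)).
  move=> hD sD dD hL hV sV.
  have hV' : all (@is_minor m n) V by apply: sub_all hV => e /andP[].
  have hall : all (@is_minor m n) ((D ++ singles L) ++ V).
    by rewrite !all_cat hD singles_minor hV'.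
  have szV : map size V = nseq v n.
    rewrite -sV; elim: V hV {sV hV' hall} => //= e V IH /andP[/andP[_ /eqP ->] /IH ->] //.
  have szL : map size (singles L) = nseq (size L) 1 by elim: (L) => //= z L' ->.
  apply: (shape_in_all hshape (s := map size D ++ (nseq (size L) 1 ++ nseq v n)) _ hall _); last first.
    by rewrite !map_cat szV szL catA; apply: eqsh_refl.
  have hle' : all (fun z => z <= p) (map size ((D ++ singles L) ++ V)).
    by apply/allP => _ /mapP[e he ->]; apply: is_minor_size; apply: (allP hall).
  apply: (@reshape_balanced big); rewrite ?size_map ?sD //.
  - have lL : l <= size L by move: hL; rewrite hu leq_add2l.
    apply: (@shape_in_eqsh _ _ _ _ ((nseq v n ++ big ++ nseq l 1) ++ nseq (size L - l) 1)).
      apply: eqsh_perm; apply/permP => a; rewrite !count_cat !count_nseq.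
      by move: lL; clear; nia.
    apply: shape_in_cat => //; apply/allP => z; rewrite mem_nseq => /andP[h /eqP ->].
    have : all (fun z => z <= p) (map size (singles L)).
      by move: hle'; rewrite !map_cat !all_cat => /andP[/andP[_ ->]].
    by rewrite szL all_nseq; move: h; clear; case: (size L).
  - by rewrite -hd in dD; rewrite -dD.
  - by move: hle'; rewrite !map_cat szV szL catA.
rewrite /summand; case: eqP v0 => [emn _|nmn /(_ isT) v0] f; last first.
  case=> h1 h2; move: f {h1 h2} (J_power_span h1 h2); apply: ideal_gen_min => // _ [D [L [hD sD dD hL ->]]].
  by rewrite -[_ ++ _]cats0; apply: key.
move=> h; have := @ideal_mul_gen _ (J_cap k d u) _ _ _
  (fun g hg => J_power_span (proj1 hg) (proj2 hg)) (@ideal_exp_gen K m n n v) f h.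
apply: ideal_gen_min => // _ [_ [_ [[D [L [hD sD dD hL ->]]] [V /andP[hV /eqP sV] ->] ->]]].
by rewrite -bitab_cat; apply: key.
Qed.

Lemma sum_all_max N s v : v * N <= sumn s -> size s <= v -> all (fun z => (0 < z) && (z <= N)) s ->
  s = nseq v N \/ N = 0.
Proof.
case: N => [|N]; first by right.
move=> h1 h2 h3; left; elim: v s h1 h2 h3 => [|v IH] [|z s] //= h1 h2 /andP[/andP[z0 zN] hs].
have hsum : sumn s <= size s * N.+1.
  elim: s hs {h1 h2} => //= y s IHs /andP[/andP[_ yN] /IHs h].
  by rewrite mulSn leq_add.
have szv : size s = v.
  apply/eqP; rewrite eqn_leq -ltnS h2 /= leqNgt; apply/negP => hlt.
  have : size s * N.+1 + N.+1 <= v * N.+1 by rewrite -mulSnr leq_mul2r hlt orbT.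
  by move: h1 hsum zN; rewrite mulSn; clear; lia.
rewrite szv in hsum; have ez : z = N.+1 by move: h1 hsum zN; rewrite mulSn; clear; lia.
have hv : v * N.+1 <= sumn s by move: h1; rewrite mulSn ez leq_add2l.
by rewrite ez (IH s) // szv.
Qed.

(** By dominance the first [v] minors have size [n], the next [k] have total size at
    least [d], so that [J_ideal_ge] applies, and the degree of the minors after the
    first [v] is at least [u]. *)
Lemma summand_mem k d u v l big s : (m != n -> v = 0) -> size big = k -> sumn big = d -> u = d + l ->
  sorted geq s -> pos_le p s ->
  (forall t, sumn (take t (nseq v n ++ big ++ nseq l 1)) <= sumn (take t s)) ->
  forall D, all (@is_minor m n) D -> eqsh (map size D) s -> summand k d u v (bp D).
Proof.
move=> v0 hk hd hu ss hp hdom D hD hsh.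
have [D' [bD' pD' sD']] := bitableau_sort hD.
pose E := [seq e <- D' | 0 < size e].
have mE : all (@is_minor m n) E.
  by rewrite all_filter; case/andP: bD' => h _; apply: sub_all h => e h; apply/implyP.
have szE : map size E = s.
  rewrite /E -[LHS]/(map size [seq e <- D' | 0 < size e]) -(filter_map size (fun z => 0 < z)).
  rewrite -[LHS]/(Defs.shape D') sD'; apply: (sorted_eq geq_trans).
  - by move=> a b; rewrite /geq /= => h'; apply/eqP; rewrite eqn_leq andbC.
  - by apply: sort_sorted geq_total _.
  - exact: ss.
  - rewrite perm_sort; apply: perm_trans hsh _.
    by rewrite filter_pos // (pos_le_pos hp).
have bE : bp D = bp E.
  rewrite (bitab_perm _ pD') /E; elim: (D') => //= e F IH.
  by case: e => [|y e] /=; rewrite !bitab_cons IH // minor_poly_nil mul1r.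
rewrite bE; pose V := take v E; pose R := drop v E.
have mV : all (@is_minor m n) V by apply/allP => e /mem_take; exact: (allP mE).
have mR : all (@is_minor m n) R by apply/allP => e /mem_drop; exact: (allP mE).
have szR : map size R = drop v s by rewrite map_drop szE.
have szV : map size V = take v s by rewrite map_take szE.
have tv : take v (nseq v n ++ big ++ nseq l 1) = nseq v n by rewrite take_size_cat ?size_nseq.
have tvk : take (v + k) (nseq v n ++ big ++ nseq l 1) = nseq v n ++ big.
  by rewrite catA take_size_cat // size_cat size_nseq hk.
have Vn : sumn (take v s) = v * n /\ all (fun z => z == n) (take v s) /\ (size (take v s) = v \/ n = 0 /\ take v s = [::]).
  case: (eqVneq m n) => [e|ne]; last by rewrite (v0 ne) take0 mul0n; split=> //; split=> //; left.
  have hpn : all (fun z => (0 < z) && (z <= n)) (take v s).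
    apply/allP => z /mem_take /(allP hp) /andP[-> h] /=; move: h; rewrite /pmin; clear; lia.
  have hv := hdom v; rewrite tv sumn_nseq mulnC in hv.
  case: (sum_all_max hv _ hpn) => [|E1|n0].
  - by rewrite size_take; case: ltnP => // h; exact: ltnW.
  - rewrite E1 sumn_nseq mulnC all_nseq eqxx orbT size_nseq; split=> //; split=> //; by left.
  - have : take v s = [::].
      case: (take v s) hpn => // z t /= /andP[/andP[]]; rewrite n0; clear; lia.
    by move=> ->; rewrite n0 muln0; split=> //; split=> //; right.
have [sV [aV cV]] := Vn.
have baseR : J_cap k d u (bp R).
  have degR : degsum R = sumn (drop v s) by rewrite /degsum szR.
  split; last first.
    apply: power_ideal_in => w /bitab_mdeg ->; rewrite degR.
    have := hdom (maxn (size s) (size (nseq v n ++ big ++ nseq l 1))).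
    rewrite !take_oversize ?leq_maxl ?leq_maxr // !sumn_cat !sumn_nseq -{1}(cat_take_drop v s) sumn_cat sV.
    by rewrite hd hu mul1n mulnC leq_add2l.
  pose R1 := take k R ++ nseq (k - size (take k R)) [::].
  have szR1 : size R1 = k.
    by rewrite size_cat size_nseq subnKC // size_take; case: ltnP => // h; exact: ltnW.
  have eR : bp R = (bp (drop k R) * bp R1)%R.
    by rewrite bitab_pad mulrC -bitab_cat cat_take_drop.
  rewrite eR; have [_ _ jM] := @J_ideal_ideal K m n k d; apply: jM.
  rewrite -szR1; apply: J_ideal_ge.
    rewrite all_cat all_nseq orbT andbT.
    by apply/allP => e /mem_take; exact: (allP mR).
  have -> : degsum R1 = sumn (take k (drop v s)).
    rewrite /degsum map_cat sumn_cat map_nseq sumn_nseq mul0n addn0 map_take szR //.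
  have := hdom (v + k); rewrite tvk sumn_cat sumn_nseq hd.
  by rewrite takeD sumn_cat sV mulnC leq_add2l.
have eE : bp E = (bp R * bp V)%R by rewrite mulrC -bitab_cat cat_take_drop.
rewrite /summand; case: eqP => [emn|nmn]; last first.
  rewrite eE; have [_ _ bM] := J_cap_ideal k d u; rewrite mulrC; exact: bM.
case: cV => [cV|[n0 t0]].
  rewrite eE; apply: ideal_mul_in => //.
  have -> : v = size V by rewrite -(size_map size V) szV cV.
  apply: bitab_ideal_exp => e he; apply: ideal_gen_in; exists e => //.
  rewrite (allP mV) //=; have : size e \in map size V by apply: map_f.
  by rewrite szV => /(allP aV).
(* For [n = 0] there are no minors of positive size to make up the factor in the
   power of I_n, but the empty minor shows that I_n is the whole ring. *)
have full w : ideal_exp (@det_ideal K m n n) w 1%R.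
  elim: w => [|w IHw] //=; rewrite -[1%R]mulr1; apply: ideal_mul_in => //.
  apply: ideal_gen_in; exists [::]; rewrite ?minor_poly_nil //=.
  by rewrite n0.
have eV : V = [::] by apply/size0nil; rewrite -(size_map size V) szV t0.
rewrite eE eV; apply: ideal_mul_in => //.
by rewrite /bitab_poly big_nil.
Qed.

(** * The decomposition of the ideal *)

Lemma nearly_split r : good r -> nearly_balanced r -> exists v big l,
  [/\ m != n -> v = 0, 0 < size big, balanced big,
      eqsh r (nseq v n ++ big ++ nseq l 1)
    & forall t, sumn (take t (nseq v n ++ big ++ nseq l 1)) <= sumn (take t r)].
Proof.
move=> [hS ss hp] hn.
have [v [r2 [er v0 sr2 hr2]]] : exists v r2, [/\ r = nseq v n ++ r2, m != n -> v = 0,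
    sorted geq r2 & {in r2, forall z, m = n -> z < n}].
  case: (eqVneq m n) => [emn|nmn]; last by exists 0, r; split=> // z _ e; rewrite e eqxx in nmn.
  exists (size [seq z <- r | n <= z]), [seq z <- r | z < n]; split.
  - rewrite {1}(sorted_split n ss); congr cat; apply/all_pred1P/allP => z.
    rewrite mem_filter => /andP[nz /(allP hp) /andP[_]]; rewrite /pmin emn minnn /= => zn.
    by rewrite eqn_leq zn nz.
  - by [].
  - by apply: sorted_filter ss; apply: geq_trans.
  - by move=> z; rewrite mem_filter => /andP[].
have hp2 : pos_le p r2 by move: hp; rewrite er /pos_le all_cat => /andP[].
pose big0 := [seq z <- r2 | 2 <= z]; pose l := size [seq z <- r2 | z < 2].
have e2 : r2 = big0 ++ nseq l 1.
  rewrite {1}(sorted_split 2 sr2); congr cat; apply/all_pred1P/allP => z.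
  rewrite mem_filter => /andP[z2 /(allP hp2) /andP[z0 _]]; move: z2 z0 => /=; clear; lia.
have bb : balanced big0.
  move=> x a; rewrite !mem_filter => /andP[x2 xr] /andP[a2 ar]; rewrite leqNgt; apply/negP => h.
  have hmem z : z \in r2 -> z \in r by rewrite er mem_cat orbC => ->.
  have := hn a x (hmem _ ar) (hmem _ xr) a2; rewrite addn2 => /(_ h) hx.
  have := allP hp2 _ xr; have := hr2 _ xr; move: hx; rewrite /pmin /=; clear; lia.
case: (posnP (size big0)) => [b0|bpos]; last first.
  exists v, big0, l; rewrite -e2 -er; split=> //; exact: eqsh_refl.
have {}b0 := size0nil b0.
(* Without parts strictly between 1 and the full size, an empty minor provides the
   required k = 1, with d = 0. *)
exists v, [:: 0], l; split=> //.
- by move=> x y; rewrite !inE => /eqP -> /eqP ->.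
- by rewrite er e2 b0 /eqsh !filter_cat.
- by move=> t; rewrite er e2 b0; apply: sumn_take_insert0.
Qed.

Definition covers (A : P -> Prop) s := [/\ admissible A, is_ideal A, forall f, A f -> I f
  & forall D, all (@is_minor m n) D -> eqsh (map size D) s -> A (bp D)].

Lemma cover_shape s : good s -> exists A, covers A s.
Proof.
move=> gs; have [r [gr dr nr]] := reduce gs.
have [v [big [l [v0 kp bb sh ht]]]] := nearly_split gr nr.
exists (summand (size big) (sumn big) (sumn big + l) v); split.
- exact: summand_admissible.
- exact: summand_ideal.
- apply: (summand_sub (l := l) v0 erefl erefl erefl bb).
  by apply: shape_in_eqsh sh _; case: gr.
- have [_ ss hp] := gs.
  have hd t : sumn (take t (nseq v n ++ big ++ nseq l 1)) <= sumn (take t s).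
    exact: leq_trans (ht t) (dr t).
  by move=> D hD hDs; exact: (summand_mem v0 erefl erefl erefl ss hp hd hD hDs).
Qed.

Definition multiplicities s := [seq count_mem i.+1 s | i <- iota 0 p].

Lemma multiplicities_le s r : pos_le p s -> all2 leq (multiplicities s) (multiplicities r) ->
  forall u, count_mem u s <= count_mem u r.
Proof.
move=> hp h u; case: (boolP (u \in s)) => [/(allP hp)/andP[u0 up]|/count_memPn -> //].
have hu : u.-1 < p by rewrite prednK.
have {h} h : forall i, i < p -> count_mem i.+1 s <= count_mem i.+1 r.
  move: h; rewrite /multiplicities; move: p => q h i hi.
  have {}hi : i \in iota 0 q by rewrite mem_iota.
  elim: (iota 0 q) h hi => //= j js IH /andP[h1 /IH h2]; rewrite inE => /predU1P[->|/h2] //.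
by have := h _ hu; rewrite prednK.
Qed.

(** Dickson's lemma, applied to the vectors of multiplicities of the parts. *)
Lemma finite_cover : exists (N : nat) (F : nat -> P -> Prop) (S : nat -> seq nat),
  (forall i, i < N -> covers (F i) (S i) /\ good (S i)) /\
  forall s, good s -> exists2 i, i < N & all2 leq (multiplicities (S i)) (multiplicities s).
Proof.
have [l [h1 h2]] := dickson p (fun w => exists2 s, good s & multiplicities s = w).
have [F [S hFS]] : exists (F : nat -> P -> Prop) (S : nat -> seq nat), forall i, i < size l ->
    [/\ covers (F i) (S i), good (S i) & multiplicities (S i) = nth [::] l i].
  elim: l h1 {h2} => [|w l IH] h1; first by exists (fun _ _ => True), (fun=> [::]).
  have [F [S hFS]] := IH (fun w' hw' => h1 w' (mem_tail _ hw')).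
  have [s gs es] := h1 w (mem_head _ _); have [A hA] := cover_shape gs.
  exists (fun i => if i is j.+1 then F j else A), (fun i => if i is j.+1 then S j else s).
  by move=> [|i] /= hi; [split | apply: hFS].
exists (size l), F, S; split=> [i /hFS[]//|s gs].
have [||w hw [_ hle']] := h2 (multiplicities s); first by exists s.
  by rewrite size_map size_iota.
exists (index w l); first by rewrite index_mem.
have [_ _ ->] := hFS _ (etrans (index_mem w l) hw).
by rewrite nth_index.
Qed.

(** A bitableau whose shape has at least the multiplicities of a shape covered by a
    summand is a multiple of a bitableau of that shape. *)
Lemma finite_decomposition : exists (N : nat) (A : 'I_N -> P -> Prop),
  (forall i, admissible (A i)) /\ same_set I (ideal_sum (fun _ : 'I_N => True) A).
Proof.
have [N [F [S [hF hS]]]] := finite_cover.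
exists N, (fun i => F (nat_of_ord i)); split; first by move=> i; have [[]] := hF _ (ltn_ord i).
move=> f; split; last first.
  move: f; apply: ideal_gen_min => // f [i _ hf].
  by have [[_ _ h _] _] := hF _ (ltn_ord i); apply: h.
have [[G hGb hGen] _] := hshape.
move/hGen; move: f; apply: ideal_gen_mono => _ [D GD ->].
have ID : I (bp D) by apply/hGen; apply: ideal_gen_in; exists D.
have bD := hGb _ GD; have [mD sD] := andP bD.
have gs : good [seq z <- map size D | 0 < z].
  by apply: good_of_shape_in => //; exists D; split=> //; apply: eqsh_refl.
have [i hi hle'] := hS _ gs.
have [[_ iF _ hmem] gSi] := hF _ hi; have [_ _ pSi] := gSi.
have [t ht] := msub_perm (multiplicities_le pSi hle').
pose E := [seq d <- D | 0 < size d].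
have eE : bp D = bp E.
  rewrite /E; elim: (D) => //= e E' IH.
  by case: e => [|y e] /=; rewrite !bitab_cons IH // minor_poly_nil mul1r.
have mE : all (@is_minor m n) E.
  by rewrite all_filter; apply: sub_all mD => e h; apply/implyP.
have [|D1 [D2 [pE e1 e2]]] := @perm_map_split _ size E (S i) t.
  by rewrite /E -(filter_map size (fun z => 0 < z)).
apply: ideal_gen_in; exists (Ordinal hi) => //=.
rewrite eE (bitab_perm _ pE) bitab_cat mulrC; have [_ _ hM] := iF; apply: hM.
apply: hmem; last by rewrite e1; apply: eqsh_refl.
by move: mE; rewrite (perm_all _ pE) all_cat => /andP[].
Qed.

End Final.

Local Open Scope ring_scope.

Theorem theorem6p3 (K : fieldType) (m n : nat) (le : rel (mxmonom m n))
    (hle : @diagonal_term_order K m n le)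
    (I : mxpoly_ring K m n -> Prop) (hI : is_ideal I)
    (hshape : defined_by_shape I) (hG : G_KRS le I) :
  exists (N : nat) (A : 'I_N -> mxpoly_ring K m n -> Prop),
    (forall i : 'I_N,
       (exists k d u : nat, (0 < k)%N /\
          same_set (A i)
            (set_inter (J_ideal k d) (ideal_exp (det_ideal 1) u)))
       \/ (m = n /\
           exists k d u v : nat, (0 < k)%N /\
             same_set (A i)
               (ideal_mul (set_inter (J_ideal k d) (ideal_exp (det_ideal 1) u))
                          (ideal_exp (det_ideal n) v))))
    /\ same_set I (ideal_sum (fun _ : 'I_N => True) A).
Proof. exact: finite_decomposition hle hI hshape hG. Qed.
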